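(* Let $G$ be an infinite connected graph and let $\Psi\subseteq\Omega(G)$ be a Borel set of ends all of which are undominated. Then there is a matroid $M$ on $E(G)$ whose set of circuits is the set of minimal nonempty elements of $\mathcal C_\Psi$ and whose set of cocircuits is the set of minimal nonempty elements of $\mathcal D_\Psi$.
   Context: Ends are equivalence classes of rays, two rays being equivalent if for every finite vertex set $S$ they have tails in the same component of $G-S$; $C(S,\omega)$ is the component of $G-S$ containing tails of rays of $\omega$. $\Omega(G)$ is topologised by the basic open sets consisting of the ends living in a fixed component $C$ of $G-S$, $S$ finite; Borel refers to this topology. A vertex $v$ dominates $\omega$ if there are infinitely many paths from $v$ to a ray of $\omega$ pairwise meeting only in $v$. An end $\omega$ is in the closure of an edge set $F$ if for every finite vertex set $S$ some edge of $F$ has an endvertex in $C(S,\omega)$. ''Even'' means finite and a multiple of $2$. A cut is the set of edges between the classes of a partition of $V(G)$; it is finitely coverable if some finite vertex set meets all its edges. An edge set $F$ is geometrically connected if $F$ meets every finitely coverable cut $b$ such that at least two components of $G-b$ contain edges of $F$. $\mathcal C_\Psi$ is the set of edge sets that meet every finitely coverable cut evenly, are geometrically connected, and have only ends of $\Psi$ in their closure. $\mathcal D_\Psi$ is the set of cuts of $G$ that have no end of $\Psi$ in their closure. Matroids are (possibly infinite) matroids in the sense of Bruhn, Diestel, Kriesell, Pendavingh and Wollan; cocircuits are circuits of the dual. *)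

(* Defs.v *)
From HB Require Import structures.
From mathcomp Require Import all_boot all_order.
From mathcomp Require Import finmap all_classical.
From mathcomp Require Import topology measurable_structure.

Set Implicit Arguments.
Unset Strict Implicit.
Unset Printing Implicit Defensive.

Local Open Scope classical_set_scope.
Local Open Scope card_scope.

Section SetFamilies.
Variable U : Type.
Implicit Types F : set (set U).

Definition minimal_in F : set (set U) :=
  [set A | F A /\ forall B, F B -> B `<=` A -> B = A].

Definition maximal_in F : set (set U) :=
  [set A | F A /\ forall B, F B -> A `<=` B -> B = A].

Definition minimal_nonempty F : set (set U) :=
  minimal_in [set A | F A /\ A !=set0].

End SetFamilies.

(* The independence axioms (I1), (I2), (I3), (IM) of Bruhn, Diestel, Kriesell,
   Pendavingh and Wollan, for the ground set E. *)
Record matroid (U : Type) (E : set U) := Matroid {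
  indep : set (set U);
  indep_ground : forall I, indep I -> I `<=` E;
  indep_set0 : indep set0;
  indep_subset : forall I J, indep J -> I `<=` J -> indep I;
  indep_augment : forall I J,
    indep I -> ~ maximal_in indep I -> maximal_in indep J ->
    exists2 x, (J `\` I) x & indep (x |` I);
  indep_maximal : forall I X, indep I -> I `<=` X -> X `<=` E ->
    maximal_in [set J | [/\ indep J, I `<=` J & J `<=` X]] !=set0
}.

Section MatroidNotions.
Variables (U : Type) (E : set U).
Implicit Types M : matroid E.

Definition base M : set (set U) := maximal_in (indep M).

Definition circuit M : set (set U) :=
  minimal_in [set C | C `<=` E /\ ~ indep M C].

Lemma baseW M B I : base M B -> indep M I -> B `<=` I -> I = B.
Proof. by move=> [_ h]; exact: h. Qed.

Lemma extend_base M B I X : base M B -> B `<=` X -> X `<=` E ->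
  indep M I -> I `<=` X -> exists B', [/\ base M B', I `<=` B' & B' `<=` X].
Proof.
move=> bB BX XE iI IX.
have [B' [[iB' IB' B'X] mB']] := indep_maximal iI IX XE.
exists B'; split => //; apply: contrapT => nB'.
have [x [Bx nB'x] ix] := indep_augment iB' nB' bB.
apply: nB'x; rewrite -(mB' (x |` B')); first by left.
  split=> //; first by move=> y /IB'; right.
  by move=> y [->|/B'X//]; exact: BX.
by move=> y; right.
Qed.

Lemma base_exists M : exists B, base M B.
Proof.
have [B [[iB _ BE] mB]] := indep_maximal (indep_set0 M) (@sub0set _ E) (@subset_refl _ E).
exists B; split=> // C iC BC; apply: mB => //; split=> //.
exact: indep_ground iC.
Qed.

Definition dual_indep M : set (set U) :=
  [set I | exists2 B, base M B & I `<=` E `\` B].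

Fact dual_base M I : maximal_in (dual_indep M) I <->
  exists2 B, base M B & I = E `\` B.
Proof.
split=> [[[B bB IB] mI]|[B bB ->]].
  by exists B => //; rewrite (mI (E `\` B)) //; exists B.
split; first by exists B.
move=> J [B' bB' JB'] BJ; apply/seteqP; split => // x /JB'[Ex nB'x].
split=> // Bx; apply: nB'x.
have -> // : B' = B.
apply/esym; apply: (baseW bB' bB.1) => y B'y; apply: contrapT => nBy.
have Ey := indep_ground bB'.1 B'y.
by have /JB'[] : J y by exact: BJ.
Qed.

Fact dual_ground M I : dual_indep M I -> I `<=` E.
Proof. by move=> [B _ IB] x /IB[]. Qed.

Fact dual_set0 M : dual_indep M set0.
Proof. by have [B bB] := base_exists M; exists B. Qed.

Fact dual_subset M I J : dual_indep M J -> I `<=` J -> dual_indep M I.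
Proof. by move=> [B bB JB] IJ; exists B => // x /IJ /JB. Qed.

Fact dual_augment M I J : dual_indep M I -> ~ maximal_in (dual_indep M) I ->
  maximal_in (dual_indep M) J ->
  exists2 x, (J `\` I) x & dual_indep M (x |` I).
Proof.
move=> [B bB IB] nI /dual_base[B' bB' ->].
have IE x : I x -> E x by move=> /IB[].
have [||||B2 [bB2 B'B2 B2I]] := @extend_base M B (B' `\` I) (E `\` I) bB.
- by move=> x Bx; split; [exact: (indep_ground bB.1)|move=> /IB[]].
- by move=> x [].
- by apply: indep_subset bB'.1 _ => x [].
- by move=> x [B'x]; split=> //; exact: (indep_ground bB'.1).
have [x [[Ex nIx] nB2x]] : exists x, (E `\` I) x /\ ~ B2 x.
  apply: contrapT => h; apply/nI/dual_base; exists B2 => //.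
  apply/seteqP; split=> [x Ix|x [Ex nB2x]].
    by split; [exact: IE|move=> /B2I[]].
  by apply: contrapT => nIx; apply: h; exists x.
exists x.
  by split=> //; split=> // B'x; apply: nB2x; exact: B'B2.
exists B2 => // y [->//|Iy]; split; [exact: IE|by move=> /B2I[]].
Qed.

Fact dual_maximal M I X : dual_indep M I -> I `<=` X -> X `<=` E ->
  maximal_in [set J | [/\ dual_indep M J, I `<=` J & J `<=` X]] !=set0.
Proof.
move=> [B bB IB] IX XE.
have [K [[iK _ KX] mK]] : maximal_in [set J | [/\ indep M J, set0 `<=` J
    & J `<=` E `\` X]] !=set0.
  by apply: indep_maximal (indep_set0 M) _ _ => // x [].
have [||||B2 [bB2 KB2 B2I]] := @extend_base M B K (E `\` I) bB.
- by move=> x Bx; split; [exact: (indep_ground bB.1)|move=> /IB[]].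
- by move=> x [].
- exact: iK.
- by move=> x /KX[Ex nXx]; split=> // /IX.
exists (X `\` B2); split.
  split; [|by move=> x Ix; split; [exact: IX|move=> /B2I[]]|by move=> x []].
  by exists B2 => // x [/XE].
move=> J [[B3 bB3 JB3] IJ JX] XJ; apply/seteqP; split=> // y Jy.
split; first exact: JX.
move=> B2y; have [_ nB3y] := JB3 _ Jy.
have iBy : indep M (B2 `\ y) by apply: indep_subset bB2.1 _ => z [].
have nBy : ~ maximal_in (indep M) (B2 `\ y).
  move=> h; have E2 : B2 = B2 `\ y by apply: (baseW h bB2.1) => z [].
  by move: B2y; rewrite E2 => -[_]; apply.
have [x [B3x nBx] ix] := indep_augment iBy nBy bB3.
have xy : x <> y by move=> xy; apply: nB3y; rewrite -xy.
have nB2x : ~ B2 x by move=> B2x; apply: nBx.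
have nXx : ~ X x by move=> Xx; have /JB3[] : J x by exact: XJ.
apply/nB2x/KB2; rewrite -(mK (x |` K)); first by left.
  split=> //.
  - apply: indep_subset ix _ => z [->|Kz]; first by left.
    right; split; first exact: KB2.
    by move=> zy; have [_] := KX _ Kz; apply; rewrite zy; exact: JX.
  - by move=> z [->|/KX//]; split=> //; exact: (indep_ground bB3.1).
by move=> z; right.
Qed.

Definition dual M : matroid E :=
  Matroid (@dual_ground M) (@dual_set0 M) (@dual_subset M)
    (@dual_augment M) (@dual_maximal M).

Definition cocircuit M : set (set U) := circuit (dual M).

End MatroidNotions.

Record graph (T : choiceType) := Graph {
  vertices : set T;
  edges : set (set T);
  edge_pair : forall e, edges e -> exists u v,
    [/\ vertices u, vertices v, u <> v & e = [set u; v]]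
}.

Section Graphs.
Variable T : choiceType.
Implicit Types (G : graph T) (S C : set T) (F b : set (set T)) (r : nat -> T).

Definition adjacent G : rel T := fun u v => `[< edges G [set u; v] >].

(* u :: p is the vertex sequence of a path of G. *)
Definition is_path G (u : T) (p : seq T) : Prop :=
  [/\ vertices G u, path (adjacent G) u p & uniq (u :: p)].

Definition linked G (u v : T) : Prop :=
  exists2 p, is_path G u p & last u p = v.

Definition connected_graph G : Prop :=
  vertices G !=set0 /\
  forall u v, vertices G u -> vertices G v -> linked G u v.

(* Components are represented by their vertex sets. *)
Definition component G : set (set T) :=
  [set [set v | linked G u v] | u in vertices G].

Fact del_vertices_pair G S e : edges G e /\ e `&` S = set0 ->
  exists u v, [/\ (vertices G `\` S) u, (vertices G `\` S) v,
                  u <> v & e = [set u; v]].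
Proof.
move=> [/edge_pair[u [v [Gu Gv uv ->]]] /disjoints_subset eS].
by exists u, v; do !split => //; apply: eS; [left|right].
Qed.

Definition del_vertices G S : graph T := Graph (@del_vertices_pair G S).

Fact del_edges_pair G b e : (edges G `\` b) e ->
  exists u v, [/\ vertices G u, vertices G v, u <> v & e = [set u; v]].
Proof. by move=> [/edge_pair]. Qed.

Definition del_edges G b : graph T := Graph (@del_edges_pair G b).

Definition finite_vertex_set G S : Prop := finite_set S /\ S `<=` vertices G.

Definition ray G : set (nat -> T) :=
  [set r | [/\ forall i, vertices G (r i), injective r
             & forall i, adjacent G (r i) (r i.+1)]].

Definition tail_in r C : Prop := \forall i \near \oo, C (r i).

Definition ray_equiv G r r' : Prop :=
  forall S, finite_vertex_set G S ->
  exists2 C, component (del_vertices G S) C & tail_in r C /\ tail_in r' C.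

Record graph_end G := GraphEnd {
  rays_of :> set (nat -> T);
  graph_endP : exists2 r, ray G r &
    rays_of = [set r' | ray G r' /\ ray_equiv G r r']
}.

Definition lives_in G (w : graph_end G) C : Prop :=
  forall r, rays_of w r -> tail_in r C.

Lemma adjacent_vertices G u v : adjacent G u v -> vertices G v.
Proof.
move=> /asboolP /edge_pair[a [c [Ga Gc _ E]]].
have : [set u; v] v by right.
by rewrite E => -[->|->].
Qed.

Lemma path_linked G u p : vertices G u -> path (adjacent G) u p ->
  linked G u (last u p).
Proof. by move=> Gu /shortenP[q qp uq _]; exists q. Qed.

Lemma linked_refl G u : vertices G u -> linked G u u.
Proof. by move=> Gu; exists [::]. Qed.

Lemma linked_vertices G u v : linked G u v -> vertices G v.
Proof.
move=> [p [Gu + _] <-]; elim: p u Gu => [//|x p IHp] u Gu /= /andP[ux].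
exact/IHp/(adjacent_vertices ux).
Qed.

Lemma linked_trans G u v w : linked G u v -> linked G v w -> linked G u w.
Proof.
move=> [p [Gu pp _] pv] [q [_ qp _] <-].
rewrite -pv -last_cat; apply: path_linked => //.
by rewrite cat_path pp pv.
Qed.

Lemma linked_sym G u v : linked G u v -> linked G v u.
Proof.
move=> uv; have Gv := linked_vertices uv; case: uv => p [Gu pp _] pv.
have -> : u = last v (rev (belast u p)).
  by case: p pp pv => [_ /= <-//|x p _ _]; rewrite /= rev_cons last_rcons.
apply: path_linked => //; rewrite -pv rev_path.
rewrite (@eq_path _ _ (adjacent G)) // => a c.
by rewrite /adjacent setUC.
Qed.

Lemma component_eq G C C' x : component G C -> component G C' ->
  C x -> C' x -> C = C'.
Proof.
move=> [u _ <-] [v _ <-] /= ux vx; apply/seteqP; split => y /= h.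
  exact/(linked_trans vx)/(linked_trans (linked_sym ux)).
exact/(linked_trans ux)/(linked_trans (linked_sym vx)).
Qed.

Lemma linked_del_vertices G S S' u v : S `<=` S' ->
  linked (del_vertices G S') u v -> linked (del_vertices G S) u v.
Proof.
move=> SS' [p [[Gu nS'u] pp up] <-]; apply: path_linked.
  by split=> // /SS'.
apply: sub_path pp => x y /asboolP[xy xyS']; apply/asboolP; split=> //.
apply/disjoints_subset => z xyz /SS' S'z.
by have : ([set x; y] `&` S') z by []; rewrite xyS'.
Qed.

Lemma ray_avoids G S r : ray G r -> finite_set S ->
  \forall i \near \oo, ~ S (r i).
Proof.
move=> [_ ri _] fS.
have /finite_fsetP[X EX] : finite_set (r @^-1` S).
  by apply: finite_preimage => // x y _ _; exact: ri.
exists (\max_(i <- X) i).+1 => // i /= Xi Si.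
have : [set` X] i by rewrite -EX.
move=> /= iX; have := @leq_bigmax_seq _ (X : seq nat) xpredT id i iX isT.
by rewrite leqNgt Xi.
Qed.

Lemma ray_tail G S r : ray G r -> finite_vertex_set G S ->
  exists2 C, component (del_vertices G S) C & tail_in r C.
Proof.
move=> rr [fS SG]; have [n _ nS] := ray_avoids rr fS.
case: rr => Gr ri ra.
have Gn i : n <= i -> vertices (del_vertices G S) (r i).
  by move=> ni; split=> //; exact: nS.
exists [set v | linked (del_vertices G S) (r n) v].
  by exists (r n) => //; exact: Gn.
exists n => // i /= /subnKC <-; elim: (i - n) => [|k IHk].
  by rewrite addn0; exact/linked_refl/Gn.
apply: (linked_trans IHk); rewrite addnS.
apply: (@path_linked _ (r (n + k)) [:: r (n + k).+1]).
  by apply: Gn; rewrite leq_addr.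
rewrite /= andbT; apply/asboolP; split; first exact/asboolP/ra.
apply/disjoints_subset => z [->|->]; apply: nS => /=.
  by rewrite leq_addr.
by rewrite -addnS leq_addr.
Qed.

Lemma tail_in_common r C C' : tail_in r C -> tail_in r C' ->
  exists x, C x /\ C' x.
Proof.
move=> rC rC'; have [n _ h] : \forall i \near \oo, C (r i) /\ C' (r i).
  by near do split.
by exists (r n); apply: h => /=.
Unshelve. all: by end_near. Qed.

Lemma end_lives G (w : graph_end G) S : finite_vertex_set G S ->
  exists2 C, component (del_vertices G S) C & lives_in w C.
Proof.
move=> fS; case: (graph_endP w) => r rr Ew.
have [C cC rC] := ray_tail rr fS; exists C => // r'.
rewrite Ew => -[rr' /(_ S fS)[C' cC' [rC' r'C']]].
have [x [Cx C'x]] := tail_in_common rC rC'.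
by rewrite (component_eq cC cC' Cx C'x).
Qed.

Lemma end_nonempty G (w : graph_end G) : exists r, rays_of w r.
Proof.
case: (graph_endP w) => r rr Ew; exists r; rewrite Ew; split=> //.
by move=> S fS; have [C] := ray_tail rr fS; exists C.
Qed.

HB.instance Definition _ G := gen_eqMixin (graph_end G).
HB.instance Definition _ G := gen_choiceMixin (graph_end G).

(* Indices (S, C) of the basic open sets of the end space. *)
Definition end_base_index G : set (set T * set T) :=
  [set SC | finite_vertex_set G SC.1 /\ component (del_vertices G SC.1) SC.2].

Definition end_base_open G (SC : set T * set T) : set (graph_end G) :=
  [set w | lives_in w SC.2].

Fact end_base_cover G :
  \bigcup_(SC in @end_base_index G) @end_base_open G SC = setT.
Proof.
rewrite -subTset => w _.
have f0 : finite_vertex_set G set0 by split.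
by have [C cC wC] := end_lives w f0; exists (set0, C).
Qed.

Fact end_base_join G i j (w : graph_end G) :
  end_base_index G i -> end_base_index G j ->
  end_base_open i w -> end_base_open j w ->
  exists k, [/\ end_base_index G k, end_base_open k w
    & @end_base_open G k `<=` end_base_open i `&` end_base_open j].
Proof.
case: i j => [S C] [S' C'] [/= [fS SG] cC] [/= [fS' S'G] cC'] wC wC'.
have fU : finite_vertex_set G (S `|` S').
  by split; [rewrite finite_setU|move=> x []; [exact: SG|exact: S'G]].
have [K cK wK] := end_lives w fU.
have [r wr] := end_nonempty w.
have sub S1 C1 : S1 `<=` S `|` S' -> component (del_vertices G S1) C1 ->
    tail_in r C1 -> K `<=` C1.
  move=> SS [u Gu <-] rC1.
  have [x [/= ux]] := tail_in_common rC1 (wK r wr).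
  case: cK => v Gv <- /= vx y /= vy.
  apply: (linked_trans ux); apply: linked_del_vertices SS _.
  exact: linked_trans (linked_sym vx) vy.
exists (S `|` S', K); split=> // w' w'K; split=> r' /w'K; rewrite /tail_in /=.
  by apply: filterS => i; apply: (sub S) => //; exact: wC.
by apply: filterS => i; apply: (sub S') => //; exact: wC'.
Qed.

HB.instance Definition _ G := isBaseTopological.Build (graph_end G)
  (@end_base_cover G) (@end_base_join G).

Definition borel_ends G : set (set (graph_end G)) := <<s @open (graph_end G) >>.

(* C(S, w) *)
Definition end_component G S (w : graph_end G) : set T :=
  \bigcup_(C in [set C | component (del_vertices G S) C /\ lives_in w C]) C.

(* The family of paths has to be an infinite set of paths, since the trivial
   path at v could otherwise be repeated when v lies on r. *)
Definition dominates G (v : T) (w : graph_end G) : Prop :=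
  vertices G v /\
  exists2 r, rays_of w r & exists P : set (seq T),
    [/\ infinite_set P,
        forall p, P p -> is_path G v p /\ range r (last v p)
      & forall p q, P p -> P q -> p <> q ->
          [set` v :: p] `&` [set` v :: q] = [set v]].

Definition undominated G (w : graph_end G) : Prop :=
  forall v, ~ dominates v w.

Definition in_closure G F (w : graph_end G) : Prop :=
  forall S, finite_vertex_set G S ->
  exists2 e, F e & e `&` end_component S w !=set0.

(* The edges between the two classes of a bipartition {A, V(G) \ A}. *)
Definition cut G : set (set (set T)) :=
  [set b | exists A, [/\ A `<=` vertices G, A !=set0, vertices G `\` A !=set0
    & b = [set e | [/\ edges G e, e `&` A !=set0
                     & e `&` (vertices G `\` A) !=set0]]]].

Definition finitely_coverable G b : Prop :=
  exists2 S, finite_vertex_set G S & forall e, b e -> e `&` S !=set0.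

Definition meets_evenly F b : Prop := exists n, (F `&` b) #= `I_(n.*2).

Definition contains_edge_of G b F C : Prop :=
  exists2 e, (F `&` edges (del_edges G b)) e & e `<=` C.

Definition geometrically_connected G F : Prop :=
  forall b, cut G b -> finitely_coverable G b ->
    (exists C C', [/\ component (del_edges G b) C,
                      component (del_edges G b) C', C <> C',
                      contains_edge_of G b F C & contains_edge_of G b F C']) ->
    F `&` b !=set0.

Definition C_Psi G (Psi : set (graph_end G)) : set (set (set T)) :=
  [set F | [/\ F `<=` edges G,
               forall b, cut G b -> finitely_coverable G b -> meets_evenly F b,
               geometrically_connected G F
             & forall w, in_closure F w -> Psi w]].

Definition D_Psi G (Psi : set (graph_end G)) : set (set (set T)) :=
  [set b | cut G b /\ forall w, Psi w -> ~ in_closure b w].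

End Graphs.

(* Main.v *)
Require Import Defs.
From mathcomp Require Import all_boot all_order.
From mathcomp Require Import finmap all_classical.
From mathcomp Require Import topology measurable_structure wochoice.

(** Since the ends of [Psi] are undominated, they are surrounded by connected regions
    with finite neighbourhoods that are pairwise disjoint and nonadjacent; iterating
    gives a tree of regions shrinking to the ends. Compactness of circuits along this
    tree shows that a member of C_Psi and a member of D_Psi meet in a finite even set.

    Conversely, let [e] be an edge and [P] a set of other edges. Two players walk down
    the tree of regions: the first builds, modulo 2, a connection of the ends of [e]
    from edges of [P] and from jumps through smaller regions, the second chooses the
    jump to be resolved next, and the first wins an infinite play when it converges
    to an end of [Psi]. By Borel determinacy (Martin's unravelling) one of them has a
    winning strategy. One for the first player assembles a member of C_Psi inside
    [P] together with [e], and one for the second a member of D_Psi through [e] that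
    avoids [P].

    Bases are constructed level by level. Only finitely many parities describe how
    circuits and cuts pass through a region, so representatives of all classes can be
    decided inside every region; a circuit or cut violating the limit partition
    would then meet an orthogonal set oddly. *)

Set Implicit Arguments.
Unset Strict Implicit.
Unset Printing Implicit Defensive.

Local Open Scope classical_set_scope.

(** * Games on trees *)

(** A move of the game is any finite list of edges and jumps, so determinacy is wanted on
    arbitrarily branching trees. Parities replace paths because the moves of all histories can then
    be added, and a cut sees only the sum; connectedness is recovered afterwards by a maximality
    argument. Undominatedness allows the neighbourhood of a region around an end to be pushed off
    any given finite set. Regions of least cost are nested or disjoint, but may form infinite
    ascending chains with growing neighbourhoods; cutting their unions into shells by neighbourhood
    size restores disjointness with finite boundaries. The obstacle to building bases is that a cut
    may meet infinitely many regions of one level, whereas a circuit meets only finitely many; hence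
    the two families are treated differently at every level. Maximal independent sets between [I]
    and [X] are found without contraction: the partition starts from [I], and restriction to [X]
    takes circuits inside [X] and traces of cuts, for which the game with edges of [X] again
    supplies the alternative. *)

Record tree := Tree {
  pos :> Type;
  root : pos;
  len : pos -> nat;
  par : pos -> pos;
  len0 : forall t, len t = 0 <-> t = root;
  len_par : forall t, len (par t) = (len t).-1;
  has_child : forall t, exists u, par u = t /\ len u = (len t).+1
}.
Arguments root {_}.

Section Trees.
Variable T : tree.
Implicit Types (t u w : T) (x : nat -> T) (s f : T -> T).

Definition child t u := par u = t /\ len u = (len t).+1.

Definition play x := forall n, len (x n) = n /\ par (x n.+1) = x n.

Definition strat s := forall t, child t (s t).

(* Player [false] moves at the positions of even length. *)
Definition follows (i : bool) s x := forall n, odd n = i -> x n.+1 = s (x n).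

Definition agree (i : bool) n s s' :=
  forall t, len t < n -> odd (len t) = i -> s t = s' t.

Lemma strat_exists : exists s, strat s.
Proof.
have [s hs] := choice (@has_child T).
by exists s.
Qed.

(** The ancestor of [t] at level [n]; truncated subtraction makes it [t] itself when [n] is at least
    the level of [t]. *)
Definition anc n t := iter (len t - n) (@par T) t.

Lemma iter_par_len k t : len (iter k (@par T) t) = len t - k.
Proof. by elim: k => [|k IH]; rewrite ?subn0 //= len_par IH subnS. Qed.

Lemma anc_len n t : n <= len t -> len (anc n t) = n.
Proof. by move=> h; rewrite iter_par_len subKn. Qed.

Lemma anc_id n t : len t <= n -> anc n t = t.
Proof. by rewrite /anc -subn_eq0 => /eqP ->. Qed.

Lemma anc_par n t : n < len t -> anc n (par t) = anc n t.
Proof.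
move=> h; have E : len t - n = ((len t).-1 - n).+1.
  by case: (len t) h => // m; rewrite ltnS /= => h; rewrite subSn.
by rewrite /anc len_par E iterSr.
Qed.

Lemma anc_child n t u : child t u -> n <= len t -> anc n u = anc n t.
Proof. by move=> [<- lu] h; rewrite anc_par // lu ltnS. Qed.

Lemma anc_anc m n t : m <= n -> anc m (anc n t) = anc m t.
Proof.
move=> mn; have [h|h] := leqP (len t) n; first by rewrite (anc_id h).
rewrite /anc iter_par_len -iterD subKn ?(ltnW h) //; congr (iter _ _ _).
by rewrite addnC addnBA // subnK // ltnW.
Qed.

Lemma par_anc n t : n < len t -> par (anc n.+1 t) = anc n t.
Proof. by move=> h; rewrite /anc -iterS -subSn. Qed.

Lemma play_len x n : play x -> len (x n) = n. Proof. by move=> /(_ n)[]. Qed.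

Lemma play_child x n : play x -> child (x n) (x n.+1).
Proof. by move=> px; split; [case: (px n)|rewrite !play_len]. Qed.

Lemma play_anc x n m : play x -> m <= n -> anc m (x n) = x m.
Proof.
move=> px; elim: n => [|n IH]; first by rewrite leqn0 => /eqP ->; rewrite anc_id // play_len.
rewrite leq_eqVlt => /orP[/eqP ->|]; first by rewrite anc_id // play_len.
by rewrite ltnS => h; rewrite (anc_child (play_child n px)) ?play_len // IH.
Qed.

Lemma play_extend s t : strat s -> exists x, [/\ play x,
  forall n, n <= len t -> x n = anc n t & forall n, len t <= n -> x n.+1 = s (x n)].
Proof.
move=> ss; pose x n := if n <= len t then anc n t else iter (n - len t) s t.
have lit k : len (iter k s t) = len t + k.
  elim: k => [|k IH]; rewrite ?addn0 //= addnS -IH.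
  by case: (ss (iter k s t)).
have xS n : len t <= n -> x n.+1 = s (x n).
  move=> tn; rewrite /x ltnNge tn /= subSn //=; case: leqP => // nt.
  by have -> : n = len t; [apply/eqP; rewrite eqn_leq tn nt|rewrite subnn anc_id].
exists x; split=> //; last by move=> n nt; rewrite /x nt.
move=> n; split.
  by rewrite /x; case: leqP => h; [rewrite anc_len|rewrite lit subnKC // ltnW].
case: (ltnP n (len t)) => h; last by rewrite xS //; case: (ss (x n)).
by rewrite /x h (ltnW h) par_anc.
Qed.

Lemma play_through t : exists2 x, play x & x (len t) = t.
Proof.
have [s ss] := strat_exists; have [x [px xt _]] := play_extend t ss.
by exists x => //; rewrite xt // anc_id.
Qed.

Section Win.
Variables (i : bool) (A Y : set T).

(** The attractor of [Y] for player [i], whose own moves must stay in [A]. A derivation plays the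
    part of the ordinal rank in the usual construction. *)
Inductive win : T -> Prop :=
| win_goal t : Y t -> win t
| win_own t u : odd (len t) = i -> child t u -> A u -> win u -> win t
| win_opp t : odd (len t) = ~~ i -> (forall u, child t u -> win u) -> win t.

(** The strategy is assumed to be followed only from [w] until [Y] is reached, so it can be combined
    with other strategies before and after. *)
Definition attracts w f := strat f /\
  forall x, play x -> x (len w) = w -> A w ->
    (forall n, odd n = ~~ i -> A (x n) -> A (x n.+1)) ->
    (forall n, len w <= n -> odd n = i ->
       (forall m, len w <= m <= n -> ~ Y (x m)) -> x n.+1 = f (x n)) ->
    exists n, [/\ len w <= n, Y (x n) & forall m, len w <= m <= n -> A (x m)].

Lemma win_attracts w : win w -> exists f, attracts w f.
Proof.
elim=> {w} [t Yt|t u it tu Au _ [f [sf hf]]|t it _ hu].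
- have [f sf] := strat_exists; exists f; split=> // x px xt At _ _.
  exists (len t); rewrite xt; split=> // m.
  by rewrite -eqn_leq => /eqP <-; rewrite xt.
- pose g q := if pselect (q = t) then u else f q.
  have gE q : q <> t -> g q = f q by rewrite /g; case: pselect.
  exists g; split; first by move=> q; rewrite /g; case: pselect => /= [->|].
  move=> x px xt At opp own; have [Yt|nYt] := pselect (Y t).
    by exists (len t); rewrite xt; split=> // m; rewrite -eqn_leq => /eqP <-; rewrite xt.
  have [_ lu] := tu.
  have xu : x (len u) = u.
    rewrite lu own // ?xt; first by rewrite /g; case: pselect.
    by move=> m; rewrite -eqn_leq => /eqP <-; rewrite xt.
  have [|n [un Yn hn]] := hf x px xu Au opp.
    move=> n un io nY; rewrite lu in un; have -> : x n.+1 = g (x n).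
      apply: own => //; first exact: ltnW.
      move=> m /andP[]; rewrite leq_eqVlt => /orP[/eqP <-|tm mn]; first by rewrite xt.
      by apply: nY; rewrite lu tm.
    by apply: gE => E; move: un; rewrite -E (play_len n px) ltnn.
  exists n; split=> //; first by rewrite ltnW // -lu.
  move=> m /andP[]; rewrite leq_eqVlt => /orP[/eqP <-|tm mn]; first by rewrite xt.
  by apply: hn; rewrite lu tm.
have /choice[F hF] : forall u, exists f, child t u -> attracts u f.
  move=> u; have [/hu[f hf]|n] := pselect (child t u); first by exists f.
  by exists id.
have [f0 sf0] := strat_exists.
(* The strategies of all children of [t] are glued: the ancestor at the level below [t] tells
   through which child the play has passed. *)
pose g q := if pselect (child t (anc (len t).+1 q)) then F (anc (len t).+1 q) q else f0 q.
exists g; split.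
  by move=> q; rewrite /g; case: pselect => /= [/hF[]//|_]; apply: sf0.
move=> x px xt At opp own; have [Yt|nYt] := pselect (Y t).
  by exists (len t); rewrite xt; split=> // m; rewrite -eqn_leq => /eqP <-; rewrite xt.
have tu : child t (x (len t).+1) by rewrite -{1}xt; exact: play_child.
have [sF hf] := hF _ tu.
have lu : len (x (len t).+1) = (len t).+1 by rewrite play_len.
have Au : A (x (len t).+1) by apply: opp; rewrite ?xt.
have [||n [un Yn hn]] := hf x px _ Au opp; rewrite ?lu //.
  move=> n un io nY; have -> : x n.+1 = g (x n).
    apply: own => //; first exact: ltnW.
    move=> m /andP[]; rewrite leq_eqVlt => /orP[/eqP <-|tm mn]; first by rewrite xt.
    by apply: nY; rewrite tm.
  by rewrite /g play_anc //; case: pselect.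
exists n; rewrite lu in un hn; split=> //; first exact: ltnW.
move=> m /andP[]; rewrite leq_eqVlt => /orP[/eqP <-|tm mn]; first by rewrite xt.
by apply: hn; rewrite tm.
Qed.

Lemma not_win_goal t : ~ win t -> ~ Y t.
Proof. by move=> h /win_goal. Qed.

Lemma not_win_own t u : odd (len t) = i -> child t u -> A u -> ~ win t -> ~ win u.
Proof. by move=> it tu Au nt wu; apply: nt; apply: win_own wu. Qed.

Lemma not_win_opp t : odd (len t) = ~~ i -> ~ win t ->
  exists2 u, child t u & ~ win u.
Proof.
move=> it nt; apply: contrapT => h; apply: nt; apply: win_opp => // u tu.
by apply: contrapT => nu; apply: h; exists u.
Qed.

End Win.

(** The winning sets with a finite horizon; unravelling reduces Borel sets to these. *)
Definition fixed_at N (W : set (nat -> T)) :=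
  forall x y, play x -> play y -> x N = y N -> W x -> W y.

Definition determined (W : set (nat -> T)) :=
  (exists2 s, strat s & forall x, play x -> follows false s x -> W x) \/
  (exists2 s, strat s & forall x, play x -> follows true s x -> ~ W x).

(** Zermelo's argument: the first player wins from the attractor of the favourable positions of
    level [N], and if the root is outside it, the second player can stay outside. *)
Lemma fixed_determined N W : fixed_at N W -> determined W.
Proof.
move=> hW; pose Y : set T := [set t | len t = N /\ forall x, play x -> x N = t -> W x].
have lr : len (@root T) = 0 by apply/len0.
have x0 x : play x -> x 0 = root by move=> px; apply/len0; rewrite play_len.
have [w|nw] := pselect (win false setT Y root); [left|right].
  have [f [sf hf]] := win_attracts w; exists f => // x px fx.
  have [||||n [_ [lN Yn] _]] := hf x px; rewrite ?lr ?x0 //.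
    by move=> n _ io _; exact: fx.
  by apply: Yn => //; rewrite -lN play_len.
have [s0 ss0] := strat_exists.
have /choice[s hs] : forall t : T, exists u : T, child t u /\
    (odd (len t) = true -> ~ win false setT Y t -> ~ win false setT Y u).
  move=> t.
  have [[ot nt]|h] := pselect (odd (len t) = true /\ ~ win false setT Y t).
    by have [u tu nu] := not_win_opp (i := false) ot nt; exists u.
  by exists (s0 t); split=> // a b; case: h.
exists s => [t|x px fx Wx]; first by case: (hs t).
have nwx n : ~ win false setT Y (x n).
  elim: n => [|n IH]; first by rewrite x0.
  case E : (odd n); first by rewrite fx //; apply: (hs _).2 => //; rewrite play_len.
  apply: not_win_own (play_child n px) _ IH => //.
  by rewrite play_len.
apply: (nwx N); apply: win_goal; split=> [|y py yx]; first by rewrite play_len.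
by apply: hW Wx => //; rewrite yx.
Qed.

End Trees.

(** * Coverings of game trees *)

(* Locality of [push] is what lets strategies pass to inverse limits. *)
Record covering (T' T : tree) := Covering {
  proj :> T' -> T;
  push : bool -> (T' -> T') -> T -> T;
  len_proj : forall t, len (proj t) = len t;
  par_proj : forall t, proj (par t) = par (proj t);
  push_strat : forall i s, strat s -> strat (push i s);
  push_local : forall i n s s', strat s -> strat s' -> agree i n s s' ->
    agree i n (push i s) (push i s');
  push_lift : forall i s x, strat s -> play x -> follows i (push i s) x ->
    exists x', [/\ play x', follows i s x' & forall n, proj (x' n) = x n]
}.

(** Up to level [k] the covering is an isomorphism, also for strategies. Sequences of coverings with
    growing [k] therefore have an inverse limit. *)
Definition kcovering (k : nat) (T' T : tree) (c : covering T' T) := [/\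
  forall t u : T', len t <= k -> c t = c u -> t = u,
  forall u : T, len u <= k -> exists t, c t = u &
  forall i s (t : T'), strat s -> len t < k -> odd (len t) = i ->
    push c i s (c t) = c (s t)].

Lemma play_proj T' T (c : covering T' T) x : play x -> play (c \o x).
Proof.
by move=> px n; split; rewrite /= ?len_proj -?par_proj; case: (px n) => // _ ->.
Qed.

Definition id_covering T : covering T T.
Proof.
apply: (@Covering T T id (fun _ s => s)) => // i s x _ px fx.
by exists x.
Defined.

Definition comp_covering T'' T' T (c : covering T' T) (d : covering T'' T') :
  covering T'' T.
Proof.
apply: (@Covering T'' T (c \o d) (fun i s => push c i (push d i s))).
- by move=> t; rewrite /= !len_proj.
- by move=> t; rewrite /= !par_proj.
- by move=> i s ss; do 2!apply: push_strat.
- by move=> i n s s' ss ss' h; apply: push_local; [exact: push_strat..|exact: push_local].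
- move=> i s x ss px fx.
  have [x' [px' fx' E']] := push_lift (push_strat d i ss) px fx.
  have [x'' [px'' fx'' E'']] := push_lift ss px' fx'.
  by exists x''; split=> // n /=; rewrite E'' E'.
Defined.

Lemma kcovering_comp k T'' T' T (c : covering T' T) (d : covering T'' T') :
  kcovering k c -> kcovering k d -> kcovering k (comp_covering c d).
Proof.
move=> [ci cs cp] [di ds dp]; split.
- move=> t u tk /= /ci h; apply: di => //; apply: h.
  by rewrite len_proj.
- move=> u uk; have [t tE] := cs u uk; have [|v vE] := ds t.
    by rewrite -(len_proj c) tE.
  by exists v; rewrite /= vE.
- move=> i s t ss tk it /=; rewrite cp ?len_proj ?dp //.
  exact: push_strat.
Qed.

Lemma kcoveringW k m T' T (c : covering T' T) : m <= k ->
  kcovering k c -> kcovering m c.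
Proof.
move=> mk [ci cs cp]; split.
- by move=> t u tm; apply: ci; exact: leq_trans mk.
- by move=> u um; apply: cs; exact: leq_trans mk.
- by move=> i s t ss tm; apply: cp => //; exact: leq_trans mk.
Qed.

(** * Inverse limits of coverings *)

Section Threads.

(** A coherent sequence through a prescribed [u]: above [n] the coordinates are lifted one at a
    time, below [n] they are images. The induction on [n] shifts the system until it starts at
    [u]. *)
Lemma thread_exists (X : nat -> Type) (c : forall m, X m.+1 -> X m)
    (P : forall m, X m -> Prop) n (u : X n) :
  (forall m (y : X m), n <= m -> P m y -> exists y' : X m.+1, c m y' = y /\ P m.+1 y') ->
  P n u -> exists t : forall m, X m, (forall m, c m (t m.+1) = t m) /\ t n = u.
Proof.
elim: n => [|n IH] in X c P u *.
  move=> lift Pu.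
  (* Only provides values for the choice of lifts at points outside [P]. *)
  have Pex j : exists z, P j z.
    elim: j => [|j [z Pz]]; first by exists u.
    by have [z' [_ Pz']] := lift j z isT Pz; exists z'.
  have g_ex m : exists g : X m -> X m.+1, forall y, P m y ->
      c m (g y) = y /\ P m.+1 (g y).
    have /choice[g hg] : forall y, exists y', P m y -> c m y' = y /\ P m.+1 y'.
      move=> y; have [Py|nPy] := pselect (P m y).
        by have [y' h] := lift m y isT Py; exists y'.
      by have [y' _] := Pex m.+1; exists y'.
    by exists g.
  pose g m := sval (cid (g_ex m)).
  have hg m : forall y, P m y -> c m (g m y) = y /\ P m.+1 (g m y) := svalP (cid (g_ex m)).
  pose t := fix t m := match m with 0 => u | j.+1 => g j (t j) end.
  have Pt m : P m (t m) by elim: m => [|m Hm] //=; apply: (hg _ _ Hm).2.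
  by exists t; split=> // m /=; apply: (hg _ _ (Pt m)).1.
move=> lift Pu.
have [||t [ht tn]] := IH (fun m => X m.+1) (fun m => c m.+1) (fun m => P m.+1) u.
- by move=> m y nm; apply: lift.
- exact: Pu.
exists (fun m => match m with 0 => c 0 (t 0) | j.+1 => t j end); split=> //.
by case.
Qed.

Lemma thread_low (X : nat -> Type) (c : forall m, X m.+1 -> X m)
    (t t' : forall m, X m) n m :
  (forall m, c m (t m.+1) = t m) -> (forall m, c m (t' m.+1) = t' m) ->
  t n = t' n -> m <= n -> t m = t' m.
Proof.
move=> ht ht' + mn; have -> : n = (n - m) + m by rewrite subnK.
elim: (n - m) => [//|j IH]; rewrite addSn => E; apply: IH.
by rewrite -ht -ht' E.
Qed.

End Threads.

Section Limit.
Variables (k : nat) (Q : nat -> tree) (c : forall m, covering (Q m.+1) (Q m)).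
Hypothesis kc : forall m, kcovering (k + m) (c m).

Let coherent (t : forall m, Q m) := forall m, c m (t m.+1) = t m.

Definition limit_pos := {t : forall m, Q m | coherent t}.

Implicit Types (t u : limit_pos) (i : bool).

Lemma limit_coherent t m : c m (sval t m.+1) = sval t m.
Proof. exact: (svalP t). Qed.

Lemma limit_len t m : len (sval t m) = len (sval t 0).
Proof. by elim: m => // m <-; rewrite -(limit_coherent t m) len_proj. Qed.

Lemma limit_ext t u : (forall m, sval t m = sval u m) -> t = u.
Proof.
case: t u => [t ct] [u cu] /= h; have E : t = u by apply: functional_extensionality_dep.
by subst u; congr exist; apply: Prop_irrelevance.
Qed.

(** Lower coordinates are projections, and from stage [m] on the bonding maps are injective up to
    level [k + m]; so one coordinate determines the thread. *)
Lemma limit_inj t u m : len (sval t m) <= k + m -> sval t m = sval u m -> t = u.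
Proof.
move=> lt E; apply: limit_ext => j; have [jm|mj] := leqP j m.
  by apply: (@thread_low Q c _ _ m j) => // n; exact: limit_coherent.
elim: j mj => // j IH; rewrite ltnS leq_eqVlt => /orP[/eqP Emj|mj].
  subst m; have [ci _ _] := kc j; apply: ci; last by rewrite !limit_coherent.
  by rewrite limit_len -(limit_len t j).
have [ci _ _] := kc j; apply: ci; last by rewrite !limit_coherent IH.
rewrite limit_len -(limit_len t m); apply: leq_trans lt _.
by rewrite leq_add2l ltnW.
Qed.

Lemma limit_surj m (u : Q m) : len u <= k + m -> exists t, sval t m = u.
Proof.
move=> lu; have [||t [ct tE]] := @thread_exists Q c (fun m v => len v = len u) m u => //.
  move=> j y mj ly; have [_ cs _] := kc j; have [|y' yE] := cs y.
    by rewrite ly; apply: leq_trans lu _; rewrite leq_add2l.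
  by exists y'; rewrite -(len_proj (c j)) yE.
by exists (exist _ t ct).
Qed.

Definition limit_par t : limit_pos :=
  exist coherent (fun m => par (sval t m)) (fun m =>
    eq_trans (par_proj (c m) (sval t m.+1)) (f_equal (@par _) (limit_coherent t m))).

Definition limit_root : limit_pos.
Proof.
exists (fun m => root) => m; apply/len0.
by rewrite len_proj; apply/len0.
Defined.

Definition limit_tree : tree.
Proof.
apply: (@Tree limit_pos limit_root (fun t => len (sval t 0)) limit_par).
- move=> t; split=> [lt|->]; last exact/len0.
  by apply: limit_ext => m; apply/len0; rewrite limit_len.
- by move=> t; rewrite len_par.
- move=> t; pose n := (len (sval t 0)).+1.
  have [u0 [pu lu]] := has_child (sval t n).
  have [|u uE] := @limit_surj n u0; first by rewrite lu limit_len leq_addl.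
  have lu' : len (sval u 0) = (len (sval t 0)).+1 by rewrite -(limit_len u n) uE lu limit_len.
  exists u; split=> //; apply: (@limit_inj _ _ n) => /=; last by rewrite uE.
  by rewrite uE pu limit_len (leq_trans (leqnSn _)) // leq_addl.
Defined.

Definition limit_proj m (t : limit_tree) : Q m := sval t m.

Lemma limit_projE m t : c m (limit_proj m.+1 t) = limit_proj m t.
Proof. exact: limit_coherent. Qed.

Lemma play_limit_proj m x : @play limit_tree x -> play (limit_proj m \o x).
Proof.
move=> px n; have [lx pxn] := px n; split=> /=.
  by rewrite /limit_proj limit_len.
by rewrite -pxn.
Qed.

(** Below level [k + m] the stage [Q m] and the limit are isomorphic, which dictates [f] there;
    above, any legal move will do. *)
Lemma copy_exists m (s : limit_tree -> limit_tree) : strat s ->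
  exists2 f : Q m -> Q m, strat f & forall t : limit_tree,
    len t < k + m -> f (limit_proj m t) = limit_proj m (s t).
Proof.
move=> ss; have [f0 sf0] := strat_exists (Q m).
have /choice[f hf] : forall v : Q m, exists v' : Q m, child v v' /\
    forall t : limit_tree, len t < k + m -> limit_proj m t = v -> v' = limit_proj m (s t).
  move=> v; have [lv|lv] := ltnP (len v) (k + m).
    have [t tE] := limit_surj (ltnW lv).
    exists (limit_proj m (s t)); split.
      have [ps ls] := ss t; split; last by rewrite -tE /limit_proj !limit_len; exact: ls.
      by rewrite -tE; exact: (congr1 (fun q : limit_pos => sval q m) ps).
    move=> u lu uE; congr (limit_proj m (s _)); apply: (@limit_inj _ _ m).
      by rewrite tE ltnW.
    by rewrite tE -uE.
  exists (f0 v); split=> // t lt tE.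
  by move: lv; rewrite -tE /limit_proj limit_len leqNgt lt.
exists f => [v|t lt]; first by case: (hf v).
by case: (hf (limit_proj m t)) => _; apply.
Qed.

Definition copy m (s : limit_tree -> limit_tree) : Q m -> Q m :=
  if pselect (strat s) is left ss then s2val (cid2 (copy_exists m ss)) else id.

Arguments copy : clear implicits.

Lemma copy_strat m (s : limit_tree -> limit_tree) : strat s -> strat (copy m s).
Proof. by move=> ss; rewrite /copy; case: pselect => // h; case: cid2. Qed.

Lemma copyE m (s : limit_tree -> limit_tree) (t : limit_tree) : strat s -> len t < k + m ->
  copy m s (limit_proj m t) = limit_proj m (s t).
Proof. by move=> ss; rewrite /copy; case: pselect => // h; case: cid2 => /= f _; apply. Qed.

(** The strategy on [Q m] obtained by copying [s] to stage [m + j] and pushing the copy down [j]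
    times. Below level [k + m + j] the moves of player [i] no longer change when [j] grows. *)
Fixpoint pushes i (s : limit_tree -> limit_tree) j m : Q m -> Q m :=
  match j with
  | 0 => copy m s
  | j'.+1 => push (c m) i (@pushes i s j' m.+1)
  end.

Arguments pushes : clear implicits.

Lemma pushes_strat i s j m : strat s -> strat (pushes i s j m).
Proof.
move=> ss; elim: j m => [|j IH] m /=; first exact: copy_strat.
exact: push_strat.
Qed.

Lemma pushesS i s j m : strat s -> agree i (k + m + j) (pushes i s j m) (pushes i s j.+1 m).
Proof.
move=> ss; elim: j m => [|j IH] m.
  move=> v; rewrite addn0 /= => lv iv.
  have [t tE] := limit_surj (ltnW lv).
  have lt : @len limit_tree t < k + m.
    by move: lv; rewrite -tE limit_len.
  have [_ _ cp] := kc m.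
  rewrite -tE -{2}(limit_coherent t) cp.
  - rewrite -/(limit_proj m t) copyE // -/(limit_proj m.+1 t) copyE //.
      by rewrite limit_projE.
    by rewrite addnS ltnW.
  - exact: copy_strat.
  - by rewrite limit_len.
  - by rewrite limit_len -(limit_len t m) tE.
rewrite addnS -addSn -addnS.
apply: (@push_local _ _ (c m) i _ (pushes i s j m.+1) (pushes i s j.+1 m.+1));
  [exact: pushes_strat..|exact: IH].
Qed.

Lemma pushes_agree i s j j' m : strat s -> j <= j' ->
  agree i (k + m + j) (pushes i s j m) (pushes i s j' m).
Proof.
move=> ss jj' v lv iv; rewrite -(subnK jj'); elim: (j' - j) => [//|d ->].
rewrite addSn (@pushesS i s (d + j) m ss v) //.
by apply: leq_trans lv _; rewrite leq_add2l leq_addl.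
Qed.

(** The stationary value of [pushes]: every number of stages beyond the length of [v] gives the same
    move of player [i] at [v]. *)
Definition limit_push i s m (v : Q m) : Q m := pushes i s (len v).+1 m v.

Arguments limit_push : clear implicits.

Lemma limit_pushE i s m j : strat s -> agree i j (limit_push i s m) (pushes i s j m).
Proof.
move=> ss v lv iv; rewrite /limit_push; apply: pushes_agree => //.
by rewrite addnS ltnS leq_addl.
Qed.

Lemma limit_push_copy i s m : strat s -> agree i (k + m) (limit_push i s m) (copy m s).
Proof.
move=> ss v lv iv; rewrite /limit_push.
by rewrite -(@pushes_agree i s 0 (len v).+1 m ss) // addn0.
Qed.

Lemma limit_push_strat i s m : strat s -> strat (limit_push i s m).
Proof. by move=> ss v; exact: pushes_strat. Qed.

(** Coherence of the stationary strategies along the bonding coverings; it is what lets a play be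
    lifted from each stage to the next. *)
Lemma limit_pushS i s m v : strat s -> odd (len v) = i ->
  limit_push i s m v = push (c m) i (limit_push i s m.+1) v.
Proof.
move=> ss iv; rewrite {1}/limit_push /=.
apply: (@push_local _ _ (c m) i (len v).+1) => //; [exact: pushes_strat|exact: limit_push_strat|].
move=> w lw iw; apply/esym.
rewrite (@limit_pushE i s m.+1 (len v).+1) //.
rewrite (@pushes_agree i s (len v) (len v).+1 m.+1 ss) //.
by apply: leq_trans lw _; rewrite addnS addSn ltnS leq_addl.
Qed.

Lemma pushes_local i n s s' j m : strat s -> strat s' -> agree i n s s' ->
  agree i (minn n (k + m + j)) (pushes i s j m) (pushes i s' j m).
Proof.
move=> ss ss' h; elim: j m => [|j IH] m; last first.
  rewrite addnS -addSn -addnS.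
  by apply: (@push_local _ _ (c m) i _ (pushes i s j m.+1) (pushes i s' j m.+1));
    [exact: pushes_strat..|exact: IH].
move=> v; rewrite addn0 leq_min => /andP[ln lk] iv /=.
have [t tE] := limit_surj (ltnW lk).
have lt : @len limit_tree t = len v by rewrite -tE limit_len.
by rewrite -tE -/(limit_proj m t) !copyE ?lt // h ?lt.
Qed.

(** The play is lifted stage by stage, each lift following the stationary strategy of its stage. The
    lifts form threads, and high stages, where the strategy is a copy of [s], show that the
    resulting play follows [s]. *)
Lemma limit_lift i s x : strat s -> play x -> follows i (limit_push i s 0) x ->
  exists x' : nat -> limit_tree,
    [/\ play x', follows i s x' & forall n, limit_proj 0 (x' n) = x n].
Proof.
move=> ss px fx.
pose P m (y : nat -> Q m) := play y /\ follows i (limit_push i s m) y.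
have step m (y : nat -> Q m) : exists y' : nat -> Q m.+1, P m y ->
    (c m \o y') = y /\ P m.+1 y'.
  have [[py fy]|nP] := pselect (P m y); last first.
    by have [z _ _] := play_through (@root (Q m.+1)); exists z.
  have [|y' [py' fy' E]] := @push_lift _ _ (c m) i _ y (@limit_push_strat i s m.+1 ss) py.
    by move=> n io; rewrite fy // limit_pushS // play_len.
  by exists y' => _; split=> //; apply: funext.
pose g m y := sval (cid (step m y)).
have hg m y : P m y -> (c m \o g m y) = y /\ P m.+1 (g m y) := svalP (cid (step m y)).
pose y := fix y m : nat -> Q m := match m with 0 => x | j.+1 => g j (y j) end.
have Py m : P m (y m) by elim: m => [|m IH] //=; apply: (hg _ _ IH).2.
have cy n : coherent (y^~ n).
  by move=> m /=; rewrite -[in RHS](hg _ _ (Py m)).1.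
pose x' n : limit_tree := exist coherent (y^~ n) (cy n).
have lx' n : len (x' n) = n by rewrite /= play_len.
exists x'; split=> //.
  move=> n; split=> //; apply: limit_ext => m /=.
  by case: (Py m) => py _; case: (py n).
move=> n io; apply: (@limit_inj _ _ n.+1); first by rewrite limit_len /= play_len // leq_addl.
have [py fy] := Py n.+1; rewrite [LHS]fy // limit_push_copy ?play_len //.
  by apply: (@copyE n.+1 s (x' n)) => //; rewrite lx' addnS ltnS leq_addl.
by rewrite addnS ltnS leq_addl.
Qed.

Definition limit_covering : covering limit_tree (Q 0).
Proof.
apply: (@Covering limit_tree (Q 0) (limit_proj 0) (fun i s => limit_push i s 0)).
- by [].
- by [].
- by move=> i s; exact: limit_push_strat.
- move=> i n s s' ss ss' h v lv iv; rewrite /limit_push.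
  apply: (pushes_local (n := n)) => //.
  by rewrite leq_min lv addnS ltnS leq_addl.
- exact: limit_lift.
Defined.

Lemma limit_kcovering : kcovering k limit_covering.
Proof.
split.
- by move=> t u lt E; apply: (@limit_inj _ _ 0) E; rewrite addn0.
- by move=> u lu; apply: limit_surj; rewrite addn0.
- move=> i s t ss lt io; rewrite [LHS]limit_push_copy ?addn0 //.
  by apply: copyE => //; rewrite addn0.
Qed.

End Limit.

(** * Unravelling open and Borel winning sets *)

Definition pick_in (X : Type) (x0 : X) (P : set X) : X :=
  if pselect (exists x, P x) is left h then sval (cid h) else x0.

Lemma pick_inP (X : Type) (x0 x : X) (P : set X) : P x -> P (pick_in x0 P).
Proof. by move=> Px; rewrite /pick_in; case: pselect => [h|[]]; [case: cid|exists x]. Qed.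

Section FirstHit.
Variable T : tree.
Implicit Types (P : set T) (x : nat -> T) (t : T).

Definition hits b P t := exists2 m, b <= m <= len t & P (anc m t).

(** Expressed through the ancestors of [t], so that a strategy can recover the event from the
    current position alone. *)
Definition first_hit b P t : T := pick_in t [set u | exists m,
  [/\ b <= m <= len t, P (anc m t), forall j, b <= j < m -> ~ P (anc j t)
    & u = anc m t]].

Lemma first_index (Q : nat -> Prop) b n : b <= n -> Q n ->
  exists m, [/\ b <= m <= n, Q m & forall j, b <= j < m -> ~ Q j].
Proof.
move=> bn Qn; have ex : exists m, (b <= m) && `[< Q m >].
  by exists n; rewrite bn; apply/asboolP.
case: (ex_minnP ex) => m /andP[bm /asboolP Qm] min; exists m; split=> //.
  by rewrite bm min // bn; apply/asboolP.
by move=> j /andP[bj jm] Qj; move: jm; rewrite ltnNge min // bj; apply/asboolP.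
Qed.

Lemma hits_play b P x n : play x ->
  hits b P (x n) <-> exists2 m, b <= m <= n & P (x m).
Proof.
move=> px; split=> -[m]; rewrite ?(play_len _ px) => mn h; exists m => //.
  by rewrite -(play_anc px (proj2 (andP mn))).
  by rewrite (play_len _ px).
by rewrite (play_anc px (proj2 (andP mn))).
Qed.

Lemma first_hit_play b P x m n : play x -> b <= m <= n -> P (x m) ->
  (forall j, b <= j < m -> ~ P (x j)) -> first_hit b P (x n) = x m.
Proof.
move=> px /andP[bm mn] Pm min; rewrite /first_hit.
set P' := (X in pick_in _ X); have [|j [/andP[bj jn] Pj minj ->]] := @pick_inP _ (x n) (x m) P'.
  exists m; rewrite (play_len _ px) bm mn (play_anc px mn); split=> // j /andP[bj jm].
  by rewrite (play_anc px (leq_trans (ltnW jm) mn)); apply: min; rewrite bj.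
rewrite (play_len _ px) in jn; rewrite (play_anc px jn) in Pj *; congr x.
apply/eqP; rewrite eqn_leq; apply/andP; split; rewrite leqNgt; apply/negP => h.
  by apply: (minj m); rewrite ?bm // play_anc.
by apply: (min j) => //; rewrite bj.
Qed.

End FirstHit.

Section Unravel.
Variables (T : tree) (K : nat) (O : set T).
Hypothesis K_even : odd K = false.
Hypothesis O_up : forall t, O (par t) -> O t.
Implicit Types (t u q w : T) (A : set T).

(* [quasi1 t A] is a quasistrategy of the first player from [t], and
   [quasi2 t A B] one of the second player inside [A] that avoids [O]. *)
Definition quasi1 t A := [/\ A t,
  forall q u, A q -> odd (len q) -> child q u -> A u,
  forall q, A q -> ~~ odd (len q) -> exists2 u, child q u & A u
  & forall q, A q -> K.+1 < len q -> A (par q)].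

Definition quasi2 t A B := [/\ B t /\ B `<=` A, forall q, B q -> ~ O q,
  forall q u, B q -> ~~ odd (len q) -> child q u -> A u -> B u,
  forall q, B q -> odd (len q) -> exists2 u, child q u & B u
  & forall q, B q -> K.+2 < len q -> B (par q)].

(** The commitments of Martin's unravelling. On reaching level [K.+1] the first player names a
    quasistrategy [A] for himself. On reaching level [K.+2] the second player answers either with a
    position of [O] in [A], through which the play then has to pass, or with a quasistrategy inside
    [A] that avoids [O]. *)
Definition data := option (set T * option (T + set T)).

Definition valid t (d : data) : Prop :=
  match d with
  | None => len t <= K
  | Some (A, None) => len t = K.+1 /\ quasi1 t A
  | Some (A, Some (inl u)) => [/\ K.+2 <= len t, quasi1 (anc K.+1 t) A,
      A u /\ O u, K.+2 <= len u
      & anc (minn (len t) (len u)) t = anc (minn (len t) (len u)) u]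
  | Some (A, Some (inr B)) => [/\ K.+2 <= len t, quasi1 (anc K.+1 t) A,
      quasi2 (anc K.+2 t) A B & B t]
  end.

Definition par_data n (d : data) : data :=
  if d is Some (A, b) then
    if n <= K.+1 then None else if n <= K.+2 then Some (A, None) else d
  else None.

Lemma valid_par t d : valid t d -> valid (par t) (par_data (len t) d).
Proof.
case: d => [[A [[u|B]|]]|] /=.
- move=> [lt qS [Su Ou] lu cmp]; rewrite leqNgt lt /=.
  have nK : K.+1 < len t by [].
  case: leqP => h.
    have E : len t = K.+2 by apply/eqP; rewrite eqn_leq h lt.
    by split; [rewrite len_par E|rewrite -par_anc // anc_id // h in qS].
  have lp : K.+2 <= len (par t) by rewrite len_par -ltnS prednK // (leq_trans _ h).
  split=> //; first by rewrite anc_par.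
  have le1 : minn (len (par t)) (len u) <= minn (len t) (len u).
    by rewrite len_par leq_min geq_minr andbT (leq_trans (geq_minl _ _)) // leq_pred.
  rewrite -(anc_anc u le1) -cmp anc_anc // anc_par //.
  by rewrite (leq_ltn_trans (geq_minl _ _)) // len_par prednK // (leq_trans _ h).
- move=> [lt qS qB Bt]; rewrite leqNgt lt /=; case: leqP => h.
    have E : len t = K.+2 by apply/eqP; rewrite eqn_leq h lt.
    by split; [rewrite len_par E|rewrite -par_anc // anc_id // h in qS].
  have lp : K.+2 <= len (par t) by rewrite len_par -ltnS prednK // (leq_trans _ h).
  split=> //; [by rewrite anc_par|by rewrite anc_par|].
  by case: qB => _ _ _ _; apply.
- by move=> [lt qS]; rewrite lt leqnn /= len_par lt.
- by move=> lt; rewrite len_par (leq_trans (leq_pred _)).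
Qed.

Lemma quasi1_full u : len u = K.+1 -> quasi1 u [set q | K.+1 <= len q /\ anc K.+1 q = u].
Proof.
move=> lu; split.
- by split; rewrite ?lu // anc_id ?lu.
- move=> q v [lq aq] _ qv; split; first by rewrite qv.2 (leq_trans lq).
  by rewrite (anc_child qv).
- move=> q [lq aq] _; have [v qv] := has_child q; exists v => //; split.
    by rewrite qv.2 (leq_trans lq).
  by rewrite (anc_child qv).
- by move=> q [lq aq] h; split; [rewrite len_par -ltnS prednK // (leq_trans _ h)|rewrite anc_par].
Qed.

Lemma quasi1_sub t A u : len t = K.+1 -> quasi1 t A -> child t u ->
  ~ (exists v, [/\ A v, O v, K.+2 <= len v & anc K.+2 v = u]) ->
  quasi2 u A [set q | [/\ A q, K.+2 <= len q & anc K.+2 q = u]].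
Proof.
move=> lt [St S1 S2 S3] tu nv; have lu : len u = K.+2 by rewrite tu.2 lt.
have step q v : K.+2 <= len q -> child q v -> K.+2 <= len v /\ anc K.+2 v = anc K.+2 q.
  by move=> lq qv; rewrite (anc_child qv) // qv.2 leqW.
split.
- split; last by move=> q [].
  split; rewrite ?lu ?anc_id ?lu //.
  by apply: S1 tu; rewrite // lt /= K_even.
- by move=> q [Sq lq aq] Oq; apply: nv; exists q.
- by move=> q v [Sq lq aq] _ qv Sv; have [lv av] := step q v lq qv; split; rewrite ?av.
- move=> q [Sq lq aq] oq; have [v qv] := has_child q.
  by exists v => //; have [lv av] := step q v lq qv; split; rewrite ?av //; apply: S1 qv.
- move=> q [Sq lq aq] h; split; last by rewrite anc_par.
    by apply: S3 => //; apply: ltnW.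
  by rewrite len_par -ltnS prednK // (leq_trans _ h).
Qed.

(** There are no dead ends. In particular, if the second player finds no position of [O] in [A]
    beyond the next position, then all of [A] beyond it is a quasistrategy avoiding [O]. *)
Lemma valid_child t d : valid t d -> exists u d', [/\ child t u, valid u d'
  & par_data (len t).+1 d' = d].
Proof.
case: d => [[A [[v|B]|]]|] /=.
- move=> [lt qS [Sv Ov] lv cmp]; have [h|h] := ltnP (len t) (len v).
    have tE : t = anc (len t) v.
      by move: cmp; rewrite (minn_idPl (ltnW h)) {1}anc_id.
    have tu : child t (anc (len t).+1 v).
      by split; [rewrite par_anc // -tE|rewrite anc_len].
    exists (anc (len t).+1 v), (Some (A, Some (inl v))); split=> //=; last first.
      by rewrite !ltnS leqNgt (ltnW lt) /= leqNgt lt.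
    split=> //; first by rewrite tu.2 (leq_trans lt).
      by rewrite (anc_child tu) // ltnW.
    by rewrite tu.2 (minn_idPl h) anc_anc.
  have [u tu] := has_child t; exists u, (Some (A, Some (inl v))); split=> //=; last first.
    by rewrite !ltnS leqNgt (ltnW lt) /= leqNgt lt.
  have ltu : len v <= len u by rewrite tu.2 leqW.
  split=> //; first by rewrite tu.2 (leq_trans lt).
    by rewrite (anc_child tu) // ltnW.
  by rewrite (minn_idPr ltu) (anc_child tu) //; move: cmp; rewrite (minn_idPr h).
- move=> [lt qS qB Bt].
  have [u tu Bu] : exists2 u, child t u & B u.
    case: qS => _ _ S2 _; case: qB => [[_ sub] _ B1 B2 _].
    case E : (odd (len t)); first exact: B2.
    have [u tu Su] := S2 t (sub _ Bt) (negbT E).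
    by exists u => //; apply: B1 tu Su; rewrite ?E.
  exists u, (Some (A, Some (inr B))); split=> //=; last first.
    by rewrite !ltnS leqNgt (ltnW lt) /= leqNgt lt.
  split=> //; first by rewrite tu.2 (leq_trans lt).
    by rewrite (anc_child tu) // ltnW.
  by rewrite (anc_child tu).
- move=> [lt qS]; have [u tu] := has_child t.
  have lu : len u = K.+2 by rewrite tu.2 lt.
  have au : anc K.+1 u = t by rewrite (anc_child tu) ?lt // anc_id ?lt.
  have [[v [Sv Ov lv av]]|nv] := pselect (exists v, [/\ A v, O v, K.+2 <= len v & anc K.+2 v = u]).
    exists u, (Some (A, Some (inl v))); rewrite /= lt ltnn leqnn; split=> //.
    split; rewrite ?lu ?au //.
    by rewrite (minn_idPl lv) av anc_id ?lu.
  exists u, (Some (A, Some (inr [set q | [/\ A q, K.+2 <= len q & anc K.+2 q = u]]))).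
  rewrite /= lt ltnn leqnn; split=> //; split; rewrite ?lu ?au //.
    by rewrite (@anc_id _ K.+2 u) ?lu //; exact: quasi1_sub tu nv.
  by have [[[Au _ ua] _] _ _ _ _] := quasi1_sub lt qS tu nv; split.
- move=> lt; have [u tu] := has_child t; have [h|h] := ltnP (len t) K.
    by exists u, None; split=> //=; rewrite tu.2.
  have lu : len u = K.+1 by rewrite tu.2; congr _.+1; apply/eqP; rewrite eqn_leq lt h.
  exists u, (Some ([set q | K.+1 <= len q /\ anc K.+1 q = u], None)); split=> //=.
    by split=> //; exact: quasi1_full.
  by rewrite ltnS lt.
Qed.

Definition upos := {z : T * data | valid z.1 z.2}.

Lemma upos_ext (z z' : upos) : sval z = sval z' -> z = z'.
Proof. exact: eq_sig_hprop (fun _ => @Prop_irrelevance _) z z'. Qed.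

Definition upar (z : upos) : upos :=
  exist (fun z : T * data => valid z.1 z.2)
    (par (sval z).1, par_data (len (sval z).1) (sval z).2) (valid_par (svalP z)).

Lemma valid_root : valid root None.
Proof. by rewrite /= (proj2 (len0 _)). Qed.

Definition uroot : upos := exist (fun z : T * data => valid z.1 z.2) (root, None) valid_root.

Lemma valid_low t d : valid t d -> len t <= K -> d = None.
Proof.
case: d => [[A [[u|B]|]]|] //=.
- by move=> [h _ _ _ _] /(leq_trans h) /ltnW; rewrite ltnn.
- by move=> [h _ _ _] /(leq_trans h) /ltnW; rewrite ltnn.
- by move=> [-> _]; rewrite ltnn.
Qed.

Definition unraveled : tree.
Proof.
apply: (@Tree upos uroot (fun z => len (sval z).1) upar).
- move=> z; split=> [lz|->]; last exact/len0.
  apply: upos_ext; rewrite [sval z]surjective_pairing /=; congr pair; first exact/len0.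
  by apply: valid_low (svalP z) _; rewrite lz.
- by move=> z; rewrite /= len_par.
- move=> [[t d] v]; have [u [d' [tu v' pd]]] := valid_child v.
  exists (exist (fun z : T * data => valid z.1 z.2) (u, d') v'); split; last exact: tu.2.
  by apply: upos_ext => /=; rewrite tu.1 tu.2 pd.
Defined.

Definition uproj (z : unraveled) : T := (sval z).1.
Definition udata (z : unraveled) : data := (sval z).2.

Definition upt t d (v : valid t d) : unraveled :=
  exist (fun z : T * data => valid z.1 z.2) (t, d) v.

Lemma uchild (z z' : unraveled) : child z z' ->
  child (uproj z) (uproj z') /\ par_data (len (uproj z')) (udata z') = udata z.
Proof. by move=> [<- l']; split. Qed.

Lemma udata_keep (z z' : unraveled) : child z z' -> K.+2 <= len (uproj z) ->
  udata z' = udata z.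
Proof.
move=> zz' lz; have [c <-] := uchild zz'; rewrite /par_data.
case: (udata z') => // -[A b]; rewrite c.2 !ltnS.
by rewrite leqNgt (ltnW lz) /= leqNgt lz.
Qed.

Lemma udata_play (x : nat -> unraveled) n : play x -> K.+2 <= n ->
  udata (x n) = udata (x K.+2).
Proof.
move=> px; elim: n => // n IH; rewrite leq_eqVlt => /orP[/eqP <-//|h].
rewrite (udata_keep (play_child n px)) ?IH //.
by have := play_len n px; rewrite /= => ->.
Qed.

(** * Pushing strategies down from the unravelled tree *)

Section Strategies.
Variable s : unraveled -> unraveled.
Hypothesis ss : strat s.

Let f0 := sval (cid (strat_exists T)).
Let sf0 : strat f0. Proof. exact: (svalP (cid (strat_exists T))). Qed.

(** Together with [appd], a total version of the answer of [s] in which position and commitments are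
    separated; the values at invalid pairs are dummies. *)
Definition app t d : T := if pselect (valid t d) is left v then uproj (s (upt v)) else f0 t.
Definition appd t d : data := if pselect (valid t d) is left v then udata (s (upt v)) else None.

Lemma appE t d (v : valid t d) : uproj (s (upt v)) = app t d.
Proof. by rewrite /app; case: pselect => // v'; rewrite (Prop_irrelevance v v'). Qed.

Lemma appdE t d (v : valid t d) : udata (s (upt v)) = appd t d.
Proof. by rewrite /appd; case: pselect => // v'; rewrite (Prop_irrelevance v v'). Qed.

Lemma app_child t d : child t (app t d).
Proof.
rewrite /app; case: pselect => [v|_]; last exact: sf0.
by have [] := uchild (ss (upt v)).
Qed.

Lemma app_valid t d : valid t d -> valid (app t d) (appd t d).
Proof. by move=> v; rewrite -(appE v) -(appdE v); exact: (svalP (s (upt v))). Qed.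

Lemma appd_par t d : valid t d -> par_data (len t).+1 (appd t d) = d.
Proof.
move=> v; have [c e] := uchild (ss (upt v)).
by rewrite -(appdE v) -[RHS]e c.2.
Qed.

Lemma appd_keep t A b : valid t (Some (A, Some b)) ->
  appd t (Some (A, Some b)) = Some (A, Some b).
Proof.
move=> v; have := appd_par v; rewrite /par_data; case: (appd _ _) => // -[B b'].
by do 2 case: ifP => _ //.
Qed.

Lemma appd_low t : len t < K -> appd t None = None.
Proof.
move=> lt; have v : valid t None by apply: ltnW.
by apply: valid_low (app_valid v) _; rewrite (app_child t None).2.
Qed.

Lemma appd_K t : len t = K -> exists2 A, appd t None = Some (A, None)
  & quasi1 (app t None) A.
Proof.
move=> lt; have v : valid t None by rewrite /= lt.
have := app_valid v; have := (app_child t None).2; rewrite lt.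
case: (appd t None) => [[A [[u|B]|]]|] /= l.
- by rewrite l ltnn => -[].
- by rewrite l ltnn => -[].
- by move=> [_ q]; exists A.
- by rewrite l ltnn.
Qed.

Lemma appd_K1 t A : valid t (Some (A, None)) ->
  exists b, appd t (Some (A, None)) = Some (A, Some b).
Proof.
move=> v; have lt : len t = K.+1 by case: v.
have := appd_par v; have := app_valid v.
case: (appd _ _) => [[B [b|]]|] //=.
  by rewrite lt ltnn leqnn => _ [->]; exists b.
by rewrite (app_child _ _).2 lt => -[/eqP]; rewrite eqn_leq ltnn.
Qed.

Lemma app_forced t A u : valid t (Some (A, Some (inl u))) -> len t < len u ->
  app t (Some (A, Some (inl u))) = anc (len t).+1 u.
Proof.
move=> v ltu; have := app_valid v; rewrite (appd_keep v) /= => -[_ _ _ _].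
by rewrite (app_child _ _).2 (minn_idPl ltu) anc_id // (app_child _ _).2.
Qed.

(** The commitments visible at level [n] on a play on which the two players commit to [A] and
    [b]. *)
Definition tag (A : set T) (b : T + set T) n : data :=
  if n <= K then None else if n == K.+1 then Some (A, None) else Some (A, Some b).

Lemma tag_high A b n : K.+2 <= n -> tag A b n = Some (A, Some b).
Proof. by move=> h; rewrite /tag leqNgt (ltnW h) gtn_eqF. Qed.

Lemma tag_lift i x A b : play x -> (forall n, valid (x n) (tag A b n)) ->
  (forall n, odd n = i -> x n.+1 = app (x n) (tag A b n) /\
     (K <= n <= K.+1 -> appd (x n) (tag A b n) = tag A b n.+1)) ->
  exists x', [/\ play x', follows i s x' & forall n, uproj (x' n) = x n].
Proof.
move=> px vx fx; exists (fun n => upt (vx n)); split=> //.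
  move=> n; split; first by rewrite /= play_len.
  apply: upos_ext => /=; have [_ ->] := px n; congr pair.
  rewrite (play_len _ px) /tag /par_data.
  rewrite !ltnS eqSS; case: (ltngtP n K) => [h|h|h] //=.
  by case: (ltngtP n K.+1) => //; rewrite ltnS leqNgt h.
move=> n io; have [E Ed] := fx n io; apply: upos_ext.
rewrite [RHS]surjective_pairing [LHS]surjective_pairing /=.
rewrite -/(uproj _) appE -/(udata _) appdE E; congr pair.
have [h|h] := ltnP n K; first by rewrite /tag (ltnW h) h appd_low ?play_len.
have [h'|h'] := leqP n K.+1; first by rewrite Ed ?h ?h'.
have tE := tag_high A b h'; have tE' := tag_high A b (leqW h').
by rewrite tE' tE appd_keep // -tE.
Qed.


Definition att i A Y w : T -> T := pick_in f0 [set f | attracts i A Y w f].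

Lemma attP i A Y w : win i A Y w -> attracts i A Y w (att i A Y w).
Proof. by move=> /win_attracts[f hf]; exact: (@pick_inP _ f0 f). Qed.

Lemma att_strat i A Y w : strat (att i A Y w).
Proof.
rewrite /att /pick_in; case: pselect => [h|_]; last exact: sf0.
by case: cid => f [].
Qed.

(** The quasistrategy that [s] commits to on leaving level [K], recovered from a later position;
    [setT] is a dummy. *)
Definition sig1 t : set T := if appd (anc K t) None is Some (A, _) then A else setT.

(** The quasistrategy of never letting the first player force [O] inside [A]; the simulation
    pretends that the second player has committed to it. *)
Definition safe2 A t : set T := [set q | [/\ A q, K.+2 <= len q, anc K.+2 q = t
  & forall m, K.+2 <= m <= len q -> ~ win false A O (anc m q)]].

(** Simulates [s] although the second player makes no commitment. While the first player cannot
    force [O] inside [A], the commitment is taken to be [safe2]. Once he can, he forces [O], and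
    when it is reached at a position [u], the commitment is reinterpreted as having been [u] from
    the start. *)
Definition push1 t : T :=
  if len t <= K then app t None else
  if pselect (hits K.+2 O t) then
    app t (Some (sig1 t, Some (inl (first_hit K.+2 O t)))) else
  if pselect (hits K.+2 (win false (sig1 t) O) t) then
    att false (sig1 t) O (first_hit K.+2 (win false (sig1 t) O) t) t
  else app t (Some (sig1 t, Some (inr (safe2 (sig1 t) (anc K.+2 t))))).

Lemma push1_strat : strat push1.
Proof.
move=> t; rewrite /push1; case: ifP => _; first exact: app_child.
case: pselect => /= _; first exact: app_child.
case: pselect => /= _; [exact: att_strat|exact: app_child].
Qed.

Lemma safe2_child A t q u : safe2 A t q -> child q u -> A u ->
  ~ win false A O u -> safe2 A t u.
Proof.
move=> [Aq lq aq hq] qu Au nu; split=> //; first by rewrite qu.2 leqW.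
  by rewrite (anc_child qu).
move=> m /andP[Km]; rewrite qu.2 leq_eqVlt => /orP[/eqP ->|mq].
  by rewrite anc_id ?qu.2.
by rewrite (anc_child qu) //; apply: hq; rewrite Km.
Qed.

Lemma safe2_start A t t' : len t = K.+1 -> quasi1 t A -> child t t' ->
  ~ win false A O t' -> safe2 A t' t'.
Proof.
move=> lt [At A1 _ _] tt' nw; have lt' : len t' = K.+2 by rewrite tt'.2 lt.
split; rewrite ?lt' ?anc_id ?lt' //; first by apply: A1 tt'; rewrite // lt /= K_even.
by move=> m; rewrite -eqn_leq => /eqP <-; rewrite anc_id ?lt'.
Qed.

Lemma quasi2_safe A t t' : len t = K.+1 -> quasi1 t A -> child t t' ->
  ~ win false A O t' -> quasi2 t' A (safe2 A t').
Proof.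
move=> lt qA tt' nw; have [_ A1 A2 A3] := qA; split.
- by split=> [|q []//]; exact: safe2_start tt' nw.
- by move=> q [_ lq _ /(_ (len q))]; rewrite lq leqnn anc_id // => /(_ isT) /not_win_goal.
- move=> q u sq oq qu Au; apply: (safe2_child sq qu Au).
  case: sq => _ lq _ /(_ (len q)); rewrite lq leqnn anc_id // => /(_ isT).
  by apply: not_win_own => //; exact: negbTE.
- move=> q sq oq; have [Aq lq _ /(_ (len q))] := sq.
  rewrite lq leqnn anc_id // => /(_ isT) nq.
  have [u qu nu] := not_win_opp (i := false) oq nq.
  by exists u => //; apply: (safe2_child sq qu) nu; apply: A1 qu.
- move=> q [Aq lq aq hq] lt2.
  have E : (len q).-1.+1 = len q by rewrite prednK // (leq_trans _ lt2).
  split; [by apply: A3 => //; apply: ltnW|by rewrite len_par -ltnS E|by rewrite anc_par|].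
  move=> m; rewrite len_par => /andP[Km mq]; rewrite anc_par; last by rewrite -E ltnS.
  by apply: hq; rewrite Km (leq_trans mq) // leq_pred.
Qed.

Section Lift1.
Variable x : nat -> T.
Hypotheses (px : play x) (fx : follows false push1 x).

Let A := sig1 (x K).

Lemma sig1E n : K <= n -> sig1 (x n) = A.
Proof. by move=> h; rewrite /A /sig1 !(play_anc px). Qed.

Lemma lift1_K : appd (x K) None = Some (A, None) /\ quasi1 (x K.+1) A.
Proof.
have [|B E q] := @appd_K (x K); first by rewrite play_len.
have -> : A = B by rewrite /A /sig1 anc_id ?E // play_len.
by split=> //; rewrite fx // /push1 play_len // leqnn.
Qed.

Lemma lift1_opp n : odd n = ~~ false -> A (x n) -> A (x n.+1).
Proof.
move=> on An; have [_ [_ A1 _ _]] := lift1_K.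
by apply: A1 An _ (play_child n px); rewrite play_len.
Qed.

Lemma push1_O n m : K.+2 <= m <= n -> O (x m) -> (forall j, K.+2 <= j < m -> ~ O (x j)) ->
  push1 (x n) = app (x n) (Some (A, Some (inl (x m)))).
Proof.
move=> /andP[Km mn] Om nO; have Kn : K < n by apply: leq_trans mn; apply: ltnW.
rewrite /push1 play_len // leqNgt Kn /= sig1E ?(ltnW Kn) //; case: pselect => /= h.
  by rewrite (@first_hit_play _ _ _ x m) // Km.
by case: h; apply/hits_play => //; exists m; rewrite ?Km.
Qed.

Lemma push1_W n m : K.+2 <= m <= n -> win false A O (x m) ->
  (forall j, K.+2 <= j < m -> ~ win false A O (x j)) ->
  (forall j, K.+2 <= j <= n -> ~ O (x j)) ->
  push1 (x n) = att false A O (x m) (x n).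
Proof.
move=> /andP[Km mn] Wm nW nO; have Kn : K < n by apply: leq_trans mn; apply: ltnW.
rewrite /push1 play_len // leqNgt Kn /= sig1E ?(ltnW Kn) //; case: pselect => /= h.
  by case: (proj1 (hits_play _ _ _ px) h) => j jn /nO; case.
case: pselect => /= h'; first by rewrite (@first_hit_play _ _ _ x m) // Km.
by case: h'; apply/hits_play => //; exists m; rewrite ?Km.
Qed.

Lemma push1_safe n : K.+2 <= n -> (forall j, K.+2 <= j <= n -> ~ win false A O (x j)) ->
  push1 (x n) = app (x n) (Some (A, Some (inr (safe2 A (x K.+2))))).
Proof.
move=> Kn nW; have Kn' : K < n by apply: ltnW.
rewrite /push1 play_len // leqNgt Kn' /= sig1E ?(ltnW Kn') //; case: pselect => /= h.
  by case: (proj1 (hits_play _ _ _ px) h) => j jn /win_goal /nW; case.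
case: pselect => /= h'; last by rewrite play_anc.
by case: (proj1 (hits_play _ _ _ px) h') => j jn /nW; case.
Qed.

Lemma lift1_safe n : K.+2 <= n -> (forall j, K.+2 <= j <= n -> ~ win false A O (x j)) ->
  safe2 A (x K.+2) (x n).
Proof.
have [_ qA] := lift1_K; have l1 : len (x K.+1) = K.+1 by rewrite play_len.
have c := play_child K.+1 px.
elim: n => // n IH; rewrite leq_eqVlt => /orP[/eqP [<-] nW|Kn nW].
  by apply: safe2_start c (nW _ _); rewrite ?leqnn.
have nWn j : K.+2 <= j <= n -> ~ win false A O (x j).
  by move=> /andP[Kj jn]; apply: nW; rewrite Kj leqW.
rewrite ltnS in Kn; have sn := IH Kn nWn; apply: (safe2_child sn (play_child n px) _ (nW _ _)).
  case E : (odd n); first by case: sn => An _ _ _; exact: lift1_opp.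
  rewrite fx // push1_safe //; set d := Some _.
  have v : valid (x n) d.
    split; rewrite ?play_len ?play_anc ?(ltnW Kn) //.
    by apply: (quasi2_safe _ qA c) => //; apply: nWn; rewrite leqnn.
  have := app_valid v; rewrite appd_keep // => -[_ _ _ []//].
by rewrite leqnn andbT leqW.
Qed.

(* As long as the first player has no way to force [O], the play stays in a
   quasistrategy avoiding [O]; once it has one, [push1] forces [O] inside [A]. *)
Lemma lift1_exit n : K.+2 <= n -> win false A O (x n) ->
  exists m, [/\ K.+2 <= m, O (x m), forall j, K.+2 <= j < m -> ~ O (x j) & A (x m)].
Proof.
move=> Kn Wn; have [m0 [/andP[Km0 _] W0 min0]] := @first_index (fun j => win false A O (x j)) _ _ Kn Wn.
have A0 : A (x m0).
  move: Km0; rewrite leq_eqVlt => /orP[/eqP E|Km0].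
    rewrite -E; apply: lift1_opp; first by rewrite /= K_even.
    by case: lift1_K => _ [].
  case: m0 Km0 W0 min0 => // m0; rewrite ltnS => Km0 W0 min0.
  have nW j : K.+2 <= j <= m0 -> ~ win false A O (x j) by move=> h; apply: min0.
  have sn := lift1_safe Km0 nW.
  case E : (odd m0); first by case: sn => An _ _ _; exact: lift1_opp.
  have [_ qA] := lift1_K.
  rewrite fx // push1_safe //; set d := Some _.
  have v : valid (x m0) d.
    split; rewrite ?play_len ?play_anc ?(ltnW Km0) //.
    apply: (quasi2_safe _ qA (play_child K.+1 px)); first by rewrite play_len.
    by apply: nW; rewrite leqnn.
  by have := app_valid v; rewrite appd_keep // => -[_ _ _ []].
have [sA hA] := attP W0.
have l0 : len (x m0) = m0 by rewrite play_len.
have [||n1 [mn1 On1 hn1]] := hA x px _ A0 lift1_opp; rewrite ?l0 //.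
  move=> j mj oj nO; rewrite fx // (@push1_W _ m0) ?Km0 //.
  move=> i /andP[Ki ij]; have [h|h] := ltnP i m0; last by apply: nO; rewrite h.
  by move=> Oi; apply: (min0 i); [rewrite Ki|exact: win_goal].
rewrite l0 in mn1 hn1.
have [m [/andP[Km mn] Om min]] := @first_index (fun j => O (x j)) _ _ (leq_trans Km0 mn1) On1.
exists m; split=> //; apply: hn1; rewrite mn andbT leqNgt; apply/negP => h.
by apply: (min0 m); [rewrite Km|exact: win_goal].
Qed.

Lemma push1_lift : exists x', [/\ play x', follows false s x' & forall n, uproj (x' n) = x n].
Proof.
have [EK qA] := lift1_K.
have low n : n <= K -> push1 (x n) = app (x n) None by move=> h; rewrite /push1 play_len ?h.
have oddK n : odd n = false -> K <= n <= K.+1 -> n = K.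
  move=> on /andP[]; rewrite leq_eqVlt => /orP[/eqP//|h1 h2].
  by move: on; have -> : n = K.+1 by [apply/eqP; rewrite eqn_leq h2 h1]; rewrite /= K_even.
have [[n Kn On]|nO] := pselect (exists2 n, K.+2 <= n & O (x n)).
  have [m [Km Om min Am]] := lift1_exit Kn (win_goal _ _ On).
  apply: (@tag_lift false x A (inl (x m))) => // j.
    rewrite /tag; have [h|h] := leqP j K; first by rewrite /= play_len.
    case: eqP => [->|ne]; first by rewrite /= play_len.
    have Kj : K.+2 <= j by rewrite ltn_neqAle eq_sym h andbT; apply/eqP.
    split; rewrite ?play_len ?play_anc ?geq_minl ?geq_minr //; exact: ltnW.
  move=> oj; split; last first.
    by move=> /(oddK _ oj) ->; rewrite /tag leqnn ltnn eqxx.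
  rewrite fx // /tag; case: leqP => h; first exact: low.
  case: eqP => [jE|ne]; first by move: oj; rewrite jE /= K_even.
  have Kj : K.+2 <= j by rewrite ltn_neqAle eq_sym h andbT; apply/eqP.
  have [jm|mj] := ltnP j m; last by rewrite (@push1_O _ m) // Km.
  (* Before [x m] is reached, this commitment leaves [s] no choice, so the moves actually made are
     those of [s]. *)
  rewrite -fx // app_forced ?play_len ?play_anc //.
  split; rewrite ?play_len ?play_anc ?geq_minl ?geq_minr //; exact: ltnW.
have nW j : K.+2 <= j -> ~ win false A O (x j).
  by move=> Kj Wj; have [m [Km Om _ _]] := lift1_exit Kj Wj; apply: nO; exists m.
apply: (@tag_lift false x A (inr (safe2 A (x K.+2)))) => // j.
  rewrite /tag; have [h|h] := leqP j K; first by rewrite /= play_len.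
  case: eqP => [->|ne]; first by rewrite /= play_len.
  have Kj : K.+2 <= j by rewrite ltn_neqAle eq_sym h andbT; apply/eqP.
  split; rewrite ?play_len ?play_anc ?(ltnW Kj) //.
    by apply: (quasi2_safe _ qA (play_child K.+1 px)); [rewrite play_len|exact: nW].
  by apply: lift1_safe => // i /andP[Ki _]; exact: nW.
move=> oj; split; last by move=> /(oddK _ oj) ->; rewrite /tag leqnn ltnn eqxx.
rewrite fx // /tag; case: leqP => h; first exact: low.
case: eqP => [jE|ne]; first by move: oj; rewrite jE /= K_even.
have Kj : K.+2 <= j by rewrite ltn_neqAle eq_sym h andbT; apply/eqP.
by apply: push1_safe => // i /andP[Ki _]; exact: nW.
Qed.

End Lift1.

(** The positions with which [s] answers some commitment of the first player at [t]. Once one of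
    them is reached, that commitment can be attributed to him in retrospect. *)
Definition yset t : set T := [set u | exists A, valid t (Some (A, None)) /\
  appd t (Some (A, None)) = Some (A, Some (inl u))].

Definition ysig t u : set T := pick_in setT [set A | valid t (Some (A, None)) /\
  appd t (Some (A, None)) = Some (A, Some (inl u))].

Lemma ysigP t u : yset t u -> valid t (Some (ysig t u, None)) /\
  appd t (Some (ysig t u, None)) = Some (ysig t u, Some (inl u)).
Proof. by move=> [A hA]; rewrite /ysig; set P := (X in pick_in _ X); exact: (@pick_inP _ setT A P). Qed.

Definition safe1 t : set T := [set q | [/\ K.+1 <= len q, anc K.+1 q = t
  & forall m, K.+1 <= m <= len q -> ~ win true setT (yset t) (anc m q)]].

(** Here the commitment of the first player is missing. It is taken to be [safe1], the quasistrategy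
    of staying outside the attractor of [yset]. If the play enters the attractor, the second player
    forces [yset], and the commitment is reinterpreted as [ysig] of the position reached. *)
Definition push2 t : T :=
  if len t <= K then app t None else
  let t1 := anc K.+1 t in
  if pselect (hits K.+2 (yset t1) t) then
    app t (Some (ysig t1 (first_hit K.+2 (yset t1) t),
                 Some (inl (first_hit K.+2 (yset t1) t)))) else
  if pselect (hits K.+1 (win true setT (yset t1)) t) then
    att true setT (yset t1) (first_hit K.+1 (win true setT (yset t1)) t) t
  else if len t == K.+1 then app t (Some (safe1 t1, None))
  else app t (appd t1 (Some (safe1 t1, None))).

Lemma push2_strat : strat push2.
Proof.
move=> t; rewrite /push2; case: ifP => _; first exact: app_child.
case: pselect => /= _; first exact: app_child.
case: pselect => /= _; first exact: att_strat.
by case: ifP => _; exact: app_child.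
Qed.

Lemma yset_valid t u : yset t u ->
  valid (app t (Some (ysig t u, None))) (Some (ysig t u, Some (inl u))).
Proof. by move=> /ysigP[v <-]; exact: app_valid. Qed.

Lemma yset_len t u : yset t u -> K.+2 <= len u.
Proof. by move=> /yset_valid[]. Qed.

Lemma safe1_child t q u : safe1 t q -> child q u ->
  ~ win true setT (yset t) u -> safe1 t u.
Proof.
move=> [lq aq hq] qu nu; split; first by rewrite qu.2 leqW.
  by rewrite (anc_child qu).
move=> m /andP[Km]; rewrite qu.2 leq_eqVlt => /orP[/eqP ->|mq].
  by rewrite anc_id ?qu.2.
by rewrite (anc_child qu) //; apply: hq; rewrite Km.
Qed.

Lemma quasi1_safe t : len t = K.+1 -> ~ win true setT (yset t) t ->
  quasi1 t (safe1 t).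
Proof.
move=> lt nw; have last q : safe1 t q -> ~ win true setT (yset t) q.
  by move=> [lq _ /(_ (len q))]; rewrite lq leqnn anc_id // => /(_ isT).
split.
- split; rewrite ?lt ?anc_id ?lt // => m.
  by rewrite -eqn_leq => /eqP <-; rewrite anc_id ?lt.
- move=> q u sq oq qu; apply: (safe1_child sq qu).
  by apply: not_win_own (last _ sq) => //.
- move=> q sq oq; have [u qu nu] := not_win_opp (i := true) (negbTE oq) (last _ sq).
  by exists u => //; exact: safe1_child sq qu nu.
- move=> q [lq aq hq] lt2.
  have E : (len q).-1.+1 = len q by rewrite prednK // (leq_trans _ lt2).
  split; [by rewrite len_par -ltnS E|by rewrite anc_par|].
  move=> m; rewrite len_par => /andP[Km mq]; rewrite anc_par; last by rewrite -E ltnS.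
  by apply: hq; rewrite Km (leq_trans mq) // leq_pred.
Qed.

Section Lift2.
Variable x : nat -> T.
Hypotheses (px : play x) (fx : follows true push2 x).

Let t1 := x K.+1.
Let Y := yset t1.
Let l1 : len t1 = K.+1. Proof. by rewrite play_len. Qed.

Lemma push2_Y n m : K.+2 <= m <= n -> Y (x m) -> (forall j, K.+2 <= j < m -> ~ Y (x j)) ->
  push2 (x n) = app (x n) (Some (ysig t1 (x m), Some (inl (x m)))).
Proof.
move=> /andP[Km mn] Om nO; have Kn : K < n by apply: leq_trans mn; apply: ltnW.
rewrite /push2 play_len // leqNgt Kn /= play_anc // -/t1 -/Y; case: pselect => /= h.
  by rewrite (@first_hit_play _ _ _ x m) // Km.
by case: h; apply/hits_play => //; exists m; rewrite ?Km.
Qed.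

Lemma push2_W n m : K.+1 <= m <= n -> win true setT Y (x m) ->
  (forall j, K.+1 <= j < m -> ~ win true setT Y (x j)) ->
  (forall j, K.+2 <= j <= n -> ~ Y (x j)) ->
  push2 (x n) = att true setT Y (x m) (x n).
Proof.
move=> /andP[Km mn] Wm nW nO; have Kn : K < n by apply: leq_trans mn.
rewrite /push2 play_len // leqNgt Kn /= play_anc // -/t1 -/Y; case: pselect => /= h.
  by case: (proj1 (hits_play _ _ _ px) h) => j jn /nO; case.
case: pselect => /= h'; first by rewrite (@first_hit_play _ _ _ x m) // Km.
by case: h'; apply/hits_play => //; exists m; rewrite ?Km.
Qed.

Lemma push2_safe n : K.+1 <= n -> (forall j, K.+1 <= j <= n -> ~ win true setT Y (x j)) ->
  push2 (x n) = app (x n) (if n == K.+1 then Some (safe1 t1, None)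
                           else appd t1 (Some (safe1 t1, None))).
Proof.
move=> Kn nW; rewrite /push2 play_len // leqNgt Kn /= play_anc // -/t1 -/Y.
case: pselect => /= h.
  have [j /andP[Kj jn] /win_goal /nW] := proj1 (hits_play _ _ _ px) h.
  by case; rewrite (ltnW Kj).
case: pselect => /= h'; last by case: ifP.
by case: (proj1 (hits_play _ _ _ px) h') => j jn /nW; case.
Qed.

Lemma lift2_exit n : K.+1 <= n -> win true setT Y (x n) -> exists2 m, K.+2 <= m & Y (x m).
Proof.
move=> Kn Wn; apply: contrapT => nY.
have [m0 [/andP[Km0 _] W0 min0]] := @first_index (fun j => win true setT Y (x j)) _ _ Kn Wn.
have [sA hA] := attP W0.
have l0 : len (x m0) = m0 by rewrite play_len.
have [||||n1 [mn1 On1 hn1]] := hA x px; rewrite ?l0 //.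
  move=> j mj oj nO; rewrite fx // (@push2_W _ m0) ?Km0 //.
  by move=> i /andP[Ki _] Yi; apply: nY; exists i.
by apply: nY; exists n1 => //; have := yset_len On1; rewrite play_len.
Qed.

Lemma push2_lift : exists x', [/\ play x', follows true s x' & forall n, uproj (x' n) = x n].
Proof.
have low n : n <= K -> push2 (x n) = app (x n) None by move=> h; rewrite /push2 play_len ?h.
have oddK n : odd n = true -> K <= n <= K.+1 -> n = K.+1.
  move=> on /andP[]; rewrite leq_eqVlt => /orP[/eqP E|h1 h2].
    by move: on; rewrite -E K_even.
  by apply/eqP; rewrite eqn_leq h2 h1.
have tK1 A b : tag A b K.+1 = Some (A, None) by rewrite /tag ltnn eqxx.
have tK2 := tag_high.
have cases j : [\/ j <= K, j = K.+1 | K.+2 <= j].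
  have [h|h] := leqP j K; first by constructor 1.
  by move: h; rewrite leq_eqVlt => /orP[/eqP <-|]; [constructor 2|constructor 3].
have tlow A b j : j <= K -> tag A b j = None by move=> h; rewrite /tag h.
have [[n Kn Yn]|nY] := pselect (exists2 n, K.+2 <= n & Y (x n)).
  have [m [/andP[Km mn] Ym min]] := @first_index (fun j => Y (x j)) _ _ Kn Yn.
  have [v vE] := ysigP Ym; have := yset_valid Ym.
  set A := ysig t1 (x m) in v vE *; move=> [_ _ [Am Om] _].
  have [la _] := (app_child t1 (Some (A, None))).
  rewrite (app_child _ _).2 l1 play_len // (minn_idPl Km) anc_id; last first.
    by rewrite (app_child _ _).2 l1.
  rewrite play_anc // => appx.
  have q1 : quasi1 t1 A by case: v.
  have vx j : valid (x j) (tag A (inl (x m)) j).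
    have [h|->|h] := cases j; first by rewrite tlow //= play_len.
      by rewrite tK1.
    rewrite tK2 //; split; rewrite ?play_len ?play_anc ?geq_minl ?geq_minr //; exact: ltnW.
  apply: (@tag_lift true x A (inl (x m))) => // j oj; split; last first.
    by move=> /(oddK _ oj) ->; rewrite tK1 tK2.
  have [h|jE|h] := cases j; first by rewrite fx // tlow // low.
    by rewrite jE tK1 appx.
  have vj := vx j; rewrite tK2 // in vj *.
  have [jm|mj] := ltnP j m; last by rewrite fx // (@push2_Y _ m) // Km.
  by rewrite app_forced ?play_len ?play_anc.
have nW j : K.+1 <= j -> ~ win true setT Y (x j) by move=> h /(lift2_exit h).
have sx j : K.+1 <= j -> safe1 t1 (x j).
  move=> Kj; split; rewrite ?play_len ?play_anc // => m /andP[Km mj].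
  by rewrite play_anc //; exact: nW.
have q1 : quasi1 t1 (safe1 t1) by apply: quasi1_safe => //; exact: nW.
have v1 : valid t1 (Some (safe1 t1, None)) by [].
(* An answer by a position is impossible: it would belong both to [yset] and to [safe1]. *)
have [[u|B] dE] := appd_K1 v1.
  have Yu : Y u by exists (safe1 t1).
  have := app_valid v1; rewrite dE /= => -[_ _ [[lu _ hu] _] _ _].
  by case: (hu (len u)); rewrite ?lu ?leqnn // anc_id //; exact: win_goal.
have follow j : odd j = true -> x j.+1 = app (x j) (tag (safe1 t1) (inr B) j).
  move=> oj; rewrite fx //; have [h|->|h] := cases j; first by rewrite tlow // low.
    by rewrite tK1 push2_safe ?eqxx // => i /andP[Ki _]; exact: nW.
  rewrite tK2 // push2_safe ?(ltnW h) // => [|i /andP[Ki _]]; last exact: nW.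
  by rewrite gtn_eqF // dE.
have [qB B2] : quasi2 (x K.+2) (safe1 t1) B /\ B (x K.+2).
  have := app_valid v1; rewrite dE; rewrite -[X in app X _]/(x K.+1) -(tK1 _ (inr B)).
  rewrite -follow /= ?K_even // => -[_ _ + ?].
  by rewrite anc_id // play_len.
have vx j : valid (x j) (tag (safe1 t1) (inr B) j).
  elim: j => [|j IH]; first by rewrite tlow //= play_len.
  have [h|->|h] := cases j.+1; first by rewrite tlow //= play_len.
    by rewrite tK1.
  move: (h); rewrite leq_eqVlt => /orP[/eqP[<-]|{}h].
    by rewrite tK2 //; split; rewrite ?play_len ?play_anc.
  rewrite tK2 //; last exact: ltnW.
  rewrite tK2 // in IH; have [_ _ _ Bj] := IH.
  split; rewrite ?play_len ?play_anc ?(ltnW h) //; last first.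
    case E : (odd j); last first.
      by case: qB => _ _ B1 _ _; apply: B1 Bj _ (play_child j px) (sx _ _); rewrite ?play_len ?E // ltnW // ltnW.
    rewrite follow // tK2 //; have := app_valid IH.
    by rewrite appd_keep // => -[].
  exact: (ltnW (ltnW h)).
apply: (@tag_lift true x (safe1 t1) (inr B)) => // j oj; split; first exact: follow.
by move=> /(oddK _ oj) ->; rewrite tK1 tK2.
Qed.

End Lift2.

End Strategies.


Lemma app_agree i n s s' t d : agree i n s s' -> len t < n -> odd (len t) = i ->
  app s t d = app s' t d /\ appd s t d = appd s' t d.
Proof.
by move=> h lt it; rewrite /app /appd; case: pselect => // v; rewrite h.
Qed.

Lemma push1_local n s s' : agree false n s s' -> agree false n (push1 s) (push1 s').
Proof.
move=> h t lt it; have E d := (app_agree d h lt it).1.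
rewrite /push1; case: leqP => Kt //.
have -> : sig1 s' t = sig1 s t.
  rewrite /sig1 (app_agree None h _ _).2 // anc_len // ?(ltnW Kt) //.
  exact: ltn_trans lt.
by rewrite !E.
Qed.

Lemma push2_local n s s' : agree true n s s' -> agree true n (push2 s) (push2 s').
Proof.
move=> h t lt it; have E d := (app_agree d h lt it).1.
rewrite /push2; case: leqP => Kt //=.
have Ed d : appd s' (anc K.+1 t) d = appd s (anc K.+1 t) d.
  apply/esym; apply: (app_agree d h _ _).2; rewrite anc_len //= ?K_even //.
  exact: leq_ltn_trans lt.
have Ey : yset s' (anc K.+1 t) = yset s (anc K.+1 t).
  by apply/seteqP; split=> u [A]; rewrite ?Ed => hA; exists A; rewrite ?Ed.
have Es u : ysig s' (anc K.+1 t) u = ysig s (anc K.+1 t) u.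
  rewrite /ysig; congr pick_in.
  by apply/seteqP; split=> A /=; rewrite Ed.
have Ef : safe1 s' (anc K.+1 t) = safe1 s (anc K.+1 t) by rewrite /safe1 Ey.
rewrite Ey Ef Ed; case: pselect => //= _; first by rewrite Es E.
by case: pselect => //= _; rewrite !E.
Qed.

Definition upush i s := if i then push2 s else push1 s.

Definition ucovering : covering unraveled T.
Proof.
apply: (@Covering unraveled T uproj upush) => //.
- by case=> s ss; [exact: push2_strat|exact: push1_strat].
- by case=> n s s' _ _; [exact: push2_local|exact: push1_local].
- by case=> s x ss px fx; [exact: push2_lift fx|exact: push1_lift fx].
Defined.

Lemma ucovering_k : kcovering K ucovering.
Proof.
have low (z : unraveled) : len (uproj z) <= K -> udata z = None.
  by move=> h; exact: valid_low (svalP z) h.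
split.
- move=> t u lt /= E; apply: upos_ext.
  rewrite [LHS]surjective_pairing [RHS]surjective_pairing.
  congr pair => //; rewrite -!/(udata _) !low //.
  by rewrite -E.
- by move=> u lu; exists (@upt u None lu).
- move=> i s [[t d] v] ss lt io; have dE : d = None by exact: valid_low v (ltnW lt).
  subst d; have lt' : len t <= K by exact: ltnW lt.
  transitivity (app s t None); last by rewrite -(appE s v).
  by case: {io} i; rewrite /= /push1 /push2 lt'.
Qed.

(** The commitment present at level [K.+2] settles the outcome: a named position of [O] will be
    passed through, and a named quasistrategy avoiding [O] will be kept. *)
Lemma ucovering_fixed : fixed_at K.+2 [set x | exists n, O (ucovering (x n))].
Proof.
move=> x y px py xy [n On].
have up m : O (uproj (x (n + m))).
  elim: m => [|m IH]; first by rewrite addn0.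
  rewrite addnS; apply: O_up.
  by have [[-> _] _] := uchild (play_child (n + m) px).
have vx := svalP (x (n + K.+2)); have vy := svalP (y K.+2).
move: vx; rewrite -/(uproj _) -/(udata _) udata_play // ?leq_addl //.
have l z j : play z -> len (uproj (z j)) = j by move=> pz; have := play_len j pz.
have l2 : len (uproj (y K.+2)) = K.+2 by exact: l.
move: vy; rewrite -/(uproj _) -/(udata _) -xy; case E : (udata (x K.+2)) => [[A [[u|B]|]]|] /=.
- move=> [_ _ [_ Ou] lu _] _; exists (len u).
  have := svalP (y (len u)); rewrite -/(uproj _) -/(udata _) udata_play // -xy E /=.
  rewrite (l y) // minnn => -[_ _ _ _].
  by rewrite !anc_id ?l // => ->.
- by move=> _ [_ _ [_ /(_ _ _) nO _ _ _] /nO]; case.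
- by rewrite xy l2 => -[/eqP]; rewrite eqn_leq ltnn.
- by rewrite xy l2 ltnNge leqnSn.
Qed.

End Unravel.

Definition unravels (T' T : tree) (c : covering T' T) (W : set (nat -> T)) :=
  exists N, fixed_at N [set x | W (c \o x)].

(* Quantifying over the covering [c] makes unravellings of countably many sets
   composable. *)
Definition unravelable (T : tree) (W : set (nat -> T)) :=
  forall (T' : tree) (c : covering T' T) k,
    exists (T'' : tree) (d : covering T'' T'), kcovering k d /\
      unravels (comp_covering c d) W.

Lemma unravelable_determined (T : tree) (W : set (nat -> T)) : unravelable W -> determined W.
Proof.
move=> /(_ T (id_covering T) 0)[T'' [d [_ [N hN]]]].
have [[s ss hs]|[s ss hs]] := fixed_determined hN; [left|right].
  exists (push d false s); first exact: push_strat.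
  move=> x px fx; have [x' [px' fx' E]] := push_lift ss px fx.
  by have := hs x' px' fx'; rewrite /= (_ : _ \o x' = x) //; apply: funext.
exists (push d true s); first exact: push_strat.
move=> x px fx; have [x' [px' fx' E]] := push_lift ss px fx.
by have := hs x' px' fx'; rewrite /= (_ : _ \o x' = x) //; apply: funext.
Qed.

Lemma unravelableC (T : tree) (W : set (nat -> T)) : unravelable W -> unravelable (~` W).
Proof.
move=> h T' c k; have [T'' [d [kd [N hN]]]] := h T' c k.
exists T'', d; split=> //; exists N => x y px py xy nx Wy; apply: nx.
exact: hN Wy.
Qed.

(** Closing [O] upwards does not change the set of plays that meet it. The level [k.*2] is even, as
    the unravelling requires, and at least [k]. *)
Lemma open_unravel (T : tree) (O : set T) k : exists (T' : tree) (c : covering T' T),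
  kcovering k c /\ unravels c [set x | exists n, O (x n)].
Proof.
pose O' : set T := [set t | exists2 m, m <= len t & O (anc m t)].
have up t : O' (par t) -> O' t.
  move=> [m mt Om]; have [lt|lt] := posnP (len t).
    have E : par t = t.
      by rewrite (proj1 (len0 t) lt); apply/len0; rewrite len_par (proj2 (len0 _)).
    by exists m; rewrite E in mt Om.
  rewrite len_par in mt; have mlt : m < len t by rewrite -ltnS prednK in mt.
  by exists m; [exact: ltnW|rewrite -anc_par].
have ev : odd k.*2 = false by rewrite odd_double.
exists (unraveled O' ev), (ucovering O' ev); split.
  by apply: kcoveringW (ucovering_k O' ev); rewrite -addnn leq_addr.
exists k.*2.+2 => x y px py xy [n On].
have [|m [j jm Oj]] := @ucovering_fixed _ _ _ ev up x y px py xy.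
  by exists n; exists n; rewrite ?anc_id ?len_proj ?play_len.
have pcy := play_proj (ucovering O' ev) py.
exists j => /=; move: Oj; rewrite -[ucovering _ _ _]/((ucovering O' ev \o y) m).
by rewrite (play_anc pcy) //; rewrite -[ucovering _ _ _]/((ucovering O' ev \o y) m) play_len in jm.
Qed.

Lemma unravelable_open (T : tree) (O : set T) : unravelable [set x | exists n, O (x n)].
Proof.
move=> T' c k; have [T'' [d [kd [N hN]]]] := open_unravel [set t | O (c t)] k.
by exists T'', d; split=> //; exists N.
Qed.

(** The sets are unravelled one after another by coverings with growing [k]. In the inverse limit
    each of them is decided at a finite level, so the union is open there, and one more unravelling
    finishes. *)
Lemma unravelable_bigcup (T : tree) (W : nat -> set (nat -> T)) :
  (forall n, unravelable (W n)) -> unravelable (\bigcup_n W n).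
Proof.
move=> hW T' c k.
pose st := {Q : tree & covering Q T}.
have step n (q : st) : exists q' : {Q' : tree & covering Q' (projT1 q)},
    kcovering (k + n) (projT2 q') /\ unravels (comp_covering (projT2 q) (projT2 q')) (W n).
  by case: q => Q e; have [Q' [d h]] := hW n Q e (k + n); exists (existT _ Q' d).
pose nxt n q := sval (cid (step n q)).
pose Q := fix Q n : st := match n with
  | 0 => existT _ T' c
  | j.+1 => existT _ (projT1 (nxt j (Q j))) (comp_covering (projT2 (Q j)) (projT2 (nxt j (Q j))))
  end.
pose cc n : covering (projT1 (Q n.+1)) (projT1 (Q n)) := projT2 (nxt n (Q n)).
have kcc n : kcovering (k + n) (cc n) := (svalP (cid (step n (Q n)))).1.
have uW n : unravels (projT2 (Q n.+1)) (W n) := (svalP (cid (step n (Q n)))).2.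
pose L := limit_tree kcc.
have pE n (t : L) : projT2 (Q n) (limit_proj n t) = c (limit_proj 0 t).
  elim: n => // n IH.
  by rewrite -IH -[in RHS](limit_projE kcc).
have fW n : exists N, fixed_at N [set x : nat -> L | W n (c \o (limit_proj 0 \o x))].
  have [N hN] := uW n; exists N => x y px py xy.
  have E z : c \o (@limit_proj k _ _ kcc 0 \o z) = projT2 (Q n.+1) \o (limit_proj n.+1 \o z).
    by apply: funext => j; rewrite /= -(pE n.+1).
  rewrite /= !E; apply: hN; [exact: play_limit_proj..|].
  by rewrite /= xy.
pose dL := limit_covering kcc.
have kL : kcovering k dL := limit_kcovering kcc.
pose O : set L := [set t | exists n, forall x, play x -> x (len t) = t ->
  W n (c \o (dL \o x))].
have [Q'' [d [kd [N hN]]]] := open_unravel O k.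
exists Q'', (comp_covering dL d); split; first exact: kcovering_comp.
have OE x : play x -> (exists n, O (x n)) <-> (\bigcup_n W n) (c \o (dL \o x)).
  move=> px; split=> [[m [n h]]|[n _ Wn]].
    by exists n => //; apply: h => //; rewrite play_len.
  have [M hM] := fW n; exists M, n => y py yx; apply: hM Wn => //.
  by rewrite (play_len _ px) in yx; rewrite yx.
exists N => x y px py xy Wx.
have := hN x y px py xy; rewrite /= !(OE (d \o _)); try exact: play_proj.
exact.
Qed.

(** * Games with Borel winning condition *)

Lemma unravelable_eq (T : tree) (W W' : set (nat -> T)) :
  (forall x, play x -> W x <-> W' x) -> unravelable W -> unravelable W'.
Proof.
move=> WW' h T' c k; have [T'' [d [kd [N hN]]]] := h T' c k.
exists T'', d; split=> //; exists N => x y px py xy.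
have pc z : play z -> play (comp_covering c d \o z) by exact: play_proj.
rewrite /= -(WW' _ (pc x px)) -(WW' _ (pc y py)); exact: hN.
Qed.

Lemma unravelableU (T : tree) (W W' : set (nat -> T)) :
  unravelable W -> unravelable W' -> unravelable (W `|` W').
Proof.
move=> h h'; apply: (@unravelable_eq _ (\bigcup_n (if n is 0 then W else W'))).
  move=> x _; split=> [[[|n] _ ?]|[?|?]]; [by left|by right|by exists 0|by exists 1].
by apply: unravelable_bigcup => -[].
Qed.

Lemma unravelableI (T : tree) (W W' : set (nat -> T)) :
  unravelable W -> unravelable W' -> unravelable (W `&` W').
Proof.
move=> h h'; rewrite -[W `&` W']setCK setCI; apply: unravelableC.
by apply: unravelableU; exact: unravelableC.
Qed.

Section Respect.
Variable T : tree.
Implicit Types (s : T -> T) (t u : T) (x : nat -> T).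

Definition respects (i : bool) s t :=
  forall n, n < len t -> odd n = i -> anc n.+1 t = s (anc n t).

Lemma respects_root i s : respects i s root.
Proof. by move=> n; rewrite (proj2 (len0 _)). Qed.

Lemma respects_child i s t u : respects i s t -> child t u ->
  (odd (len t) = i -> u = s t) -> respects i s u.
Proof.
move=> rt tu h n; rewrite tu.2 ltnS leq_eqVlt => /orP[/eqP -> io|nt io].
  by rewrite (anc_child (n := len t) tu) // anc_id ?tu.2 // anc_id // h.
by rewrite !(anc_child tu) // ?rt // ltnW.
Qed.

Lemma respects_play i s t : strat s -> respects i s t -> exists x,
  [/\ play x, follows i s x, x (len t) = t & x (len t).+1 = s t].
Proof.
move=> ss rt; have [x [px x1 x2]] := play_extend t ss.
have xt : x (len t) = t by rewrite x1 // anc_id.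
exists x; split=> //; last by rewrite x2 // xt.
move=> n io; have [tn|nt] := leqP (len t) n; first exact: x2.
by rewrite !x1 // ?rt // ltnW.
Qed.

End Respect.

(** The Borel sets of sequences over a discrete space, since every open set is a countable union of
    sets that depend on finitely many entries. *)
Definition borel_seq (X : Type) : set (set (nat -> X)) :=
  <<s [set Y | exists n, forall y y', (forall k, k < n -> y k = y' k) -> Y y -> Y y'] >>.

Lemma borel_seqC (X : Type) (Y : set (nat -> X)) : borel_seq Y -> borel_seq (~` Y).
Proof.
rewrite -setTD; have [_ h _] := @smallest_sigma_algebra _ setT
  [set Y : set (nat -> X) | exists n, forall y y', (forall k, k < n -> y k = y' k) -> Y y -> Y y'].
exact: h.
Qed.

Lemma borel_seq_bigcup (X : Type) (Y : nat -> set (nat -> X)) :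
  (forall n, borel_seq (Y n)) -> borel_seq (\bigcup_n Y n).
Proof.
have [_ _ h] := @smallest_sigma_algebra _ setT
  [set Y : set (nat -> X) | exists n, forall y y', (forall k, k < n -> y k = y' k) -> Y y -> Y y'].
exact: h.
Qed.

Lemma borel_seq_bigcap (X : Type) (Y : nat -> set (nat -> X)) :
  (forall n, borel_seq (Y n)) -> borel_seq (\bigcap_n Y n).
Proof.
move=> hY; rewrite -[\bigcap_n _]setCK setC_bigcap; apply: borel_seqC.
by apply: borel_seq_bigcup => n; exact: borel_seqC.
Qed.

Lemma borel_seqI (X : Type) (Y Y' : set (nat -> X)) :
  borel_seq Y -> borel_seq Y' -> borel_seq (Y `&` Y').
Proof.
move=> h h'; have -> : Y `&` Y' = \bigcap_n (if n is 0 then Y else Y').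
  by apply/seteqP; split=> [y [? ?] [|n] _ //|y hy]; split; [exact: (hy 0)|exact: (hy 1)].
by apply: borel_seq_bigcap => -[].
Qed.

Lemma borel_seq_cylinder (X : Type) n (Y : set (nat -> X)) :
  (forall y y', (forall k, k < n -> y k = y' k) -> Y y -> Y y') -> borel_seq Y.
Proof. by move=> hY A [_]; apply; exists n. Qed.

Fixpoint rounds (Y : Type) (z : nat -> Y) n : seq Y :=
  if n is k.+1 then z k :: rounds z k else [::].

Lemma size_rounds (Y : Type) (z : nat -> Y) n : size (rounds z n) = n.
Proof. by elim: n => //= n ->. Qed.

(** * Games played in rounds *)

Section Game.
Variables (M X : Type) (m0 : M) (x0 : X).
Variables (legal : nat -> X -> M -> Prop) (succ : M -> X -> Prop).
Implicit Types (p q : seq (M + X)) (h : seq (M * X)).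

(** The rules are not built into the tree: every finite sequence of moves, latest first, is a
    position, and the first illegal move loses. This avoids dead ends, where a player has no legal
    move. *)
Definition game_tree : tree.
Proof.
apply: (@Tree (seq (M + X)) [::] size behead).
- by move=> t; split=> [/size0nil|->].
- by case.
- by move=> t; exists (inr x0 :: t).
Defined.

Definition last_state p : X := if p is inr s :: _ then s else x0.

Definition allowed a p : Prop :=
  match a with
  | inl m => ~~ odd (size p) /\ legal (size p)./2 (last_state p) m
  | inr s => if p is inl m :: _ then succ m s else False
  end.

Fixpoint fair p : Prop := if p is a :: q then allowed a q /\ fair q else True.

Implicit Types x : nat -> game_tree.

Definition lost i x := exists k, [/\ fair (x k), ~ fair (x k.+1) & odd k = i].

Lemma fair_mono x m n : play x -> m <= n -> fair (x n) -> fair (x m).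
Proof.
move=> px mn; rewrite -(subnKC mn); elim: (n - m) => [|d IH]; first by rewrite addn0.
rewrite addnS => f; apply: IH; rewrite -(px (m + d)).2.
by case: (x (m + d).+1) f => //= a q [].
Qed.

Lemma lost_unique x : play x -> lost true x -> ~ lost false x.
Proof.
move=> px [k [fk nk ok]] [j [fj nj oj]]; case: (ltngtP k j) => kj.
- exact/nk/(fair_mono px kj).
- exact/nj/(fair_mono px kj).
- by rewrite kj oj in ok.
Qed.

Lemma lost_open i : unravelable (lost i).
Proof.
apply: (@unravelable_eq _ [set x | exists n, [set t : game_tree |
   [/\ fair (behead t), ~ fair t & odd (size t).-1 = i]] (x n)]); last first.
  exact: unravelable_open.
move=> x px; split=> [[[|n] [f nf o]]|[k [f nf o]]].
- by case: nf; have := play_len 0 px => /= /size0nil ->.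
- have := (px n).2 => /= E; have := play_len n.+1 px => /= S; rewrite E S in f o.
  by exists n.
- exists k.+1; split=> //; first by have := (px k).2 => /= ->.
  by have := play_len k.+1 px => /= ->.
Qed.

Fixpoint encode h : seq (M + X) :=
  if h is (m, s) :: h' then [:: inr s, inl m & encode h'] else [::].

Definition game_state h : X := if h is z :: _ then z.2 else x0.

Lemma size_encode h : size (encode h) = (size h).*2.
Proof. by elim: h => //= -[m s] h /= ->. Qed.

Lemma state_encode h : last_state (encode h) = game_state h.
Proof. by case: h => //= -[]. Qed.

Fixpoint follows_left (f : seq (M * X) -> M) h : Prop :=
  if h is (m, s) :: h' then [/\ follows_left f h', m = f h' & succ m s] else True.

Fixpoint follows_right (g : seq (M * X) -> M -> X) h : Prop :=
  if h is (m, s) :: h' then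
    [/\ follows_right g h', legal (size h') (game_state h') m & s = g h' m] else True.

Definition encode_play (z : nat -> M * X) n : game_tree :=
  if odd n then inl (z n./2).1 :: encode (rounds z n./2) else encode (rounds z n./2).

Lemma encode_playP z : play (encode_play z).
Proof.
move=> n; rewrite /encode_play; split.
  have := odd_double_half n.
  by case: (odd n) => /= E; rewrite size_encode size_rounds // -[RHS]E.
rewrite [in X in par X](_ : odd n.+1 = ~~ odd n) //= uphalf_half.
by case: (odd n) => //=; case: (z _).
Qed.

Lemma encode_play_double z n : encode_play z n.*2 = encode (rounds z n).
Proof. by rewrite /encode_play odd_double doubleK. Qed.

Lemma encode_play_follows i s z :
  (forall n, respects i s (encode (rounds z n) : game_tree)) ->
  follows i s (encode_play z).
Proof.
move=> r n io; have px := encode_playP z.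
have := r n.+1; rewrite -encode_play_double => /(_ n).
have l : n < (n.+1).*2 by rewrite -addnn addSn ltnS leq_addr.
by rewrite play_len // => /(_ l io); rewrite !play_anc // ltnW.
Qed.

Lemma encode_play_fair z i : (forall n, fair (encode (rounds z n))) ->
  ~ lost i (encode_play z).
Proof.
move=> f [k [_ nk _]]; apply: nk; apply: (@fair_mono _ _ (k.+1).*2).
- exact: encode_playP.
- by rewrite -addnn leq_addr.
- by rewrite encode_play_double.
Qed.

Lemma encode_play_state z n :
  last_state (encode_play z n.*2) = game_state (rounds z n).
Proof. by rewrite encode_play_double state_encode. Qed.

Variable Win : set (nat -> X).
Hypothesis borelWin : borel_seq Win.

Definition left_wins x := lost true x \/
  (~ lost false x /\ Win (fun n => last_state (x n.*2))).

Lemma left_wins_unravelable : unravelable left_wins.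
Proof.
apply: unravelableU; first exact: lost_open.
apply: unravelableI; first exact/unravelableC/lost_open.
have : [set Y : set (nat -> X) | unravelable
    [set x : nat -> game_tree | Y (fun n => last_state (x n.*2))]] Win; last exact.
move: Win borelWin; apply: smallest_sub => [|Y [n hY]].
  split=> [|Y hY|Y hY].
  - apply: (@unravelable_eq _ [set x | exists n, set0 (x n)]).
      by move=> x _; split=> // -[].
    exact: unravelable_open.
  - apply: unravelable_eq (unravelableC hY) => x _ /=.
    by split=> [|[]].
  - have := unravelable_bigcup hY; apply: unravelable_eq => x _.
    by split=> -[n _ h]; exists n.
apply: (@unravelable_eq _ [set x | exists k, [set t : game_tree | size t = n.*2 /\
   Y (fun k => last_state (anc k.*2 t))] (x k)]); last exact: unravelable_open.
move=> x px; split=> [[k [E]]|Yx] /=.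
  have := play_len k px => /= l; rewrite l in E; apply: hY => j jn.
  by rewrite play_anc // E leq_double ltnW.
exists n.*2; split; first by have := play_len n.*2 px.
by apply: hY Yx => j jn; rewrite play_anc // leq_double ltnW.
Qed.

Lemma encode_even h : odd (len (encode h : game_tree)) = false.
Proof. by rewrite /= size_encode odd_double. Qed.

(** A winning strategy moves legally after legal histories: otherwise the position extends to a play
    consistent with [s] in which the first illegal move is its own. *)
Lemma left_strategy s : strat s ->
  (forall x, play x -> follows false s x -> left_wins x) ->
  exists2 f, forall h, follows_left f h -> legal (size h) (game_state h) (f h) &
    forall z, (forall n, follows_left f (rounds z n)) -> Win (fun n => game_state (rounds z n)).
Proof.
move=> ss hs; pose f h := if s (encode h) is inl m :: _ then m else m0.
have step h : respects false s (encode h : game_tree) -> fair (encode h) ->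
    s (encode h) = inl (f h) :: encode h /\ legal (size h) (game_state h) (f h).
  move=> r fh; have [x [px fx xt xS]] := respects_play ss r.
  have fS : fair (s (encode h)).
    apply: contrapT => nf; have lf : lost false x.
      by exists (len (encode h : game_tree)); rewrite xt xS encode_even.
    case: (hs x px fx) => [lt|[]//]; exact: (lost_unique px lt).
  have [+ _] := ss (encode h); move: fS; rewrite /f.
  case: (s (encode h)) (ss (encode h)).2 => [//|a q] _ /= + E; rewrite E.
  case: a => [m|t] [] /=.
    by rewrite size_encode doubleK state_encode => -[].
  by case: (h) => //= -[].
have inv h : follows_left f h -> respects false s (encode h : game_tree) /\ fair (encode h).
  elim: h => [|[m t] h IH] /=; first by split=> //; exact: (@respects_root game_tree).
  move=> [/IH[r fh] E mt]; have [E' l] := step h r fh; split; last first.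
    by split=> //; rewrite size_encode odd_double doubleK state_encode E.
  apply: (@respects_child game_tree _ _ (inl m :: encode h)).
  - by apply: (respects_child r) => [|_]; [split|rewrite E' E].
  - by split.
  - by rewrite /= size_encode odd_double.
exists f => [h /inv[r fh]|z hz]; first by have [] := step h r fh.
have inv' n := inv _ (hz n).
have := hs _ (encode_playP z) (encode_play_follows (fun n => (inv' n).1)).
case=> [/(encode_play_fair (fun n => (inv' n).2))//|[_]].
by congr Win; apply: funext => n; exact: encode_play_state.
Qed.

Lemma right_strategy s : strat s ->
  (forall x, play x -> follows true s x -> ~ left_wins x) ->
  exists2 g, forall h m, follows_right g h -> legal (size h) (game_state h) m -> succ m (g h m) &
    forall z, (forall n, follows_right g (rounds z n)) -> ~ Win (fun n => game_state (rounds z n)).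
Proof.
move=> ss hs; pose g h m := if s (inl m :: encode h) is inr t :: _ then t else x0.
have step h m : respects true s (encode h : game_tree) -> fair (encode h) ->
    legal (size h) (game_state h) m -> s (inl m :: encode h) = [:: inr (g h m), inl m & encode h] /\
      [/\ succ m (g h m), fair (inl m :: encode h) &
        respects true s (inl m :: encode h : game_tree)].
  move=> r fh lm.
  have r' : respects true s (inl m :: encode h : game_tree).
    by apply: (respects_child r); [split|rewrite encode_even].
  have f' : fair (inl m :: encode h).
    by split=> //; rewrite /= size_encode odd_double doubleK state_encode.
  have [x [px fx xt xS]] := respects_play ss r'.
  have fS : fair (s (inl m :: encode h)).
    apply: contrapT => nf; apply: (hs x px fx); left.
    exists (len (inl m :: encode h : game_tree)); rewrite xt xS.
    by split=> //=; rewrite size_encode odd_double.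
  have [+ _] := ss (inl m :: encode h); move: fS; rewrite /g.
  case: (s (inl m :: encode h)) (ss (inl m :: encode h)).2 => [//|a q] _ /= + E; rewrite E.
  case: a => [m'|t] [] /=; last by move=> ?.
  by rewrite size_encode odd_double => -[].
have inv h : follows_right g h -> respects true s (encode h : game_tree) /\ fair (encode h).
  elim: h => [|[m t] h IH] /=; first by split=> //; exact: (@respects_root game_tree).
  move=> [/IH[r fh] l E]; have [E' [mt f' r']] := step h m r fh l.
  split; last by rewrite E; split.
  by apply: (respects_child r') => [|_]; [split|rewrite E' E].
exists g => [h m /inv[r fh] l|z hz]; first by have [_ []] := step h m r fh l.
have inv' n := inv _ (hz n).
have nW := hs _ (encode_playP z) (encode_play_follows (fun n => (inv' n).1)).
move=> wz; apply: nW; right; split; first exact: (encode_play_fair (fun n => (inv' n).2)).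
by move: wz; congr Win; apply: funext => n; rewrite encode_play_state.
Qed.

Theorem game_determined :
  (exists2 f, forall h, follows_left f h -> legal (size h) (game_state h) (f h) &
     forall z, (forall n, follows_left f (rounds z n)) -> Win (fun n => game_state (rounds z n)))
  \/
  (exists2 g, forall h m, follows_right g h -> legal (size h) (game_state h) m -> succ m (g h m) &
     forall z, (forall n, follows_right g (rounds z n)) -> ~ Win (fun n => game_state (rounds z n))).
Proof.
have [[s ss hs]|[s ss hs]] := unravelable_determined left_wins_unravelable.
  by left; exact: left_strategy hs.
by right; exact: right_strategy hs.
Qed.

End Game.

(** * Connectivity and ends *)

Section Connectivity.
Variables (T : choiceType) (G : graph T).
Implicit Types (S K C : set T) (u v x : T) (w : graph_end G).

(** Connection inside [K], written as deletion of the complement so that the facts on [linked]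
    apply. *)
Definition joined K u v := linked (del_vertices G (~` K)) u v.

Lemma adjacent_sym u v : adjacent G u v = adjacent G v u.
Proof. by rewrite /adjacent setUC. Qed.

Lemma adjacent_vertex u v : adjacent G u v -> vertices G u /\ vertices G v.
Proof.
move=> uv; split; last exact: adjacent_vertices uv.
by apply: (@adjacent_vertices _ _ v); rewrite adjacent_sym.
Qed.

Lemma adjacent_neq u v : adjacent G u v -> u <> v.
Proof.
move=> /asboolP /edge_pair[a [c [_ _ ac E]]] uv; subst v; apply: ac.
have : [set u; u] a by rewrite E; left.
have : [set u; u] c by rewrite E; right.
by rewrite setUid => -> ->.
Qed.

Lemma adjacent_in K u v :
  adjacent (del_vertices G (~` K)) u v <-> [/\ adjacent G u v, K u & K v].
Proof.
split=> [/asboolP[e /disjoints_subset h]|[/asboolP e Ku Kv]].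
  rewrite setCK in h; split; [exact/asboolP|apply: h; by left|apply: h; by right].
apply/asboolP; split=> //; apply/disjoints_subset; rewrite setCK => z [->//|->//].
Qed.

Lemma joined_in K u v : joined K u v ->
  [/\ vertices G u, vertices G v, K u & K v].
Proof.
move=> h; have [Gv Kv] := linked_vertices h; case: h => p [[Gu Ku] _ _] _.
by split=> //; apply: contrapT.
Qed.

Lemma joined_refl K u : vertices G u -> K u -> joined K u u.
Proof. by move=> Gu Ku; apply: linked_refl; split=> // /(_ Ku). Qed.

Lemma joined_sym K u v : joined K u v -> joined K v u.
Proof. exact: linked_sym. Qed.

Lemma joined_trans K u v x : joined K u v -> joined K v x -> joined K u x.
Proof. exact: linked_trans. Qed.

Lemma joined_edge K u v : adjacent G u v -> K u -> K v -> joined K u v.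
Proof.
move=> uv Ku Kv; have [Gu Gv] := adjacent_vertex uv.
apply: (@path_linked _ (del_vertices G (~` K)) u [:: v]); first by split=> // /(_ Ku).
by rewrite /= andbT; apply/adjacent_in.
Qed.

Lemma joinedS K K' u v : K `<=` K' -> joined K u v -> joined K' u v.
Proof. by move=> h; apply: linked_del_vertices; exact: subsetC. Qed.

Lemma joined_path K u v : joined K u v -> exists p,
  [/\ path (adjacent G) u p, last u p = v, uniq (u :: p) & {subset u :: p <= K}].
Proof.
move=> uv; have [Gu Gv Ku Kv] := joined_in uv; case: uv => p [_ pp up] <-.
exists p; split=> //; first by apply: sub_path pp => a b /adjacent_in[].
move=> x; rewrite in_cons => /orP[/eqP ->|]; first exact/mem_set.
elim: p u {Gu Gv Ku Kv up} pp => //= y p IH u /andP[/adjacent_in[_ _ Ky] pp].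
by rewrite in_cons => /orP[/eqP ->|]; [exact/mem_set|exact: IH pp].
Qed.

Lemma path_joined K u p : vertices G u -> path (adjacent G) u p ->
  {subset u :: p <= K} -> joined K u (last u p).
Proof.
elim: p u => [|y p IH] u Gu /=.
  by move=> _ h; apply: joined_refl => //; apply/set_mem/h; rewrite mem_head.
move=> /andP[uy pp] h; have Gy := adjacent_vertices uy.
apply: (@joined_trans _ _ y); last by apply: IH => // z zp; apply: h; rewrite in_cons zp orbT.
by apply: joined_edge => //; apply/set_mem/h; rewrite !in_cons eqxx ?orbT.
Qed.

Lemma joined_ind (Q : T -> Prop) K u v : joined K u v -> Q u ->
  (forall a b, K a -> K b -> adjacent G a b -> Q a -> Q b) -> Q v.
Proof.
move=> /joined_path[p [pp <- _ sp]] Qu st.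
elim: p u Qu pp sp => //= y p IH u Qu /andP[uy pp] sp; apply: IH => //.
  by apply: st uy Qu; apply/set_mem/sp; rewrite !in_cons eqxx ?orbT.
by move=> z zp; apply: sp; rewrite in_cons zp orbT.
Qed.

Definition conn K := [/\ K !=set0, K `<=` vertices G
  & forall u v, K u -> K v -> joined K u v].

Definition nbr K : set T := [set v | ~ K v /\ exists2 u, K u & adjacent G u v].

Lemma nbr_vertices K : nbr K `<=` vertices G.
Proof. by move=> v [_ [u _ /adjacent_vertices]]. Qed.

Lemma conn_sub K C : conn K -> (forall v, K v -> ~ nbr C v) ->
  (exists x, K x /\ C x) -> K `<=` C.
Proof.
move=> [_ _ cK] nK [x [Kx Cx]] y Ky.
apply: (joined_ind (cK x y Kx Ky)) => // a b Ka Kb ab Ca.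
by apply: contrapT => nCb; apply: (nK b) => //; split=> //; exists a.
Qed.

Lemma conn_union K K' : conn K -> conn K' -> (exists x, K x /\ K' x) ->
  conn (K `|` K').
Proof.
move=> [[a Ka] KV cK] [_ KV' cK'] [x [Kx K'x]].
have jx y : (K `|` K') y -> joined (K `|` K') x y.
  move=> [Ky|K'y]; [apply: joinedS (cK _ _ Kx Ky)|apply: joinedS (cK' _ _ K'x K'y)].
    by move=> z; left.
  by move=> z; right.
split; [by exists a; left|by move=> y []; [exact: KV|exact: KV']|].
by move=> u v hu hv; apply: joined_trans (jx v hv); apply/joined_sym/jx.
Qed.

Lemma comp_conn S C : component (del_vertices G S) C ->
  [/\ conn C, forall v, C v -> ~ S v & nbr C `<=` S].
Proof.
move=> [u [Gu nSu] <-].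
have E v : linked (del_vertices G S) u v = joined (~` S) u v by rewrite /joined setCK.
have Cin v : linked (del_vertices G S) u v -> ~ S v by rewrite E => /joined_in[].
split.
- split; first by exists u => /=; rewrite E; exact: joined_refl.
    by move=> v /=; rewrite E => /joined_in[].
  suff jx y : linked (del_vertices G S) u y -> joined [set v | linked (del_vertices G S) u v] u y.
    by move=> a b /= /jx ha /jx hb; apply: joined_trans hb; exact: joined_sym.
  move=> uy; have := uy; rewrite {1}E => uy'.
  have jS z : joined (~` S) u z -> linked (del_vertices G S) u z by rewrite E.
  suff : joined (~` S) u y /\ joined [set v | linked (del_vertices G S) u v] u y by case.
  apply: (@joined_ind (fun z => joined (~` S) u z /\
    joined [set v | linked (del_vertices G S) u v] u z) _ _ _ uy').
    by split; apply: joined_refl => //=; apply/jS; exact: joined_refl.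
  move=> a b Sa Sb ab [ja jb]; have jb' : joined (~` S) u b.
    by apply: joined_trans ja _; exact: joined_edge.
  by split=> //; apply: joined_trans jb _; apply: joined_edge => //=; exact: jS.
- exact: Cin.
- move=> v [nv [a /= ua av]]; apply: contrapT => nSv; apply: nv => /=.
  rewrite E in ua; rewrite E; apply: (joined_trans ua); apply: joined_edge => //.
  by case: (joined_in ua).
Qed.

Lemma conn_comp S C : conn C -> (forall v, C v -> ~ S v) -> nbr C `<=` S ->
  component (del_vertices G S) C.
Proof.
move=> cC nS nC; have [[u Cu] CV jC] := cC.
exists u; first by split; [exact: CV|exact: nS].
apply/seteqP; split=> v /=.
  rewrite -[S]setCK -/(joined _ u v) => uv.
  apply: (joined_ind uv) => // a b Sa Sb ab Ca.
  by apply: contrapT => nCb; apply/Sb/nC; split=> //; exists a.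
move=> Cv; rewrite -[S]setCK; apply: joinedS (jC _ _ Cu Cv).
by move=> z /nS.
Qed.

Lemma comp_sub S C K : component (del_vertices G S) C -> conn K ->
  (forall v, K v -> ~ S v) -> (exists x, K x /\ C x) -> K `<=` C.
Proof.
move=> /comp_conn[_ _ nC] cK KS; apply: conn_sub => // v Kv /nC.
exact: KS.
Qed.

Lemma comp_exists S v : vertices G v -> ~ S v ->
  exists2 C, component (del_vertices G S) C & C v.
Proof.
move=> Gv nSv; exists [set u | linked (del_vertices G S) v u]; first by exists v.
exact: linked_refl.
Qed.

Lemma finite_nbr_set K : finite_set (nbr K) -> finite_vertex_set G (nbr K).
Proof. by move=> fK; split=> //; exact: nbr_vertices. Qed.

Lemma region_comp K : conn K -> component (del_vertices G (nbr K)) K.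
Proof. by move=> cK; apply: conn_comp => // v Kv []. Qed.

Lemma lives_meet w C C' : lives_in w C -> lives_in w C' -> exists x, C x /\ C' x.
Proof.
move=> h h'; have [r wr] := end_nonempty w.
exact: tail_in_common (h r wr) (h' r wr).
Qed.

Lemma lives_sub w C C' : lives_in w C -> C `<=` C' -> lives_in w C'.
Proof. by move=> h CC r /h; apply: filterS => i; exact: CC. Qed.

Lemma ecompP S w : finite_vertex_set G S ->
  component (del_vertices G S) (end_component S w) /\ lives_in w (end_component S w).
Proof.
move=> fS; have [C cC wC] := end_lives w fS.
have -> // : end_component S w = C.
apply/seteqP; split=> [x [C' [cC' wC'] C'x]|x Cx]; last by exists C.
have [y [Cy C'y]] := lives_meet wC wC'.
by rewrite (component_eq cC cC' Cy C'y).
Qed.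

Lemma ecomp_eq S w C : finite_vertex_set G S -> component (del_vertices G S) C ->
  lives_in w C -> end_component S w = C.
Proof.
move=> fS cC wC; have [cE wE] := ecompP w fS.
have [x [Ex Cx]] := lives_meet wE wC.
exact: component_eq cE cC Ex Cx.
Qed.

Lemma ecomp_conn S w : finite_vertex_set G S ->
  [/\ conn (end_component S w), forall v, end_component S w v -> ~ S v
    & nbr (end_component S w) `<=` S].
Proof. by move=> /(ecompP w)[/comp_conn]. Qed.

Lemma ecomp_nbr_finite S w : finite_vertex_set G S ->
  finite_set (nbr (end_component S w)).
Proof. by move=> fS; have [_ _ h] := ecomp_conn w fS; apply: sub_finite_set h fS.1. Qed.

Lemma ecomp_sub S w K : finite_vertex_set G S -> nbr K `<=` S -> lives_in w K ->
  end_component S w `<=` K.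
Proof.
move=> fS nK wK; have [cE nE _] := ecomp_conn w fS.
apply: conn_sub => // [v /nE nSv /nK//|].
exact: lives_meet (ecompP w fS).2 wK.
Qed.

Lemma ecomp_mono S S' w : finite_vertex_set G S -> finite_vertex_set G S' ->
  S `<=` S' -> end_component S' w `<=` end_component S w.
Proof.
move=> fS fS' SS'; apply: ecomp_sub => //; last exact: (ecompP w fS).2.
by have [_ _ h] := ecomp_conn w fS; apply: subset_trans h SS'.
Qed.

Lemma conn_sub_ecomp S w K : finite_vertex_set G S -> conn K ->
  (forall v, K v -> ~ S v) -> (exists x, K x /\ end_component S w x) ->
  K `<=` end_component S w.
Proof. by move=> fS; apply: comp_sub; exact: (ecompP w fS).1. Qed.

Lemma region_ecomp w K : conn K -> finite_set (nbr K) -> lives_in w K ->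
  end_component (nbr K) w = K.
Proof.
by move=> cK fK; apply: ecomp_eq; [exact: finite_nbr_set|exact: region_comp].
Qed.

Lemma finite_vertex_setU S S' : finite_vertex_set G S -> finite_vertex_set G S' ->
  finite_vertex_set G (S `|` S').
Proof.
move=> [fS VS] [fS' VS']; split; first by rewrite finite_setU.
by move=> x []; [exact: VS|exact: VS'].
Qed.

Lemma finite_vertex_set1 v : vertices G v -> finite_vertex_set G [set v].
Proof. by move=> Gv; split; [exact: finite_set1|move=> x ->]. Qed.

Lemma finite_vertex_bigcup (I : Type) (D : set I) (F : I -> set T) : finite_set D ->
  (forall i, D i -> finite_vertex_set G (F i)) -> finite_vertex_set G (\bigcup_(i in D) F i).
Proof.
move=> fD hF; split; first by apply: bigcup_finite => // i /hF[].
by move=> x [i Di]; exact: (hF i Di).2.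
Qed.

Lemma end_of_ray (r : nat -> T) : ray G r -> exists w, rays_of w r.
Proof.
move=> rr; have h : exists2 r0, ray G r0 &
  [set r' | ray G r' /\ ray_equiv G r r'] = [set r' | ray G r' /\ ray_equiv G r0 r'].
  by exists r.
exists (GraphEnd h); split=> // S fS.
by have [C cC rC] := ray_tail rr fS; exists C.
Qed.

Lemma ray_lives w r S C : finite_vertex_set G S -> component (del_vertices G S) C ->
  rays_of w r -> tail_in r C -> lives_in w C.
Proof.
move=> fS cC wr rC; have [cE wE] := ecompP w fS.
have [x [Cx Ex]] := tail_in_common rC (wE r wr).
by rewrite (component_eq cC cE Cx Ex).
Qed.

Lemma ray_of_end w r : rays_of w r -> ray G r.
Proof. by case: (graph_endP w) => r0 _ ->; case. Qed.

Lemma end_ext w w' : (forall S, finite_vertex_set G S ->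
  end_component S w = end_component S w') -> w = w'.
Proof.
move=> E; suff ER : rays_of w = rays_of w'.
  case: w w' {E} ER => [R P] [R' P'] /= ER; subst R'.
  by rewrite (Prop_irrelevance P P').
have main w1 w2 : (forall S, finite_vertex_set G S ->
    end_component S w1 = end_component S w2) -> rays_of w1 `<=` rays_of w2.
  move=> E12 r w1r; have rr := ray_of_end w1r.
  have [r2 w2r2] := end_nonempty w2.
  case: (graph_endP w2) => r0 rr0 E2; rewrite E2; split=> // S fS.
  have w2r0 : rays_of w2 r0.
    rewrite E2; split=> // S' fS'.
    by have [C cC rC] := ray_tail rr0 fS'; exists C.
  have [cE wE] := ecompP w2 fS; exists (end_component S w2) => //; split.
    exact: wE.
  by rewrite -E12 //; exact: (ecompP w1 fS).2.
by apply/seteqP; split; apply: main => // S fS; rewrite E.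
Qed.

End Connectivity.

(** * Rays from walks and ends as limits of vertices *)

Section Rays.
Variables (T : choiceType) (G : graph T).
Implicit Types (K : nat -> set T) (v : nat -> T).

(** Loop erasure: the walk is always continued from its last visit to the current vertex. *)
Lemma walk_ray (W : nat -> T) : (forall i, adjacent G (W i) (W i.+1)) ->
  (forall x, exists N, forall i, N <= i -> W i <> x) ->
  exists (r : nat -> T) (idx : nat -> nat), [/\ ray G r, forall k, r k = W (idx k)
    & forall k, idx k < idx k.+1].
Proof.
move=> aW fW.
have /choice[last hlast] : forall i, exists j, [/\ i <= j, W j = W i &
    forall m, j < m -> W m <> W i].
  move=> i; have [N hN] := fW (W i).
  have iN : i < N by rewrite ltnNge; apply/negP => /hN.
  have ex : exists j, (i <= j) && (W j == W i) by exists i; rewrite leqnn eqxx.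
  have ub j : (i <= j) && (W j == W i) -> j <= N.
    by move=> /andP[_ /eqP Wj]; rewrite leqNgt; apply/negP => /ltnW /hN.
  case: (ex_maxnP ex ub) => j /andP[ij /eqP Wj] mx; exists j; split=> // m jm Wm.
  have := mx m; rewrite (leq_trans ij (ltnW jm)) Wm eqxx => /(_ isT).
  by rewrite leqNgt jm.
pose idx := fix idx k := match k with 0 => last 0 | k'.+1 => last (idx k').+1 end.
have incr k : idx k < idx k.+1 by rewrite /=; case: (hlast (idx k).+1).
have mono k l : k < l -> idx k < idx l.
  elim: l => // l IH; rewrite ltnS leq_eqVlt => /orP[/eqP ->//|/IH h].
  exact: ltn_trans h _.
have lastk k m : idx k < m -> W m <> W (idx k).
  by case: k => [|k] /=; [have [_ -> h] := hlast 0|have [_ -> h] := hlast (idx k).+1]; exact: (h m).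
exists (fun k => W (idx k)), idx; split=> //; split.
- by move=> i; have [] := adjacent_vertex (aW (idx i)).
- move=> k l E; apply/eqP; rewrite eqn_leq; apply/andP; split; rewrite leqNgt; apply/negP => h.
    by apply: (lastk _ _ (mono _ _ h)).
  by apply: (lastk _ _ (mono _ _ h)).
- move=> k; have [_ E _] := hlast (idx k).+1.
  by rewrite [X in adjacent _ _ X]/= E.
Qed.

(** The function [lev] records which of the sets is being crossed, so that local finiteness of the
    sets passes on to the walk. *)
Lemma concat_walk v K : (forall n, joined G (K n) (v n) (v n.+1)) ->
  (forall n, v n <> v n.+1) ->
  exists (W : nat -> T) (lev : nat -> nat), [/\ forall i, adjacent G (W i) (W i.+1),
    forall i, joined G (K (lev i)) (v (lev i)) (W i),
    forall i, lev i <= lev i.+1 & forall n, exists i, lev i = n].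
Proof.
move=> jv nv; have /choice[p hp] : forall n, exists p, [/\ path (adjacent G) (v n) p,
    last (v n) p = v n.+1, p != [::] & {subset v n :: p <= K n}].
  move=> n; have [p [pp lp up sp]] := joined_path (jv n); exists p; split=> //.
  by apply/eqP => E; move: lp; rewrite E /=; exact: nv.
pose step (z : nat * T * seq T) := match z with
  | (n, u, x :: q) => (n, x, q)
  | (n, u, [::]) => (n.+1, head u (p n.+1), behead (p n.+1)) end.
pose z i := iter i step (0, v 0, p 0).
pose inv (y : nat * T * seq T) := let: (n, u, q) := y in
  [/\ joined G (K n) (v n) u, path (adjacent G) u q, last u q = v n.+1
    & {subset u :: q <= K n}].
have inv0 : inv (0, v 0, p 0).
  have [pp lp np sp] := hp 0; split=> //; have [Gv _ Kv _] := joined_in (jv 0).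
  exact: joined_refl.
have invS y : inv y -> inv (step y) /\ adjacent G y.1.2 (step y).1.2.
  case: y => [[n u] [|x q]] /=.
    move=> [ju _ lu su]; have [+ + + +] := hp n.+1; case: (p n.+1) => //= x q.
    move=> /andP[vx pq] lq _ sq; rewrite lu; split=> //; split=> //.
      by apply: joined_edge => //; apply/set_mem/sq; rewrite !in_cons eqxx ?orbT.
    by move=> y yq; apply: sq; rewrite in_cons yq orbT.
  move=> [ju /andP[ux pq] lq sq]; split=> //; split=> //.
    apply: joined_trans ju _.
    by apply: joined_edge => //; apply/set_mem/sq; rewrite !in_cons eqxx ?orbT.
  by move=> y yq; apply: sq; rewrite in_cons yq orbT.
have invz i : inv (z i) by elim: i => //= i /invS[].
exists (fun i => (z i).1.2), (fun i => (z i).1.1); split.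
- by move=> i; have [_] := invS _ (invz i).
- by move=> i; have := invz i; case: (z i) => [[n u] q] [].
- by move=> i; rewrite /z iterS -/(z i); case: (z i) => [[n u] [|x q]] /=.
- have emp n i q u : z i = (n, u, q) -> exists j u', z j = (n, u', [::]).
    elim: q u i => [|x q IH] u i zi; first by exists i, u.
    by apply: (IH x i.+1); rewrite /z iterS -/(z i) zi.
  elim=> [|n [i zi]]; first by exists 0.
  have [|j [u zj]] := @emp n i (z i).2 (z i).1.2.
    by rewrite -zi; case: (z i) => [[? ?] ?].
  by exists j.+1; rewrite /z iterS -/(z j) zj.
Qed.

Lemma eventually_avoids K (S : set T) : finite_set S ->
  (forall x, exists N, forall n, N <= n -> ~ K n x) ->
  exists N, forall n x, N <= n -> K n x -> ~ S x.
Proof.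
move=> /finite_fsetP[X ->] lv; have /choice[N hN] := lv.
exists (\max_(x <- X) N x) => n x Nn Kx Sx; apply: (hN x n) => //.
by apply: leq_trans Nn; apply: (@leq_bigmax_seq _ _ xpredT).
Qed.

(** The tool by which ends are produced. Local finiteness turns the concatenated walk into one
    containing a ray; once the sets avoid [S], the rest of the walk and the vertices [v n] lie in a
    single component. *)
Lemma end_of_sets v K : (forall n, joined G (K n) (v n) (v n.+1)) ->
  (forall n, v n <> v n.+1) ->
  (forall x, exists N, forall n, N <= n -> ~ K n x) ->
  exists w : graph_end G, forall S, finite_vertex_set G S ->
    exists N, forall n, N <= n -> end_component S w (v n).
Proof.
move=> jv nv lv; have [W [lev [aW jW mlev slev]]] := concat_walk jv nv.
have mono i j : i <= j -> lev i <= lev j.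
  move=> ij; rewrite -(subnKC ij); elim: (j - i) => [|d IH]; first by rewrite addn0.
  by rewrite addnS; apply: leq_trans IH _.
have Klev i : K (lev i) (W i) by have [] := joined_in (jW i).
have [x|r [idx [rr rE iidx]]] := walk_ray aW.
  have [N hN] := lv x; have [i iN] := slev N; exists i => j ij E.
  by apply: (hN (lev j)); [rewrite -iN mono|rewrite -E].
have idxk k : k <= idx k.
  by elim: k => // k IH; apply: leq_ltn_trans IH (iidx k).
have [w wr] := end_of_ray rr; exists w => S fS.
have [N hN] := eventually_avoids fS.1 lv.
have jN n : N <= n -> joined G (~` S) (v N) (v n).
  elim: n => [|n IH]; rewrite ?leqn0 => h.
    rewrite (eqP h); apply: joined_refl; first by case: (joined_in (jv 0)).
    by apply: (hN 0); rewrite ?(eqP h) //; case: (joined_in (jv 0)).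
  move: h; rewrite leq_eqVlt => /orP[/eqP <-|h].
    apply: joined_refl; first by case: (joined_in (jv N)).
    by apply: (hN N) => //; case: (joined_in (jv N)).
  apply: joined_trans (IH h) _; apply: joinedS (jv n) => y.
  exact: hN.
have [Gv nS] : vertices G (v N) /\ ~ S (v N).
  by case: (joined_in (jv N)) => Gv _ Kv _; split=> //; exact: hN Kv.
have [C cC Cv] := comp_exists Gv nS.
have CE y : joined G (~` S) (v N) y -> C y.
  have [cC' nC nbC] := comp_conn cC.
  move=> jy; apply: (joined_ind jy) => // a b Sa Sb ab Ca.
  by apply: contrapT => nCb; apply/Sb/nbC; split=> //; exists a.
have [i0 li0] := slev N.
have wC : lives_in w C.
  apply: ray_lives fS cC wr _; exists i0 => // k /= ik; rewrite rE.
  have lk : N <= lev (idx k) by rewrite -li0 mono // (leq_trans ik).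
  apply: CE; apply: joined_trans (jN _ lk) _.
  by apply: joinedS (jW (idx k)) => y; exact: hN.
exists N => n Nn; rewrite (ecomp_eq fS cC wC); exact/CE/jN.
Qed.

End Rays.

(** * Separating undominated ends *)

Lemma pick_in_eq (X : Type) (x y : X) (P : set X) : P !=set0 -> pick_in x P = pick_in y P.
Proof. by move=> [z Pz]; rewrite /pick_in; case: pselect => // -[]; exists z. Qed.

Section Domination.
Variables (T : choiceType) (G : graph T).
Implicit Types (S K : set T) (w : graph_end G).

(** An infinite fan is built recursively: each new path from [v] to the ray runs through the
    component of [w] that remains after deleting all earlier paths. *)
Lemma adherent_dominates v w : vertices G v ->
  (forall S, finite_vertex_set G S -> S v -> nbr G (end_component S w) v) ->
  dominates v w.
Proof.
move=> Gv ad; split=> //; have [r wr] := end_nonempty w; exists r => //.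
have /choice[P hP] : forall S, exists p, finite_vertex_set G S -> S v ->
    [/\ is_path G v p, range r (last v p), p != [::] & forall x, x \in p -> end_component S w x].
  move=> S; have [[fS Sv]|nS] := pselect (finite_vertex_set G S /\ S v); last first.
    by exists [::] => fS Sv; case: nS.
  have [nv [a Ea av]] := ad S fS Sv; have [[_ _ jE] _ _] := ecomp_conn w fS.
  have [n _ hn] := (ecompP w fS).2 r wr.
  have [q [pq lq uq sq]] := joined_path (jE _ _ Ea (hn n (leqnn n))).
  have inE x : x \in a :: q -> end_component S w x by move=> /sq /set_mem.
  exists (a :: q) => _ _; split=> //; last by rewrite /= lq; exists n.
  split=> //=; first by rewrite adjacent_sym av.
  by rewrite -/(uniq (a :: q)) uq andbT; apply/negP => /inE.
pose Sq := fix Sq n := match n with 0 => [set v] | n'.+1 => Sq n' `|` [set` P (Sq n')] end.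
have fSq n : finite_vertex_set G (Sq n) /\ Sq n v.
  elim: n => [|n [fn vn]] /=; first by split=> //; exact: finite_vertex_set1.
  split; last by left.
  apply: finite_vertex_setU => //; split; first exact: finite_seq.
  have [_ _ _ h] := hP _ fn vn; move=> x /= /h.
  by have [[_ + _] _ _] := ecomp_conn w fn; apply.
have hp n := hP _ (fSq n).1 (fSq n).2.
have mono n m : n <= m -> Sq n `<=` Sq m.
  move=> nm; rewrite -(subnKC nm); elim: (m - n) => [|d IH]; first by rewrite addn0.
  by rewrite addnS /=; apply: subset_trans IH _ => x; left.
have disj n m x : n < m -> x \in P (Sq n) -> x \in P (Sq m) -> False.
  move=> nm xn xm; have [_ _ _ /(_ x xm)] := hp m.
  have [_ h _] := ecomp_conn w (fSq m).1; move=> /h; apply.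
  by apply: (mono n.+1 m nm) => /=; right.
have inj n m : P (Sq n) = P (Sq m) -> n = m.
  have [_ _ + _] := hp n; case E : (P (Sq n)) => [//|x q] _ E'.
  have xn : x \in P (Sq n) by rewrite E mem_head.
  have xm : x \in P (Sq m) by rewrite -E' mem_head.
  by case: (ltngtP n m) => // h; [case: (disj _ _ x h)|case: (disj _ _ x h)].
exists (range (fun n => P (Sq n))); split.
- move=> f; apply: infinite_nat.
  have := @finite_preimage _ _ _ (fun n => P (Sq n)) _ f.
  rewrite (_ : _ @^-1` _ = setT); first by apply=> a b _ _; exact: inj.
  by apply/seteqP; split=> // n _; exists n.
- by move=> p [n _ <-]; have [] := hp n.
- move=> p q [n _ <-] [m _ <-] npq; apply/seteqP; split=> [x [/=]|x ->]; last first.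
    by rewrite /= !mem_head.
  rewrite !in_cons => /orP[/eqP ->//|xn] /orP[/eqP ->//|xm].
  case: (ltngtP n m) => h; [by case: (disj _ _ x h)|by case: (disj _ _ x h)|].
  by case: npq; rewrite h.
Qed.

Lemma undominated_separated v w : undominated w -> vertices G v ->
  exists S, [/\ finite_vertex_set G S, S v & ~ nbr G (end_component S w) v].
Proof.
move=> uw Gv; apply: contrapT => h; apply: (uw v); apply: adherent_dominates => // S fS Sv.
by apply: contrapT => n; apply: h; exists S.
Qed.

Definition good S K := [/\ conn G K, finite_set (nbr G K),
  forall v, K v -> ~ S v & forall v, nbr G K v -> ~ S v].

Lemma good_sub S K K' : good S K -> conn G K' -> finite_set (nbr G K') ->
  K' `<=` K -> good S K'.
Proof.
move=> [_ _ K1 K2] cK' fK' sub; split=> // v; first by move=> /sub /K1.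
move=> [_ [u /sub Ku uv]]; have [Kv|nKv] := pselect (K v); first exact: K1.
by apply: K2; split=> //; exists u.
Qed.

(** Each vertex of [S] can be separated from the neighbourhood of some component around [w]; the
    union of these finitely many separators works for all of them. *)
Lemma undominated_good S w : undominated w -> finite_vertex_set G S ->
  exists2 K, good S K & lives_in w K.
Proof.
move=> uw fS; have /choice[X hX] : forall s, exists X, vertices G s ->
    [/\ finite_vertex_set G X, X s & ~ nbr G (end_component X w) s].
  move=> s; have [Gs|nGs] := pselect (vertices G s); last by exists set0.
  by have [X hX] := undominated_separated uw Gs; exists X.
pose X' := S `|` \bigcup_(s in S) X s.
have fX' : finite_vertex_set G X'.
  apply: finite_vertex_setU => //; apply: finite_vertex_bigcup; first exact: fS.1.
  by move=> s Ss; have [] := hX s (fS.2 _ Ss).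
have [cE nE bE] := ecomp_conn w fX'; exists (end_component X' w); last exact: (ecompP w fX').2.
split=> //; first exact: ecomp_nbr_finite.
  by move=> v /nE nv Sv; apply: nv; left.
move=> v [nv [u Eu uv]] Sv; have [fX Xv nX] := hX v (fS.2 _ Sv); apply: nX.
have sub : end_component X' w `<=` end_component (X v) w.
  by apply: ecomp_mono => // y Xy; right; exists v.
split; first by have [_ h _] := ecomp_conn w fX; move=> /h.
by exists u => //; exact: sub.
Qed.

End Domination.

(** * A cost on finite vertex sets *)

Section Cost.
Variable T : choiceType.
Local Open Scope fset_scope.
Implicit Types X Y : {fset T}.

Let le : rel T := sval (well_ordering_principle T).
Let wo : well_order le := svalP (well_ordering_principle T).

Let wo_least (A : set T) : A !=set0 -> exists2 m, A m & forall z, A z -> le m z.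
Proof.
move=> [x Ax]; have [|m [[mA lb] _]] := @wo [pred x | `[< A x >]].
  by exists x; apply/asboolP.
exists m; first exact/asboolP.
by move=> z Az; apply: lb; apply/asboolP.
Qed.

Let le_total x y : le x y \/ le y x.
Proof.
have [|m mxy h] := @wo_least [set x; y]%classic; first by exists x; left.
by case: mxy h => -> h; [left|right]; apply: h; [right|left].
Qed.

Let le_refl x : le x x. Proof. by case: (le_total x x). Qed.

Let le_anti x y : le x y -> le y x -> x = y.
Proof.
move=> xy yx; have [|m [_ um]] := @wo [pred z | (z == x) || (z == y)].
  by exists x; rewrite !inE eqxx.
rewrite -(um x) ?(um y) //; split; rewrite ?inE ?eqxx ?orbT //.
  by move=> z; rewrite inE => /orP[/eqP ->|/eqP ->].
by move=> z; rewrite inE => /orP[/eqP ->|/eqP ->].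
Qed.

Let le_trans x y z : le x y -> le y z -> le x z.
Proof.
move=> xy yz; have [|m mxyz h] := @wo_least [set x; y; z]%classic; first by exists x; do 2 left.
have hx : le m x by apply: h; do 2 left.
have hy : le m y by apply: h; left; right.
have hz : le m z by apply: h; right.
case: mxyz => [[/= E|/= E]|/= E]; rewrite E in hx hy hz => //.
  by rewrite (le_anti xy hx).
by rewrite -(le_anti yz hy).
Qed.

Let fmax X : X != fset0 -> exists2 m, m \in X & forall z, z \in X -> le z m.
Proof.
elim/finSet_rect: X => X IH /fset0Pn[x xX].
have [E|/eqP ne] := eqVneq (X `\ x) fset0.
  exists x => // z zX; have [->//|ne] := eqVneq z x.
  have : z \in X `\ x by rewrite !inE ne.
  by rewrite E inE.
have [|m] := IH _ _ (introN eqP ne); first exact: fproperD1.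
rewrite !inE => /andP[mx mX] hm.
case: (le_total x m) => h.
  exists m => // z zX; have [->//|nz] := eqVneq z x.
  by apply: hm; rewrite !inE nz.
exists x => // z zX; have [->//|nz] := eqVneq z x.
by apply: le_trans h; apply: hm; rewrite !inE nz.
Qed.

(* Sets are compared at their largest difference for a fixed well-order, so that
   minimal neighbourhoods of given size exist and ties are broken consistently. *)
Definition lexlt X Y := exists2 m, (m \in Y) && (m \notin X) &
  forall z, le m z -> z != m -> (z \in X) = (z \in Y).

Definition costlt X Y := #|` X| < #|` Y| \/ #|` X| = #|` Y| /\ lexlt X Y.

Lemma lex_min k (F : set {fset T}) : F !=set0 -> (forall X, F X -> #|` X| = k) ->
  exists2 X, F X & forall Y, F Y -> ~ lexlt Y X.
Proof.
elim: k F => [|k IH] F [X0 FX0] hF.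
  exists X0 => // Y _ [m /andP[mX _] _].
  by have := cardfs0_eq (hF _ FX0) => E; rewrite E inE in mX.
have ne X : F X -> X != fset0 by move=> /hF h; rewrite -cardfs_gt0 h.
pose top X m := m \in X /\ forall z, z \in X -> le z m.
(* The least possible largest element; the remaining elements are minimised by induction among the
   sets with this largest element. *)
have [m0 [X1 FX1 t1] m0min] : exists2 m, (exists2 X, F X & top X m) &
    forall z, (exists2 X, F X & top X z) -> le m z.
  apply: (@wo_least [set m | exists2 X, F X & top X m]%classic).
  by have [m mX hm] := fmax (ne _ FX0); exists m, X0.
have [||X' [X [FX tX] ->] minX] := IH [set Y | exists2 X, F X /\ top X m0 & Y = (X `\ m0)%fset]%classic.
- by exists (X1 `\ m0), X1.
- move=> Y [X [FX tX] ->]; have := hF _ FX; rewrite (cardfsD1 m0) tX.1.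
  by rewrite add1n => -[].
exists X => // Y FY [m /andP[mX mY] hm].
have [my myY hmy] := fmax (ne _ FY).
have le0 : le m0 my by apply: m0min; exists Y.
have Emy : my = m0.
  apply/eqP; apply: contraT => nmy; have nX : my \notin X.
    by apply/negP => /tX.2 h; move/eqP: nmy; apply; apply: le_anti.
  case: (le_total m my) => h.
    have [E|ne'] := eqVneq my m; first by rewrite -E (negbTE nX) in mX.
    by rewrite -(hm _ h ne') myY in nX.
  by move/eqP: nmy; case; apply: le_anti => //; apply: le_trans h (tX.2 _ mX).
subst my; apply: (minX (Y `\ m0)); first by exists Y.
have nm : m != m0 by apply: contraNneq mY => ->.
exists m; first by rewrite !inE nm mX (negbTE mY) andbF.
by move=> z mz zm; rewrite !inE (hm z).
Qed.

Lemma cost_min (F : set {fset T}) : F !=set0 ->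
  exists2 X, F X & forall Y, F Y -> ~ costlt Y X.
Proof.
move=> [X0 FX0]; have ex : exists k, `[< exists2 X, F X & #|` X| = k >].
  by exists #|` X0|; apply/asboolP; exists X0.
case: (ex_minnP ex) => k /asboolP[X1 FX1 c1] mk.
have [||X [FX cX] mX] := @lex_min k [set X | F X /\ #|` X| = k]%classic.
- by exists X1.
- by move=> X [].
exists X => // Y FY [h|[h l]]; last by apply: (mX Y) => //; split=> //; rewrite h.
have : k <= #|` Y| by apply: mk; apply/asboolP; exists Y.
by rewrite leqNgt -cX h.
Qed.

(* With submodularity of neighbourhoods this uncrosses regions of minimal cost. *)
Lemma cost_cancel (a b c d : {fset T}) :
  (forall z, z \in a -> (z \in c) || (z \in d)) ->
  (forall z, z \in b -> (z \in c) || (z \in d)) ->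
  (forall z, z \in a -> z \in b -> (z \in c) && (z \in d)) ->
  ~ costlt a d -> ~ costlt b c -> a = d /\ b = c.
Proof.
move=> hac hbc hab nad nbc.
have sum : #|` a| + #|` b| <= #|` c| + #|` d|.
  rewrite -(cardfsUI a b) -(cardfsUI c d); apply: leq_add; apply: fsubset_leq_card; apply/fsubsetP => z.
    by rewrite !inE => /orP[/hac|/hbc].
  by rewrite !inE => /andP[za zb]; exact: hab.
have lad : #|` d| <= #|` a| by rewrite leqNgt; apply/negP => h; apply: nad; left.
have lbc : #|` c| <= #|` b| by rewrite leqNgt; apply/negP => h; apply: nbc; left.
have ead : #|` a| = #|` d|.
  apply/eqP; rewrite eqn_leq lad andbT -(leq_add2r #|` b|).
  by apply: leq_trans sum _; rewrite addnC leq_add2l.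
have ebc : #|` b| = #|` c|.
  apply/eqP; rewrite eqn_leq lbc andbT -(leq_add2l #|` a|).
  by apply: leq_trans sum _; rewrite addnC ead.
have {}nad : ~ lexlt a d by move=> h; apply: nad; right.
have {}nbc : ~ lexlt b c by move=> h; apply: nbc; right.
(* Above the largest element of this set both pairs agree, so at that element neither [d] may exceed
   [a] nor [c] exceed [b]. The inclusions assumed rule out what is left. *)
pose D := ((a `\` d) `|` (d `\` a)) `|` ((b `\` c) `|` (c `\` b)).
have outD z : z \notin D -> (z \in a) = (z \in d) /\ (z \in b) = (z \in c).
  rewrite /D !inE.
  by case: (z \in a); case: (z \in b); case: (z \in c); case: (z \in d).
have [E|ne] := eqVneq D fset0.
  by split; apply/fsetP => z; have [|//] := outD z; rewrite E inE.
have [m mD hm] := fmax ne.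
have above z : le m z -> z != m -> z \notin D.
  by move=> mz zm; apply/negP => /hm zm'; move/eqP: zm; apply; apply: le_anti.
have n1 : ~~ ((m \in d) && (m \notin a)).
  by apply/negP => h; apply: nad; exists m => // z mz zm; have [] := outD z (above z mz zm).
have n2 : ~~ ((m \in c) && (m \notin b)).
  by apply/negP => h; apply: nbc; exists m => // z mz zm; have [] := outD z (above z mz zm).
move: mD n1 n2 (hac m) (hbc m) (hab m); rewrite /D !inE.
case: (m \in a); case: (m \in b); case: (m \in c); case: (m \in d) => //= _ _ _ h1 h2 h3;
  by [have := h1 isT|have := h2 isT|have := h3 isT isT].
Qed.

End Cost.

(** * Disjoint regions around the undominated ends *)

Lemma cost_cancel_set (T : choiceType) (A B C D : set T) :
  finite_set A -> finite_set B -> finite_set C -> finite_set D ->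
  (forall z, A z -> C z \/ D z) -> (forall z, B z -> C z \/ D z) ->
  (forall z, A z -> B z -> C z /\ D z) ->
  ~ costlt (fset_set A) (fset_set D) -> ~ costlt (fset_set B) (fset_set C) ->
  A = D /\ B = C.
Proof.
move=> fA fB fC fD hA hB hAB nAD nBC.
have E X z : finite_set X -> (z \in fset_set X) <-> X z.
  by move=> fX; rewrite in_fset_set // in_setE.
have [||| //|//|EA EB] := @cost_cancel _ (fset_set A) (fset_set B) (fset_set C) (fset_set D).
- by move=> z /E -/(_ fA) /hA[] h; apply/orP; [left|right]; apply/E.
- by move=> z /E -/(_ fB) /hB[] h; apply/orP; [left|right]; apply/E.
- by move=> z /E -/(_ fA) Az /E -/(_ fB) Bz; have [Cz Dz] := hAB z Az Bz; apply/andP; split; apply/E.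
by split; apply: fset_set_inj.
Qed.

Section Regions.
Variables (T : choiceType) (G : graph T) (S : set T).
Hypothesis fS : finite_vertex_set G S.
Implicit Types (K X : set T) (w : graph_end G) (u v z : T).

Local Notation nbr := (nbr G).
Local Notation conn := (conn G).

Definition cheapest w K := [/\ good G S K, lives_in w K & forall K', good G S K' ->
  lives_in w K' -> ~ costlt (fset_set (nbr K')) (fset_set (nbr K))].

Lemma cheapest_exists w : undominated w -> exists K, cheapest w K.
Proof.
move=> uw; have [K gK wK] := undominated_good uw fS.
have [|X [K0 [gK0 wK0] ->] h] := @cost_min T
    [set X | exists2 K, good G S K /\ lives_in w K & X = fset_set (nbr K)].
  by exists (fset_set (nbr K)), K.
by exists K0; split=> // K' gK' wK'; apply: h; exists K'.
Qed.

Definition reg w : set T := pick_in set0 (cheapest w).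

Lemma regP w : undominated w -> cheapest w (reg w).
Proof. by move=> /cheapest_exists[K hK]; exact: (@pick_inP _ set0 K). Qed.

Lemma ecomp_good K X w : good G S K -> finite_vertex_set G X -> nbr K `<=` X ->
  lives_in w K -> good G S (end_component X w).
Proof.
move=> gK fX nX wK; have [cE _ _] := ecomp_conn w fX.
apply: good_sub gK cE _ _; first exact: ecomp_nbr_finite.
exact: ecomp_sub.
Qed.

Lemma goodU K K' : good G S K -> good G S K' -> (exists x, K x /\ K' x) ->
  good G S (K `|` K').
Proof.
move=> [cK fK K1 K2] [cK' fK' K1' K2'] ex.
have sub : nbr (K `|` K') `<=` nbr K `|` nbr K'.
  move=> v [nv [u [Ku|Ku] uv]]; [left|right]; split; try by exists u.
    by move=> Kv; apply: nv; left.
  by move=> Kv; apply: nv; right.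
split; first exact: conn_union.
- by apply: sub_finite_set sub _; rewrite finite_setU.
- by move=> v []; [exact: K1|exact: K1'].
- by move=> v /sub[]; [exact: K2|exact: K2'].
Qed.

Lemma conn_same_nbr K K' : conn K -> nbr K' `<=` nbr K -> (exists x, K x /\ K' x) ->
  K `<=` K'.
Proof. by move=> cK sub; apply: (conn_sub cK) => v Kv /sub[]. Qed.

(** Uncrossing: the union of the two regions is a candidate for [w'], and the component [B] of [w]
    inside both is a candidate for [w]. Neither can be cheaper, so the union has the same
    neighbourhood as [reg w'], and is therefore contained in it. *)
Lemma reg_sub w w' : undominated w -> undominated w' -> lives_in w (reg w') ->
  reg w `<=` reg w'.
Proof.
move=> uw uw' ww'; have [gK wK mK] := regP uw; have [gK' wK' mK'] := regP uw'.
set K := reg w in gK wK mK *; set K' := reg w' in ww' gK' wK' mK' *.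
have [cK fK _ _] := gK; have [cK' fK' _ _] := gK'.
have fX := finite_vertex_setU (finite_nbr_set fK) (finite_nbr_set fK').
set X := _ `|` _ in fX; pose B := end_component X w.
have BK : B `<=` K by apply: ecomp_sub => // v; left.
have BK' : B `<=` K' by apply: ecomp_sub => // v; right.
have [cB nB bB] := ecomp_conn w fX.
have ex := lives_meet wK ww'.
have gU := goodU gK gK' ex; have [cU fU _ _] := gU.
have gB : good G S B by apply: ecomp_good gK fX _ wK => v; left.
have [||||| EU _] := cost_cancel_set fU (ecomp_nbr_finite w fX) fK fK'.
- move=> v [nv [u [Ku|Ku] uv]]; [left|right]; split; try by exists u.
    by move=> Kv; apply: nv; left.
  by move=> Kv; apply: nv; right.
- by move=> v /bB[]; [left|right].
- move=> v [nv _] [nBv [u Bu uv]]; split; split.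
  + by move=> Kv; apply: nv; left.
  + by exists u => //; exact: BK.
  + by move=> Kv; apply: nv; right.
  + by exists u => //; exact: BK'.
- by apply: mK' => //; apply: lives_sub wK' _ => v; right.
- by apply: mK => //; exact: (ecompP w fX).2.
have [x [Kx K'x]] := ex.
apply: subset_trans (_ : K `|` K' `<=` K'); first by move=> v; left.
by apply: conn_same_nbr => //; [rewrite EU|exists x; split=> //; right].
Qed.

(** If neither end lives in the region of the other, their components [B] and [B'] avoid the
    opposite regions and are candidates again. Uncrossing gives [B] the neighbourhood of [K], whence
    [K] lies in [B] and cannot meet [K']. *)
Lemma reg_nested w w' : undominated w -> undominated w' ->
  (exists x, reg w x /\ reg w' x) -> reg w `<=` reg w' \/ reg w' `<=` reg w.
Proof.
move=> uw uw' ex; have [h|h] := pselect (lives_in w (reg w')); first by left; exact: reg_sub.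
have [h'|h'] := pselect (lives_in w' (reg w)); first by right; exact: reg_sub.
exfalso; have [gK wK mK] := regP uw; have [gK' wK' mK'] := regP uw'.
set K := reg w in ex h' gK wK mK; set K' := reg w' in ex h gK' wK' mK'.
have [cK fK _ _] := gK; have [cK' fK' _ _] := gK'.
have fX := finite_vertex_setU (finite_nbr_set fK) (finite_nbr_set fK').
set X := _ `|` _ in fX; pose B := end_component X w; pose B' := end_component X w'.
have BK : B `<=` K by apply: ecomp_sub => // v; left.
have BK' : B' `<=` K' by apply: ecomp_sub => // v; right.
have [cB nB bB] := ecomp_conn w fX; have [cB' nB' bB'] := ecomp_conn w' fX.
have gB : good G S B by apply: ecomp_good gK fX _ wK => v; left.
have gB' : good G S B' by apply: ecomp_good gK' fX _ wK' => v; right.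
have dB v : B v -> ~ K' v.
  move=> Bv K'v; apply: h; apply: lives_sub (ecompP w fX).2 _.
  by apply: (conn_sub cB) => [z /nB nz nK'|]; [apply: nz; right|exists v].
have dB' v : B' v -> ~ K v.
  move=> Bv Kv; apply: h'; apply: lives_sub (ecompP w' fX).2 _.
  by apply: (conn_sub cB') => [z /nB' nz nK|]; [apply: nz; left|exists v].
have [||||| E _] := cost_cancel_set (ecomp_nbr_finite w fX) (ecomp_nbr_finite w' fX) fK' fK.
- by move=> v /bB[]; [right|left].
- by move=> v /bB'[]; [right|left].
- move=> v [nv [u Bu uv]] [nv' [u' Bu' uv']].
  have nKv : ~ K v.
    move=> Kv; apply: (nB' u' Bu'); left; split; first exact: dB'.
    by exists v => //; rewrite adjacent_sym.
  have nKv' : ~ K' v.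
    move=> Kv; apply: (nB u Bu); right; split; first exact: dB.
    by exists v => //; rewrite adjacent_sym.
  by split; split=> //; [exists u' => //; exact: BK'|exists u => //; exact: BK].
- by apply: mK => //; exact: (ecompP w fX).2.
- by apply: mK' => //; exact: (ecompP w' fX).2.
have [x [Kx K'x]] := ex; have KB : K `<=` B.
  apply: conn_same_nbr => //; first by rewrite E.
  by have [[y By] _ _] := cB; exists y; split=> //; exact: BK.
exact: (dB x (KB x Kx)).
Qed.

(** Regions through a common vertex form a chain, so lying in a common region is an equivalence
    relation on the vertices covered. *)
Definition cls v : set T := [set z | exists2 w, undominated w & reg w v /\ reg w z].

Lemma cls_sym v z : cls v z -> cls z v.
Proof. by move=> [w uw [a b]]; exists w. Qed.

Lemma cls_trans v z y : cls v z -> cls z y -> cls v y.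
Proof.
move=> [w uw [wv wz]] [w' uw' [w'z w'y]].
have [h|h] := reg_nested uw uw' (ex_intro _ z (conj wz w'z)).
  by exists w' => //; split=> //; exact: h.
by exists w => //; split=> //; exact: h.
Qed.

Lemma cls_eq v z : cls v z -> cls v = cls z.
Proof.
move=> vz; apply/seteqP; split=> y h; last exact: cls_trans vz h.
exact: cls_trans (cls_sym vz) h.
Qed.

Definition rep v := pick_in v (cls v).

Lemma repP v : cls v v -> cls v (rep v).
Proof. by move=> h; exact: (@pick_inP _ v v). Qed.

Lemma rep_eq v z : cls v z -> rep v = rep z.
Proof. by move=> vz; rewrite /rep (cls_eq vz); apply: pick_in_eq; exists v; exact: cls_sym. Qed.

Definition size_nbr K := #|` fset_set (nbr K)|%fset.

(** Along an ascending chain of regions the neighbourhoods may grow without bound; uniting only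
    those with fewer than [n] neighbours keeps the boundary finite. *)
Definition Un n v : set T :=
  \bigcup_(w in [set w | [/\ undominated w, reg w v & size_nbr (reg w) < n]]) reg w.

Lemma Un_mono n m v : n <= m -> Un n v `<=` Un m v.
Proof.
move=> nm z [w [uw wv sw] wz]; exists w => //; split=> //.
exact: leq_trans nm.
Qed.

Lemma Un_cls n v z : Un n v z -> cls v z.
Proof. by move=> [w [uw wv _] wz]; exists w. Qed.

Lemma Un0 v : Un 0 v = set0.
Proof. by apply/seteqP; split=> // z [w []]. Qed.

(** Finitely many neighbours of the union are witnessed by finitely many regions through [v], which
    are nested, hence by the largest of them alone; so there are fewer than [n]. *)
Lemma Un_finite n v : finite_set (nbr (Un n v)).
Proof.
apply: contrapT => inf; have [X sX cX] := infinite_set_fset n inf.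
have [E|/fset0Pn[x0 x0X]] := eqVneq X fset0%fset.
  have [w0 [uw0 w0v s0]] : exists w, [/\ undominated w, reg w v & size_nbr (reg w) < n].
    have [x] := infinite_setN0 inf.
    by move=> [_ [u [w h _] _]]; exists w.
  by move: cX; rewrite E cardfs0 leqn0 => /eqP n0; rewrite n0 in s0.
have hx x : x \in X -> exists w, [/\ undominated w, reg w v, size_nbr (reg w) < n
    & exists2 u, reg w u & adjacent G u x].
  by move=> /sX[_ [u [w [uw wv sw] wu] ux]]; exists w; split=> //; exists u.
have [w [uw wv sw hw]] : exists w, [/\ undominated w, reg w v, size_nbr (reg w) < n
    & forall x, x \in (X : seq T) -> exists2 u, reg w u & adjacent G u x].
  have : {subset (X : seq T) <= X} by [].
  elim: (X : seq T) => [|x s IH] sub.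
    by have [w [uw wv sw _]] := hx x0 x0X; exists w.
  have [|w [uw wv sw hw]] := IH; first by move=> y ys; apply: sub; rewrite in_cons ys orbT.
  have [w' [uw' w'v sw' [u w'u ux]]] := hx x (sub x (mem_head _ _)).
  have [h|h] := reg_nested uw uw' (ex_intro _ v (conj wv w'v)).
    exists w'; split=> // y; rewrite in_cons => /orP[/eqP ->|/hw[u' wu' u'y]]; first by exists u.
    by exists u' => //; exact: h.
  exists w; split=> // y; rewrite in_cons => /orP[/eqP ->|/hw//].
  by exists u => //; exact: h.
have [[_ fK _ _] _ _] := regP uw.
suff : #|` X|%fset <= size_nbr (reg w) by rewrite leqNgt (leq_trans sw).
apply: fsubset_leq_card; apply/fsubsetP => x xX; rewrite in_fset_set // in_setE.
have [nU _] := sX x xX; split; last by apply: hw.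
by move=> wx; apply: nU; exists w.
Qed.

Lemma Un_good n v z : Un n v z -> good G S (Un n v).
Proof.
move=> [w0 [uw0 w0v s0] _].
have g w : undominated w -> good G S (reg w) by move=> /regP[].
split.
- have jv y : Un n v y -> joined G (Un n v) v y.
    move=> [w [uw wv sw] wy]; have [[_ _ jw] _ _ _] := g w uw.
    by apply: joinedS (jw _ _ wv wy) => u wu; exists w.
  split.
  + by exists v, w0.
  + by move=> y [w [uw _ _] wy]; have [[_ h _] _ _ _] := g w uw; exact: h.
  + by move=> a b /jv ja /jv jb; apply: joined_trans jb; exact: joined_sym.
- exact: Un_finite.
- by move=> y [w [uw _ _] wy]; have [_ _ h _] := g w uw; exact: h.
- move=> y [ny [u [w hw wu] uy]]; have [uw _ _] := hw; have [_ _ _ h] := g w uw.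
  apply: h; split; last by exists u.
  by move=> wy; apply: ny; exists w.
Qed.

Lemma Un_lives w z : undominated w -> reg w z ->
  exists2 n, lives_in w (Un n (rep z)) & forall m, m < n -> ~ lives_in w (Un m (rep z)).
Proof.
move=> uw wz; have [_ wK _] := regP uw.
have zz : cls z z by exists w.
have [n hn] : exists n, lives_in w (Un n (rep z)).
  have [w' uw' [w'z w'r]] := repP zz.
  have [h|h] := reg_nested uw uw' (ex_intro _ z (conj wz w'z)).
    exists (size_nbr (reg w')).+1; apply: lives_sub wK _ => y /h w'y.
    by exists w'.
  exists (size_nbr (reg w)).+1; apply: lives_sub wK _ => y wy.
  by exists w => //; split=> //; exact: h.
have ex : exists n, `[< lives_in w (Un n (rep z)) >] by exists n; apply/asboolP.
case: (ex_minnP ex) => m /asboolP hm min; exists m => // j jm hj.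
by have := min j; rewrite leqNgt jm => /(_ (asboolT hj)).
Qed.

(** The part around [w] of the shell between two consecutive sets [Un n v]. A common vertex
    determines [v] and [n], so two pieces are equal or disjoint. *)
Definition piece w v n K := [/\ v = rep v, lives_in w (Un n.+1 v),
  ~ lives_in w (Un n v) & K = end_component (nbr (Un n.+1 v) `|` nbr (Un n v)) w].

Lemma piece_exists w : undominated w -> exists K v n, piece w v n K.
Proof.
move=> uw; have [[[[z wz] _ _] _ _ _] wK _] := regP uw.
have [[|n] hn min] := Un_lives uw wz.
  have [r wr] := end_nonempty w; have [N _ /(_ N (leqnn N))] := hn r wr.
  by rewrite Un0.
exists (end_component (nbr (Un n.+1 (rep z)) `|` nbr (Un n (rep z))) w), (rep z), n.
split=> //; last exact: min.
by apply: rep_eq; apply: repP; exists w.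
Qed.

Lemma piece_prop w v n K : piece w v n K -> [/\ good G S K, lives_in w K,
  K `<=` Un n.+1 v & forall z, K z -> ~ Un n v z].
Proof.
move=> [_ l1 l0 ->].
have [z Uz] : exists z, Un n.+1 v z.
  by have [r wr] := end_nonempty w; have [N _ /(_ N (leqnn N))] := l1 r wr; exists (r N).
have fX := finite_vertex_setU (finite_nbr_set (@Un_finite n.+1 v)) (finite_nbr_set (@Un_finite n v)).
set X := _ `|` _ in fX *; split.
- by apply: ecomp_good (Un_good Uz) fX _ l1 => y; left.
- exact: (ecompP w fX).2.
- by apply: ecomp_sub => // y; left.
- move=> y Ky Uy; apply: l0; apply: lives_sub (ecompP w fX).2 _.
  have [cE nE _] := ecomp_conn w fX.
  by apply: (conn_sub cE) => [x /nE nx nU|]; [apply: nx; right|exists y].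
Qed.

Lemma piece_eq w w' v v' n n' K K' z : piece w v n K -> piece w' v' n' K' ->
  K z -> K' z -> K = K'.
Proof.
move=> p p' Kz K'z; have [_ _ KU KnU] := piece_prop p; have [_ _ KU' KnU'] := piece_prop p'.
have Ev : v = v'.
  case: (p) (p') => -> _ _ _ [-> _ _ _].
  by apply: rep_eq; apply: cls_trans (Un_cls (KU _ Kz)) (cls_sym (Un_cls (KU' _ K'z))).
subst v'; have En : n = n'.
  case: (ltngtP n n') => // h.
    by case: (KnU' z K'z); apply: Un_mono h _ (KU _ Kz).
  by case: (KnU z Kz); apply: Un_mono h _ (KU' _ K'z).
subst n'; have fX := finite_vertex_setU (finite_nbr_set (@Un_finite n.+1 v)) (finite_nbr_set (@Un_finite n v)).
case: p Kz => _ _ _ -> Kz; case: p' K'z => _ _ _ -> K'z.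
exact: component_eq (ecompP w fX).1 (ecompP w' fX).1 Kz K'z.
Qed.

Definition blk w : set T := pick_in set0 [set K | exists v n, piece w v n K].

Lemma blkP w : undominated w -> exists v n, piece w v n (blk w).
Proof.
by move=> /piece_exists[K h]; exact: (@pick_inP _ set0 K [set K | exists v n, piece w v n K]).
Qed.

Lemma blk_eq w w' z : undominated w -> undominated w' -> blk w z -> blk w' z ->
  blk w = blk w'.
Proof. by move=> /blkP[v [n p]] /blkP[v' [n' p']]; exact: piece_eq p p'. Qed.

Lemma blk_prop w : undominated w -> good G S (blk w) /\ lives_in w (blk w).
Proof. by move=> /blkP[v [n /piece_prop[]]]. Qed.

(** Distinct blocks are disjoint but may be adjacent. Deleting the vertices where another block
    attaches makes the cells nonadjacent as well. *)
Definition fringe w : set T := [set x | blk w x /\ exists w',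
  [/\ undominated w', blk w' <> blk w & nbr (blk w') x]].

(** Every fringe vertex is a neighbour of a block that contains one of the finitely many neighbours
    of [blk w]. Such a block is determined by this vertex and has a finite neighbourhood. *)
Lemma fringe_finite w : undominated w -> finite_set (fringe w).
Proof.
move=> uw; have [[_ fB _ _] _] := blk_prop uw.
pose F y := [set x | exists w', [/\ undominated w', blk w' y & nbr (blk w') x]].
apply: (@sub_finite_set _ _ (\bigcup_(y in nbr (blk w)) F y)).
  move=> x [Bx [w' [uw' ne [nx [y B'y yx]]]]]; exists y; last by exists w'; split=> //; split=> //; exists y.
  split; last by exists x => //; rewrite adjacent_sym.
  by move=> By; apply: ne; exact: blk_eq By.
apply: bigcup_finite => // y _.
have [[w1 [uw1 B1y]]|n] := pselect (exists w', undominated w' /\ blk w' y).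
  have [[_ f1 _ _] _] := blk_prop uw1; apply: sub_finite_set f1 => x [w' [uw' B'y]].
  by rewrite (blk_eq uw' uw1 B'y B1y).
by apply: sub_finite_set (finite_set0 _) => x [w' [uw' B'y _]]; apply: n; exists w'.
Qed.

Definition cell w : set T := end_component (nbr (blk w) `|` fringe w) w.

Lemma cell_frame w : undominated w -> finite_vertex_set G (nbr (blk w) `|` fringe w).
Proof.
move=> uw; have [[[_ BV _] fB _ _] _] := blk_prop uw.
split; first by rewrite finite_setU; split=> //; exact: fringe_finite.
by move=> x [/nbr_vertices//|[/BV]].
Qed.

Lemma cell_good w : undominated w -> good G S (cell w) /\ lives_in w (cell w).
Proof.
move=> uw; have fX := cell_frame uw; have [gB wB] := blk_prop uw.
split; last exact: (ecompP w fX).2.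
by apply: ecomp_good gB fX _ wB => y; left.
Qed.

Lemma cell_sub w : undominated w -> cell w `<=` blk w.
Proof.
move=> uw; have [_ wB] := blk_prop uw.
by apply: ecomp_sub (cell_frame uw) _ wB => y; left.
Qed.

Lemma cell_apart w w' : undominated w -> undominated w' ->
  cell w = cell w' \/ forall v, cell w v -> ~ cell w' v /\ ~ nbr (cell w') v.
Proof.
move=> uw uw'; have fX := cell_frame uw; have fX' := cell_frame uw'.
have [E|ne] := pselect (blk w = blk w').
  have EX : nbr (blk w) `|` fringe w = nbr (blk w') `|` fringe w' by rewrite /fringe E.
  have [[z [wz w'z]]|n] := pselect (exists z, cell w z /\ cell w' z).
    left; apply: component_eq wz w'z; first exact: (ecompP w fX).1.
    by rewrite EX; exact: (ecompP w' fX').1.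
  right=> v wv; split; first by move=> w'v; apply: n; exists v.
  have [_ h _] := ecomp_conn w fX; have [_ _ h'] := ecomp_conn w' fX'.
  by move=> /h'; rewrite -EX; exact: h.
have dis v : blk w v -> ~ blk w' v by move=> wv w'v; apply: ne; exact: blk_eq wv w'v.
right=> v wv; split; first by move=> /(cell_sub uw') w'v; apply: (dis v) => //; exact: cell_sub.
move=> [_ [u w'u uv]]; have [_ h _] := ecomp_conn w fX; apply: (h v wv); right.
split; first exact: cell_sub.
exists w'; split=> //; first by move=> E; apply: ne.
split; first by move=> w'v; apply: (dis v) => //; exact: cell_sub.
by exists u => //; exact: cell_sub.
Qed.

End Regions.

(** * Levels of regions and compactness *)

Lemma ultra_finite (X I : Type) (F : set_system X) (D : set I) (A : I -> set X) :
  UltraFilter F -> finite_set D -> F (\bigcup_(i in D) A i) -> exists2 i, D i & F (A i).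
Proof.
move=> FU; elim/Pchoice: I => I in D A *.
move=> /finite_fsetP[Y ->] FY; apply: contrapT => h.
have FC : F (\bigcap_(i in [set` Y]) ~` A i).
  apply: filter_bigI => i iY; have [Fi|//] := in_ultra_setVsetC (A i) FU.
  by case: h; exists i.
have [x [[i iY Ai] nA]] := filter_ex (filterI FY FC).
exact: nA i iY Ai.
Qed.

(** Since neighbours of each set lie in the preceding one, a single step of a path leaves at most
    one of the sets. *)
Lemma nested_leave (T : choiceType) (G : graph T) (K : nat -> set T) p u n :
  (forall n, K n.+1 `<=` K n) -> (forall n, nbr G (K n.+1) `<=` K n) ->
  path (adjacent G) u p -> ~ K 0 (last u p) -> K n u -> n < size p.
Proof.
move=> Km Kn; elim: p u n => [|y p IH] u n /=.
  by move=> _ nK Ku; case: nK; elim: n Ku => // n IHn /Km.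
move=> /andP[uy pp] nl Ku; have [Ky|nKy] := pselect (K n y).
  exact: ltnW (IH _ _ pp nl Ky).
have ny : nbr G (K n) y by split=> //; exists u.
by case: n ny {Ku nKy} => // n /Kn; exact: IH.
Qed.

Section Edges.
Variables (T : choiceType) (G : graph T).
Implicit Types (F : set (set T)) (K : set T).

Definition touching K : set (set T) := [set e | edges G e /\ e `&` K !=set0].

Lemma edgeE e : edges G e -> exists u v, [/\ adjacent G u v, u <> v & e = [set u; v]].
Proof.
move=> Ge; have [u [v [_ _ uv E]]] := edge_pair Ge; exists u, v; split=> //.
by apply/asboolP; rewrite -E.
Qed.

Lemma edge_end e v : edges G e -> e v -> exists2 u, adjacent G u v & e = [set u; v].
Proof.
move=> /edgeE[a [b [ab _ ->]]] [->|->]; last by exists a.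
by exists b; [rewrite adjacent_sym|rewrite setUC].
Qed.

Lemma edge_vertices e v : edges G e -> e v -> vertices G v.
Proof. by move=> Ge /(edge_end Ge)[u /adjacent_vertices]. Qed.

Definition delta K : set (set T) := [set e | [/\ edges G e, e `&` K !=set0
  & e `&` (vertices G `\` K) !=set0]].

Lemma deltaP K u v : adjacent G u v -> delta K [set u; v] <->
  (K u /\ ~ K v) \/ (K v /\ ~ K u).
Proof.
move=> uv; have [Gu Gv] := adjacent_vertex uv; split.
  by move=> [_ [x [[->|->] Kx]] [y [[->|->] [_ nKy]]]] //; [left|right].
move=> h; split; first exact/asboolP.
  by case: h => -[? ?]; [exists u|exists v]; split=> //; [left|right].
by case: h => -[? ?]; [exists v|exists u]; split=> //; [right|left].
Qed.

Lemma cut_delta K x y : K `<=` vertices G -> K x -> vertices G y -> ~ K y ->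
  cut G (delta K).
Proof. by move=> sK Kx Gy nKy; exists K; split=> //; [exists x|exists y]. Qed.

End Edges.

Section Levels.
Variables (T : choiceType) (G : graph T) (S0 : set T) (s0 : T).
Hypothesis cG : connected_graph G.
Hypothesis fS0 : finite_vertex_set G S0.
Hypothesis S0s : S0 s0.
Implicit Types (w : graph_end G).

(** Each level is a cell relative to the finite boundary of the previous one, which puts a region
    and its neighbours inside its parent. *)
Fixpoint lvl n w : set T :=
  match n with 0 => cell S0 w | n'.+1 => cell (nbr G (lvl n' w)) w end.

Definition lvl_frame n w := if n is n'.+1 then nbr G (lvl n' w) else S0.

Lemma lvl_spec n w : undominated w -> [/\ finite_vertex_set G (lvl_frame n w),
  good G (lvl_frame n w) (lvl n w) & lives_in w (lvl n w)].
Proof.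
move=> uw; elim: n => [|n [fn [_ fK _ _] wK]].
  by have [g l] := cell_good fS0 uw.
have f' := finite_nbr_set fK.
by have [g l] := cell_good f' uw.
Qed.

Lemma lvl_conn n w : undominated w -> conn G (lvl n w) /\ finite_set (nbr G (lvl n w)).
Proof. by move=> /(lvl_spec n)[_ []]. Qed.

Lemma lvl_lives n w : undominated w -> lives_in w (lvl n w).
Proof. by move=> /(lvl_spec n)[]. Qed.

Lemma lvl_S0 w v : undominated w -> (lvl 0 w `|` nbr G (lvl 0 w)) v -> ~ S0 v.
Proof. by move=> /(lvl_spec 0)[_ [_ _ h h'] _] []; [exact: h|exact: h']. Qed.

Lemma lvlS n w : undominated w -> lvl n.+1 w `<=` lvl n w.
Proof.
move=> uw; have [_ [c _ h _] l] := lvl_spec n.+1 uw.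
apply: (conn_sub c) => [v lv nv|]; first exact: (h v lv).
exact: lives_meet l (lvl_lives n uw).
Qed.

Lemma lvl_nbr n w : undominated w -> nbr G (lvl n.+1 w) `<=` lvl n w.
Proof.
move=> uw v nv; have [_ [_ _ _ h] _] := lvl_spec n.+1 uw.
apply: contrapT => nl; apply: (h v nv); split=> //.
by case: nv => _ [u /lvlS lu uv]; exists u => //; exact: lu.
Qed.

Lemma lvl_apart n w w' : undominated w -> undominated w' -> lvl n w = lvl n w' \/
  forall v, lvl n w v -> ~ lvl n w' v /\ ~ nbr G (lvl n w') v.
Proof.
move=> uw uw'; elim: n => [|n [E|IH]]; first exact: cell_apart.
  rewrite /= E.
  have [_ f'] := lvl_conn n uw'.
  exact: (cell_apart (finite_nbr_set f')).
right=> v /(lvlS uw) lv; have [n1 _] := IH v lv.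
by split; [move=> /(lvlS uw')|move=> /(lvl_nbr uw')].
Qed.

Lemma lvl_eq n w w' v : undominated w -> undominated w' -> lvl n w v -> lvl n w' v ->
  lvl n w = lvl n w'.
Proof. by move=> uw uw' a b; case: (lvl_apart n uw uw') => // /(_ v a)[]. Qed.

Lemma lvl_leave v : vertices G v ->
  exists N, forall n w, N <= n -> undominated w -> ~ lvl n w v.
Proof.
move=> Gv; have [p [_ pp _] lp] := cG.2 v s0 Gv (fS0.2 _ S0s).
exists (size p) => n w pn uw lv.
have := @nested_leave _ G (lvl^~ w) p v n _ _ pp _ lv.
rewrite leqNgt in pn; rewrite (negbTE pn) => h; suff : false by [].
apply: h => [m|m|]; [exact: lvlS|exact: lvl_nbr|].
by rewrite lp => l0; apply: (@lvl_S0 w s0) => //; left.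
Qed.

End Levels.

(** * Compactness of circuits *)

Section Compactness.
Variables (T : choiceType) (G : graph T) (Psi : set (graph_end G)).
Hypothesis cG : connected_graph G.
Hypothesis uPsi : forall w, Psi w -> undominated w.
Implicit Types (S Q : set T) (C D : set (set T)) (w : graph_end G).

Section OneCircuit.
Variable C : set (set T).
Hypothesis CC : C_Psi Psi C.
Variables (e0 : set T) (c : T).
Hypotheses (Ce0 : C e0) (e0c : e0 c).

Let CE : C `<=` edges G. Proof. by case: CC. Qed.
Let Gc : vertices G c. Proof. exact: edge_vertices (CE Ce0) e0c. Qed.

(** The edges at [v] form a cut covered by [v] alone. *)
Lemma finite_degree v : vertices G v -> finite_set [set e | C e /\ e v].
Proof.
move=> Gv; have [y [Gy ny]] : exists y, vertices G y /\ ~ [set v] y.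
  have [a [b [ab nab _]]] := edgeE (CE Ce0); have [Ga Gb] := adjacent_vertex ab.
  have [E|ne] := pselect (a = v); last by exists a.
  by exists b; split=> // /= E'; apply: nab; rewrite E E'.
have [n hn] : meets_evenly C (delta G [set v]).
  case: CC => _ + _ _; apply; first by apply: cut_delta ny => // z ->.
  exists [set v]; first exact: finite_vertex_set1.
  by move=> e [_ + _].
apply: (@sub_finite_set _ _ (C `&` delta G [set v])); last by apply/finite_setP; exists n.*2.
move=> e [Ce ev]; split=> //; have [u uv ->] := edge_end (CE Ce) ev.
by apply/(deltaP _ uv); right; split=> //=; exact: adjacent_neq uv.
Qed.

Lemma finite_incident S : finite_vertex_set G S ->
  finite_set [set e | C e /\ e `&` S !=set0].
Proof.
move=> [fS SV]; apply: (@sub_finite_set _ _ (\bigcup_(v in S) [set e | C e /\ e v])).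
  by move=> e [Ce [v [ev Sv]]]; exists v.
by apply: bigcup_finite => // v Sv; exact: finite_degree (SV v Sv).
Qed.

Definition touched F Q := exists2 e : set T, F e & e `&` Q !=set0.

(** Geometric connectedness for the cut around [Q], which [S] covers: otherwise [C] would have edges
    inside [Q] and, at [c], outside it, but none in the cut. *)
Lemma comp_boundary S Q : finite_vertex_set G S -> S c ->
  component (del_vertices G S) Q -> touched C Q ->
  exists e, [/\ C e, e `&` Q !=set0 & e `&` S !=set0].
Proof.
move=> fS Sc cQ [e Ce [x [ex Qx]]]; apply: contrapT => nb.
have [kQ nQ bQ] := comp_conn cQ; have [_ QV jQ] := kQ.
have noC : C `&` delta G Q = set0.
  rewrite -subset0 => f [Cf [Gf [u [fu Qu]] [v [fv [Gv nQv]]]]].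
  apply: nb; exists f; split=> //; [by exists u|exists v; split=> //].
  apply: bQ; split=> //; exists u => //; apply/asboolP.
  have [u' u'v E] := edge_end Gf fv; rewrite E in fu.
  by case: fu => E'; [rewrite -E' in E; rewrite -E|rewrite E' in Qu].
have inQ f v : C f -> f v -> Q v -> f `<=` Q.
  move=> Cf fv Qv z fz; apply: contrapT => nQz.
  have : (C `&` delta G Q) f.
    split=> //; split; [exact: CE|by exists v|exists z; split=> //].
    by split=> //; exact: edge_vertices (CE Cf) fz.
  by rewrite noC.
case: CC => _ _ /(_ (delta G Q)) gc _.
have [|||z] := gc _ _ _; last by rewrite noC.
- by apply: cut_delta Qx Gc _ => //; move=> /nQ; exact.
- exists S => // f [Gf [u [fu Qu]] [v [fv [Gv nQv]]]]; exists v; split=> //.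
  apply: bQ; split=> //; exists u => //; apply/asboolP.
  have [u' u'v E] := edge_end Gf fv; rewrite E in fu.
  by case: fu => E'; [rewrite -E' in E; rewrite -E|rewrite E' in Qu].
pose H := del_edges G (delta G Q).
have HQ u v : linked H u v -> Q u <-> Q v.
  move=> [p [_ pp _] <-]; elim: p u pp => //= y p IH u /andP[/asboolP[Guy nd] pp].
  rewrite -IH // /del_edges; have uy : adjacent G u y by apply/asboolP.
  have nd' := contra_not (proj2 (deltaP Q uy)) nd.
  by split=> h; apply: contrapT => h'; apply: nd'; [left|right].
have lift u v : joined G Q u v -> linked H u v.
  move=> uv; apply: (joined_ind uv); first by apply: linked_refl; case: (joined_in uv).
  move=> a b Qa Qb ab ha; apply: linked_trans ha _.
  have [Ga Gb] := adjacent_vertex ab.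
  apply: (@path_linked _ H a [:: b]) => //; rewrite /= andbT; apply/asboolP; split; first exact/asboolP.
  by move=> /(deltaP Q ab); tauto.
have cHQ : component H Q.
  exists x; first exact: QV.
  apply/seteqP; split=> y /=; first by move=> /HQ h; apply/h.
  by move=> Qy; apply/lift/jQ.
have nQc : ~ Q c by move=> /nQ.
have nQe0 : forall z, e0 z -> ~ Q z by move=> z e0z Qz; apply: nQc; exact: inQ e0z Qz _ e0c.
exists Q, [set v | linked H c v]; split=> //.
- by exists c.
- by move=> E; apply: nQc; rewrite E; exact: linked_refl.
- exists e; last exact: inQ ex Qx.
  split=> //; split; first exact: CE.
  by move=> de; have : (C `&` delta G Q) e by []; rewrite noC.
- have nd : ~ delta G Q e0 by move=> [_ [z [/nQe0]]].
  exists e0; first by split=> //; split=> //; exact: CE.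
  move=> z e0z /=; have [u uc E] := edge_end (CE Ce0) e0c.
  rewrite E in e0z; case: e0z => ->; last exact: linked_refl.
  apply: (@path_linked _ H c [:: u]) => //; rewrite /= andbT; apply/asboolP.
  by rewrite setUC -E; split=> //; exact: CE.
Qed.

Lemma finite_touched S : finite_vertex_set G S -> S c ->
  finite_set [set Q | component (del_vertices G S) Q /\ touched C Q].
Proof.
move=> fS Sc; pose Z := [set e | C e /\ e `&` S !=set0].
apply: (@sub_finite_set _ _ (\bigcup_(e in Z) \bigcup_(v in e)
    [set Q | component (del_vertices G S) Q /\ Q v])).
  move=> Q [cQ tQ]; have [e [Ce [x [ex Qx]] eS]] := comp_boundary fS Sc cQ tQ.
  by exists e => //; exists x.
apply: bigcup_finite; first exact: finite_incident.
move=> e [Ce _]; apply: bigcup_finite.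
  have [u [v [_ _ ->]]] := edgeE (CE Ce); exact: finite_set2.
move=> v ev; have [[Q [cQ Qv]]|n] := pselect (exists Q, component (del_vertices G S) Q /\ Q v).
  apply: (@sub_finite_set _ _ [set Q]); last exact: finite_set1.
  by move=> Q' [cQ' Q'v]; exact: component_eq cQ' cQ Q'v Qv.
by apply: (@sub_finite_set _ _ set0); [move=> Q h; apply: n; exists Q|exact: finite_set0].
Qed.

Section Direction.
Variable BB : set T -> Prop.
Hypothesis BBm : forall Q Q', Q `<=` Q' -> BB Q -> BB Q'.
Hypothesis BBex : forall S, finite_vertex_set G S -> exists Q,
  [/\ component (del_vertices G S) Q, touched C Q & BB Q].

(** A suitable component is chosen for every finite set, and the limit is taken along an ultrafilter
    on the finite sets directed by inclusion. Only finitely many components are touched, so one of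
    them contains almost all the choices. *)
Lemma direction_exists : exists f : set T -> set T,
  (forall S, finite_vertex_set G S -> [/\ component (del_vertices G S) (f S),
     touched C (f S) & BB (f S)]) /\
  (forall S S', finite_vertex_set G S -> finite_vertex_set G S' -> S `<=` S' -> f S' `<=` f S).
Proof.
have /choice[B hB] : forall S, exists Q, finite_vertex_set G S ->
    [/\ component (del_vertices G S) Q, touched C Q & BB Q].
  move=> S; have [fS|nS] := pselect (finite_vertex_set G S); last by exists set0.
  by have [Q hQ] := BBex fS; exists Q.
pose F : set_system (set T) := [set A | exists2 S, finite_vertex_set G S &
  forall S', finite_vertex_set G S' -> S `<=` S' -> A S'].
have FF : ProperFilter F.
  apply: Build_ProperFilter_ex; first by move=> A [S fS h]; exists S; exact: h.
  split.
  - by exists set0 => //; split=> //; exact: finite_set0.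
  - move=> A A' [S fS h] [S' fS' h']; exists (S `|` S'); first exact: finite_vertex_setU.
    by move=> X fX sX; split; [apply: h|apply: h'] => // y Sy; apply: sX; [left|right].
  - by move=> A A' AA' [S fS h]; exists S => // X fX sX; exact/AA'/h.
have [U [UU FU]] := ultraFilterLemma FF.
have UF : ProperFilter U := ultra_proper.
have ex1 S : finite_vertex_set G S -> S c -> exists Q, component (del_vertices G S) Q /\
    U [set S' | finite_vertex_set G S' /\ B S' `<=` Q].
  move=> fS Sc; have [|Q [cQ _] hQ] := @ultra_finite _ _ U _
      (fun Q => [set S' | finite_vertex_set G S' /\ B S' `<=` Q]) UU (finite_touched fS Sc).
    apply: FU; exists S => // S' fS' SS'; have [cB [e Ce [x [ex Bx]]] _] := hB S' fS'.
    have [kB nB _] := comp_conn cB; have [_ BV _] := kB.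
    have [Q cQ Qx] := comp_exists (BV x Bx) (fun Sx => nB x Bx (SS' x Sx)).
    exists Q; first by split=> //; exists e => //; exists x.
    by split=> //; apply: comp_sub cQ kB _ _ => [v /nB nv /SS'//|]; exists x.
  by exists Q.
have ex S : finite_vertex_set G S -> exists Q, component (del_vertices G S) Q /\
    U [set S' | finite_vertex_set G S' /\ B S' `<=` Q].
  move=> fS; have fS1 := finite_vertex_setU fS (finite_vertex_set1 Gc).
  have [|Q1 [cQ1 UQ1]] := ex1 _ fS1; first by right.
  have [kQ1 nQ1 _] := comp_conn cQ1; have [[x Q1x] QV _] := kQ1.
  have nS v : Q1 v -> ~ S v by move=> /nQ1 h Sv; apply: h; left.
  have [Q cQ Qx] := comp_exists (QV x Q1x) (nS x Q1x).
  exists Q; split=> //; apply: filterS UQ1 => S' [fS' h]; split=> //.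
  by apply: subset_trans h _; apply: comp_sub cQ kQ1 nS _; exists x.
have /choice[f hf] : forall S, exists Q, finite_vertex_set G S ->
    component (del_vertices G S) Q /\ U [set S' | finite_vertex_set G S' /\ B S' `<=` Q].
  move=> S; have [fS|nS] := pselect (finite_vertex_set G S); last by exists set0.
  by have [Q hQ] := ex S fS; exists Q.
exists f; split.
  move=> S fS; have [cf Uf] := hf S fS; have [S' [fS' h]] := filter_ex Uf.
  have [_ [e Ce [x [ex' Bx]]] bB] := hB S' fS'; split=> //; last exact: BBm bB.
  by exists e => //; exists x; split=> //; exact: h.
move=> S S' fS fS' SS'; have [cf Uf] := hf S fS; have [cf' Uf'] := hf S' fS'.
have [X [[fX h] [_ h']]] := filter_ex (filterI Uf Uf').
have [cB _ _] := hB X fX; have [[[x Bx] _ _] _ _] := comp_conn cB.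
have [k' n' _] := comp_conn cf'.
apply: comp_sub cf k' _ _ => [v /n' nv /SS'//|].
by exists x; split; [exact: h'|exact: h].
Qed.

End Direction.

Section DirectionEnd.
Variable f : set T -> set T.
Hypothesis fc : forall S, finite_vertex_set G S -> component (del_vertices G S) (f S).
Hypothesis ft : forall S, finite_vertex_set G S -> touched C (f S).
Hypothesis fm : forall S S', finite_vertex_set G S -> finite_vertex_set G S' ->
  S `<=` S' -> f S' `<=` f S.

(** Here [g] prescribes what is added to the deleted sets, and [t] which kind of vertex is wanted at
    each step. The linking paths are deleted as well, so every vertex lies on only finitely many of
    them. *)
Lemma direction_ray (g : set T -> set T) (t : nat -> T -> Prop) S0 :
  finite_vertex_set G S0 ->
  (forall S, finite_vertex_set G S -> finite_vertex_set G (g S)) ->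
  (forall n S, finite_vertex_set G S -> exists2 v, f S v & t n v) ->
  exists (Sq : nat -> set T) (v : nat -> T) (w : graph_end G),
  [/\ Sq 0 = S0 /\ (forall n, finite_vertex_set G (Sq n)),
    forall n, Sq n `<=` Sq n.+1 /\ g (Sq n) `<=` Sq n.+1,
    forall n, f (Sq n) (v n), forall n, t n (v n)
    & forall S, finite_vertex_set G S ->
        exists N, forall n, N <= n -> end_component S w (v n)].
Proof.
move=> fS0 fg ht.
pose ok n (z : set T * T * set T) := [/\ finite_vertex_set G z.1.1, f z.1.1 z.1.2,
  t n z.1.2 & finite_vertex_set G z.2].
pose nx (z z' : set T * T * set T) := [/\ z'.1.1 = z.1.1 `|` g z.1.1 `|` ([set z.1.2] `|` z.2),
  joined G z'.2 z.1.2 z'.1.2 & z'.2 `<=` f z.1.1].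
have step n z : ok n z -> exists z', ok n.+1 z' /\ nx z z'.
  case: z => [[S v] P] [/= fS fv tv fP].
  have [[_ fV jf] _ _] := comp_conn (fc fS).
  have fS' : finite_vertex_set G (S `|` g S `|` ([set v] `|` P)).
    apply: finite_vertex_setU; first by apply: finite_vertex_setU => //; exact: fg.
    by apply: finite_vertex_setU => //; apply: finite_vertex_set1; exact: fV.
  have [v' fv' tv'] := ht n.+1 _ fS'.
  have fv'S : f S v' by apply: fm fv' => // y Sy; left; left.
  have [p [pp lp up sp]] := joined_path (jf _ _ fv fv'S).
  have spf : [set` v :: p] `<=` f S by move=> y /= /sp /set_mem.
  exists (S `|` g S `|` ([set v] `|` P), v', [set` v :: p]); split; last first.
    split=> //=; rewrite -lp; apply: path_joined => //; first exact: fV.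
    by move=> y yp; exact/mem_set.
  split=> //=; split; first exact: finite_seq.
  exact: subset_trans spf fV.
have [v0 fv0 tv0] := ht 0 _ fS0.
have ok0 : ok 0 (S0, v0, set0) by split=> //=; split=> //; exact: finite_set0.
have /choice[h hh] : forall nz : nat * (set T * T * set T), exists z',
    ok nz.1 nz.2 -> ok nz.1.+1 z' /\ nx nz.2 z'.
  move=> [n z]; have [o|no] := pselect (ok n z); last by exists z.
  by have [z' hz'] := step n z o; exists z'.
pose z := fix z n := match n with 0 => (S0, v0, set0) | n'.+1 => h (n', z n') end.
have okz n : ok n (z n) by elim: n => // n IH; have [] := hh (n, z n) IH.
have nxz n : nx (z n) (z n.+1) by have [] := hh (n, z n) (okz n).
have Smono n m : n <= m -> (z n).1.1 `<=` (z m).1.1.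
  move=> nm; rewrite -(subnKC nm); elim: (m - n) => [|d IH]; first by rewrite addn0.
  rewrite addnS; apply: subset_trans IH _; have [-> _ _] := nxz (n + d).
  by move=> y Sy; left; left.
have avoid n v : f (z n).1.1 v -> ~ (z n).1.1 v.
  by have [fn _ _ _] := okz n; have [_ h' _] := comp_conn (fc fn); exact: h'.
have [|||w hw] := @end_of_sets _ G (fun n => (z n).1.2) (fun n => (z n.+1).2).
- by move=> n; have [] := nxz n.
- move=> n E; have [_ fv _ _] := okz n.+1; apply: (avoid _ _ fv).
  have [-> _ _] := nxz n; right; left; exact/esym.
- move=> x; have [[n Px]|nP] := pselect (exists n, (z n.+1).2 x); last first.
    by exists 0 => n _ Px; apply: nP; exists n.
  exists n.+2 => m nm Px'; have [_ _ sub] := nxz m; apply: (avoid m x (sub _ Px')).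
  apply: (Smono n.+2 m nm); have [-> _ _] := nxz n.+1.
  by right; right.
exists (fun n => (z n).1.1), (fun n => (z n).1.2), w; split=> //.
- by split=> // n; have [] := okz n.
- by move=> n; have [-> _ _] := nxz n; split=> y Sy; left; [left|right].
- by move=> n; have [] := okz n.
- by move=> n; have [] := okz n.
Qed.

Definition Cend v := exists2 e, C e & e v.

Lemma f_Cend S : finite_vertex_set G S -> exists2 v, f S v & Cend v.
Proof. by move=> /ft[e Ce [v [ev fv]]]; exists v => //; exists e. Qed.

Lemma in_closure_C w : (forall S, finite_vertex_set G S -> exists2 v, end_component S w v & Cend v) ->
  Psi w.
Proof.
move=> h; case: CC => _ _ _; apply=> S fS.
by have [v Ev [e Ce ev]] := h S fS; exists e => //; exists v.
Qed.

(** Otherwise a sequence alternating between endvertices of [C] and neighbours of [v] converges to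
    an end. This end is in the closure of [C], hence in [Psi], and [v] dominates it. *)
Lemma no_dominating v : vertices G v ->
  exists S, [/\ finite_vertex_set G S, S v & ~ nbr G (f S) v].
Proof.
move=> Gv; apply: contrapT => nS.
have dom S : finite_vertex_set G S -> S v -> nbr G (f S) v.
  by move=> fS Sv; apply: contrapT => n; apply: nS; exists S.
have f0 := finite_vertex_set1 Gv.
have [||Sq [u [w [_ _ _ tu hw]]]] := @direction_ray id
    (fun n x => if odd n then is_true (adjacent G x v) else Cend x) [set v] f0.
- by [].
- move=> n S fS; case: (odd n); last exact: f_Cend.
  have fS1 := finite_vertex_setU fS f0.
  have [|_ [x fx xv]] := dom _ fS1; first by right.
  by exists x => //; apply: fm fx => // y Sy; left.
have Pw : Psi w.
  apply: in_closure_C => S fS; have [N hN] := hw S fS.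
  exists (u N.*2); first by apply: hN; rewrite -addnn leq_addr.
  by have := tu N.*2; rewrite odd_double.
apply: (uPsi Pw (v := v)); apply: adherent_dominates => // S fS Sv.
have [N hN] := hw S fS.
have ev : end_component S w (u N.*2.+1).
  by apply: hN; rewrite -addnn; apply: leqW; rewrite leq_addr.
split; first by have [_ h _] := ecomp_conn w fS; move=> /h.
by exists (u N.*2.+1) => //; have := tu N.*2.+1; rewrite /= odd_double.
Qed.

(** Separators for all vertices already deleted are added at each step. The chosen components then
    shrink together with their neighbourhoods and leave every finite set, so that the limit end has
    exactly the direction [f]. *)
Lemma direction_end : exists2 w, Psi w & forall S, finite_vertex_set G S ->
  end_component S w = f S.
Proof.
have /choice[X hX] : forall v, exists S, vertices G v ->
    [/\ finite_vertex_set G S, S v & ~ nbr G (f S) v].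
  move=> v; have [Gv|n] := pselect (vertices G v); last by exists set0.
  by have [S hS] := no_dominating Gv; exists S.
have f0 := finite_vertex_set1 Gc.
have [||Sq [u [w [[S0E fSq] Sm fu tu hw]]]] := @direction_ray (fun S => \bigcup_(v in S) X v)
    (fun _ => Cend) [set c] f0.
- move=> S [fS SV]; apply: finite_vertex_bigcup => // v Sv.
  by have [] := hX v (SV v Sv).
- by move=> _ S; exact: f_Cend.
have Pw : Psi w.
  by apply: in_closure_C => S fS; have [N hN] := hw S fS; exists (u N) => //; exact: hN.
exists w => // S fS.
have fn n : f (Sq n.+1) `<=` f (Sq n) by apply: fm => //; case: (Sm n).
have fnb n : nbr G (f (Sq n.+1)) `<=` f (Sq n).
  move=> v [nv [y fy yv]]; have [_ _ bf] := comp_conn (fc (fSq n)).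
  have [_ nf' _] := comp_conn (fc (fSq n.+1)).
  have [fv|nfv] := pselect (f (Sq n) v) => //.
  have Sv : Sq n v by apply: bf; split=> //; exists y => //; exact: fn.
  have [fX Xv nX] := hX v ((fSq n).2 _ Sv); case: nX.
  split; first by have [_ h _] := comp_conn (fc fX); move=> /h.
  exists y => //; apply: fm fy => // z Xz; have [_ sub] := Sm n; apply: sub.
  by exists v.
have leave x : exists N, forall n, N <= n -> ~ f (Sq n) x.
  have [Gx|nGx] := pselect (vertices G x); last first.
    exists 0 => n _ fx; apply: nGx.
    by have [[_ h _] _ _] := comp_conn (fc (fSq n)); exact: h.
  have [p [_ pp _] lp] := cG.2 x c Gx Gc.
  exists (size p) => n pn fx.
  have := @nested_leave _ G (fun n => f (Sq n)) p x n fn fnb pp.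
  rewrite lp ltnNge pn => h; suff : false by [].
  apply: h fx => fc0; have [_ h _] := comp_conn (fc (fSq 0)).
  by apply: (h c fc0); rewrite S0E.
have [N1 h1] := @eventually_avoids _ (fun n => f (Sq n)) S fS.1 leave.
have [N2 h2] := hw S fS; pose N := maxn N1 N2.
have kN : f (Sq N) `<=` end_component S w.
  have [k _ _] := comp_conn (fc (fSq N)).
  apply: (conn_sub_ecomp fS k) => [v fv|]; first exact: h1 (leq_maxl _ _) fv.
  by exists (u N); split=> //; apply: h2; rewrite leq_maxr.
have fU := finite_vertex_setU fS (fSq N).
have [[[x fx] _ _] _ _] := comp_conn (fc fU).
have fxS : f S x by apply: fm fx => // y Sy; left.
have Ex : end_component S w x by apply: kN; apply: fm fx => // y Sy; right.
exact: component_eq (ecompP w fS).1 (fc fS) Ex fxS.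
Qed.

End DirectionEnd.

(** The compactness principle: a monotone property that holds for some touched component at every
    finite stage concentrates at an end of [Psi]. It is applied to being touched by a cut and to
    touching infinitely many given edges. *)
Lemma compact_end (BB : set T -> Prop) : (forall Q Q', Q `<=` Q' -> BB Q -> BB Q') ->
  (forall S, finite_vertex_set G S -> exists Q,
     [/\ component (del_vertices G S) Q, touched C Q & BB Q]) ->
  exists2 w, Psi w & forall S, finite_vertex_set G S -> BB (end_component S w).
Proof.
move=> BBm BBex; have [f [hf fm]] := direction_exists BBm BBex.
have [|||w Pw E] := @direction_end f.
- by move=> S /hf[].
- by move=> S /hf[].
- exact: fm.
by exists w => // S fS; rewrite E //; have [] := hf S fS.
Qed.

Lemma infinite_end (M : set (set T)) : M `<=` C -> infinite_set M ->
  exists2 w, Psi w & forall S, finite_vertex_set G S ->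
    infinite_set (M `&` touching G (end_component S w)).
Proof.
move=> MC iM; apply: (@compact_end (fun Q => infinite_set (M `&` touching G Q))).
  move=> Q Q' QQ' h h'; apply: h; apply: sub_finite_set h' => e [Me [Ge [x [ex Qx]]]].
  by split=> //; split=> //; exists x; split=> //; exact: QQ'.
move=> S fS; have fS1 := finite_vertex_setU fS (finite_vertex_set1 Gc).
set S1 := _ `|` _ in fS1; have S1c : S1 c by right.
have [Q1 [cQ1 tQ1] iQ1] : exists2 Q, component (del_vertices G S1) Q /\ touched C Q
    & infinite_set (M `&` touching G Q).
  apply: contrapT => nQ; apply: iM.
  apply: (@sub_finite_set _ _ ([set e | C e /\ e `&` S1 !=set0] `|`
      \bigcup_(Q in [set Q | component (del_vertices G S1) Q /\ touched C Q]) (M `&` touching G Q))).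
    move=> e Me; have Ce := MC _ Me; have [u [v [uv _ eE]]] := edgeE (CE Ce).
    have eu : e u by rewrite eE; left.
    have [Su|nSu] := pselect (S1 u); first by left; split=> //; exists u.
    have [Q cQ Qu] := comp_exists (adjacent_vertex uv).1 nSu.
    right; exists Q; first by split=> //; exists e => //; exists u.
    by split=> //; split; [exact: CE|exists u].
  rewrite finite_setU; split; first exact: finite_incident.
  apply: bigcup_finite; first exact: finite_touched.
  by move=> Q hQ; apply: contrapT => i; apply: nQ; exists Q.
have [k1 n1 _] := comp_conn cQ1; have [[x Q1x] V1 _] := k1.
have nS v : Q1 v -> ~ S v by move=> /n1 h Sv; apply: h; left.
have [Q cQ Qx] := comp_exists (V1 x Q1x) (nS x Q1x).
have sub : Q1 `<=` Q by apply: comp_sub cQ k1 nS _; exists x.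
exists Q; split=> //.
  by case: tQ1 => e Ce [y [ey Qy]]; exists e => //; exists y; split=> //; exact: sub.
move=> h; apply: iQ1; apply: sub_finite_set h => e [Me [Ge [y [ey Qy]]]].
by split=> //; split=> //; exists y; split=> //; exact: sub.
Qed.

End OneCircuit.
End Compactness.

(** * Parity *)

Section Parity.
Variable U : choiceType.
Implicit Types X Y Z : set U.

(** An infinite set counts as even, as [fset_set] is empty on it; finiteness is stated separately
    where evenness is meant. *)
Definition oddc X : bool := odd #|` fset_set X|%fset.

Lemma oddc0 : oddc set0 = false.
Proof. by rewrite /oddc fset_set0 cardfs0. Qed.

Lemma oddc1 x : oddc [set x] = true.
Proof. by rewrite /oddc fset_set1 cardfs1. Qed.

Lemma oddc_xor X Y Z : finite_set X -> finite_set Y ->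
  (forall e, Z e <-> (X e /\ ~ Y e) \/ (Y e /\ ~ X e)) -> oddc Z = oddc X (+) oddc Y.
Proof.
move=> fX fY hZ; have -> : Z = (X `\` Y) `|` (Y `\` X).
  apply/seteqP; split=> e h; last by apply/hZ; case: h => -[]; [left|right].
  by case: ((hZ e).1 h) => -[]; [left|right].
have fXY : finite_set (X `\` Y) by exact: finite_setD.
have fYX : finite_set (Y `\` X) by exact: finite_setD.
rewrite /oddc fset_setU // !fset_setD //.
set A := fset_set X; set B := fset_set Y.
rewrite cardfsU.
have -> : ((A `\` B) `&` (B `\` A) = fset0)%fset.
  by apply/fsetP => z; rewrite !inE; case: (z \in A); case: (z \in B).
rewrite cardfs0 subn0 oddD -(cardfsID B A) -(cardfsID A B) !oddD fsetIC.
by case: (odd _); case: (odd _); case: (odd _).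
Qed.

Lemma meets_evenlyP (F b : set U) : (exists n, (F `&` b #= `I_n.*2)%card) <->
  finite_set (F `&` b) /\ oddc (F `&` b) = false.
Proof.
split=> [[n h]|[f h]].
  by split; [apply/finite_setP; exists n.*2|rewrite /oddc (card_fset_set h) odd_double].
have [m hm] := (finite_setP _).1 f; exists m./2.
move: h; rewrite /oddc (card_fset_set hm) => ho.
by have E : m = m./2.*2 by [rewrite -{1}(odd_double_half m) ho]; rewrite -E.
Qed.

Lemma oddcU X Y : finite_set X -> finite_set Y -> (forall e, X e -> ~ Y e) ->
  oddc (X `|` Y) = oddc X (+) oddc Y.
Proof.
move=> fX fY d; apply: oddc_xor => // e; split=> [[Xe|Ye]|[[Xe _]|[Ye _]]].
- by left; split=> //; exact: d.
- by right; split=> // Xe; exact: (d e).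
- by left.
- by right.
Qed.

End Parity.

(** * Circuits and cuts meet evenly *)

Section Even.
Variables (T : choiceType) (G : graph T) (Psi : set (graph_end G)).
Hypothesis cG : connected_graph G.
Hypothesis uPsi : forall w, Psi w -> undominated w.
Implicit Types (S Q K A : set T) (C D F : set (set T)) (w : graph_end G).

(** If for every [S] some component met both sets, compactness would give an end of [Psi] in the
    closure of [D]. *)
Lemma no_bad C D : C_Psi Psi C -> D_Psi Psi D -> exists S, finite_vertex_set G S /\
  forall Q, component (del_vertices G S) Q -> touched C Q -> ~ touched D Q.
Proof.
move=> CC [_ DD]; have [[e0 Ce0]|nC] := pselect (C !=set0); last first.
  exists set0; split; first by split=> //; exact: finite_set0.
  by move=> Q _ [e Ce]; case: nC; exists e.
apply: contrapT => nS; have Ee0 : edges G e0 by case: CC => h _ _ _; exact: h.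
have [u [v [uv _ E]]] := edgeE Ee0.
have e0u : e0 u by rewrite E; left.
have [||w Pw h] := compact_end cG uPsi CC Ce0 e0u (BB := touched D).
- by move=> Q Q' QQ' [e De [x [ex Qx]]]; exists e => //; exists x; split=> //; exact: QQ'.
- move=> S fS; apply: contrapT => h; apply: nS; exists S; split=> // Q cQ tC tD.
  by apply: h; exists Q.
by apply: (DD w Pw) => S fS; exact: h.
Qed.

Lemma even_delta F A : (forall b, cut G b -> finitely_coverable G b -> meets_evenly F b) ->
  A `<=` vertices G -> finitely_coverable G (delta G A) ->
  finite_set (F `&` delta G A) /\ oddc (F `&` delta G A) = false.
Proof.
move=> hF AV fc; have triv : delta G A = set0 -> finite_set (F `&` delta G A) /\
    oddc (F `&` delta G A) = false.
  by move=> ->; rewrite setI0 oddc0; split=> //; exact: finite_set0.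
have [[x Ax]|nx] := pselect (A !=set0); last first.
  by apply: triv; rewrite -subset0 => e [_ [x [_ Ax]] _]; apply: nx; exists x.
have [[y [Gy nAy]]|ny] := pselect ((vertices G `\` A) !=set0); last first.
  by apply: triv; rewrite -subset0 => e [_ _ [y [_ h]]]; apply: ny; exists y.
apply/meets_evenlyP; apply: hF fc.
exact: (cut_delta AV Ax Gy nAy).
Qed.

(** One side of the cut is shrunk to [S] and the components of [G - S] that [C] touches. This does
    not change the cut on [C], and the new cut is covered by [S] because no edge of [D] touches
    these components. *)
Lemma CD_even C D : C_Psi Psi C -> D_Psi Psi D ->
  finite_set (C `&` D) /\ oddc (C `&` D) = false.
Proof.
move=> CC DD; have [S [fS hS]] := no_bad CC DD.
have [CE Ceven _ _] := CC; have [[A [AV _ _ DE]] _] := DD.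
rewrite -/(delta G A) in DE.
pose A' := [set v | A v /\ (S v \/ exists2 Q, component (del_vertices G S) Q /\ touched C Q & Q v)].
have A'V : A' `<=` vertices G by move=> v [/AV].
have inA e v : C e -> e v -> A' v <-> A v.
  move=> Ce ev; split=> [[]//|Av]; split=> //.
  have [Sv|nSv] := pselect (S v); [by left|right].
  have [Q cQ Qv] := comp_exists (edge_vertices (CE _ Ce) ev) nSv.
  by exists Q => //; split=> //; exists e => //; exists v.
have E : C `&` D = C `&` delta G A'.
  rewrite DE; apply/seteqP; split=> e [Ce]; have [u [v [uv _ eE]]] := edgeE (CE _ Ce).
    have eu : e u by rewrite eE; left. have ev : e v by rewrite eE; right.
    have := inA e u Ce eu; have := inA e v Ce ev.
    by rewrite eE => iv iu /(deltaP _ uv) h; split; rewrite -?eE //; rewrite eE; apply/(deltaP _ uv); tauto.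
  have eu : e u by rewrite eE; left. have ev : e v by rewrite eE; right.
  have := inA e u Ce eu; have := inA e v Ce ev.
  by rewrite eE => iv iu /(deltaP _ uv) h; split; rewrite -?eE //; rewrite eE; apply/(deltaP _ uv); tauto.
rewrite E; apply: even_delta => //; exists S => // e [Ge [a [ea [Aa ha]]] [b [eb [Gb nA'b]]]].
have [Sa|nSa] := pselect (S a); first by exists a.
case: ha => // -[Q [cQ tQ] Qa]; have [kQ nQ bQ] := comp_conn cQ.
have [Sb|nSb] := pselect (S b); first by exists b.
have [u ua eE] := edge_end Ge ea; rewrite eE in eb; case: eb => Eb; last by rewrite Eb in nA'b; case: nA'b; split=> //; right; exists Q.
rewrite /= in Eb; subst u; have Qb : Q b.
  by apply: contrapT => nQb; apply/nSb/bQ; split=> //; exists a => //; rewrite adjacent_sym.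
exfalso; apply: (hS Q cQ tQ); exists e; last by exists a; split=> //; rewrite eE; right.
rewrite DE eE; apply/(deltaP _ ua); right; split=> // Ab; apply: nA'b; split=> //.
by right; exists Q.
Qed.

(** The two cuts differ only at edges between [K] and its neighbourhood, and an undominated end in
    [K] lies in a region that is not incident with such edges. *)
Lemma delta_local A K : D_Psi Psi (delta G A) -> A `<=` vertices G -> conn G K ->
  finite_set (nbr G K) -> forall w, Psi w -> ~ in_closure (delta G (A `&` K)) w.
Proof.
move=> [_ DD] AV cK fK w Pw cl; have [wK|nwK] := pselect (lives_in w K).
  have [S1 fS1 nS1] : exists2 S, finite_vertex_set G S & ~ exists2 e, delta G A e &
      e `&` end_component S w !=set0.
    apply: contrapT => h; apply: (DD w Pw) => S fS; apply: contrapT => h'.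
    by apply: h; exists S.
  have [K' [cK' fK' K1 K2] wK'] := undominated_good (uPsi Pw) (finite_nbr_set fK).
  have fS := finite_vertex_setU fS1 (finite_vertex_setU (finite_nbr_set fK) (finite_nbr_set fK')).
  have [e de [u [eu Eu]]] := cl _ fS; have Ge : edges G e by case: de.
  have Ku : K u by apply: ecomp_sub fS _ wK _ Eu => y; right; left.
  have K'u : K' u by apply: ecomp_sub fS _ wK' _ Eu => y; right; right.
  have E1u : end_component S1 w u by apply: ecomp_mono fS1 fS _ _ Eu => y; left.
  apply: nS1; exists e; last by exists u.
  have [v vu eE] := edge_end Ge eu; rewrite eE in de *.
  have Kv : K v.
    apply: contrapT => nKv; have nv : nbr G K v by split=> //; exists u => //; rewrite adjacent_sym.
    have [K'v|nK'v] := pselect (K' v); first exact: (K1 v K'v).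
    by apply: (K2 v) => //; split=> //; exists u => //; rewrite adjacent_sym.
  by move/(deltaP _ vu): de => h; apply/(deltaP _ vu); move: h => /=; rewrite /setI /=; tauto.
have fS := finite_nbr_set fK; have [e [Ge [a [ea [_ Ka]]] _] [u [eu Eu]]] := cl _ fS.
have [cE nE _] := ecomp_conn w fS; have nKu : ~ K u.
  move=> Ku; apply: nwK; apply: lives_sub (ecompP w fS).2 _.
  apply: (conn_sub cE) => [v /nE//|]; by exists u.
apply: (nE u Eu); split=> //; exists a => //.
have [v va eE] := edge_end Ge ea; rewrite eE in eu; case: eu => E; last by rewrite E in nKu.
by rewrite E adjacent_sym.
Qed.

Definition bdry K A : set (set T) :=
  [set e | [/\ edges G e, e `&` K !=set0 & e `&` (nbr G K `&` A) !=set0]].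

Lemma parity_region C A K : C_Psi Psi C -> D_Psi Psi (delta G A) -> A `<=` vertices G ->
  conn G K -> finite_set (nbr G K) ->
  oddc (C `&` delta G A `&` touching G K) = oddc (C `&` bdry K A).
Proof.
move=> CC DD AV cK fK; have [CE Ceven _ _] := CC.
have [f1 _] := CD_even CC DD.
have [f2 e2] : finite_set (C `&` delta G (A `&` K)) /\ oddc (C `&` delta G (A `&` K)) = false.
  have [[x AKx]|nx] := pselect ((A `&` K) !=set0); last first.
    have -> : delta G (A `&` K) = set0.
      by rewrite -subset0 => e [_ [x [_ h]] _]; apply: nx; exists x.
    by rewrite setI0 oddc0; split=> //; exact: finite_set0.
  have [[y [Gy ny]]|ny] := pselect ((vertices G `\` (A `&` K)) !=set0); last first.
    have -> : delta G (A `&` K) = set0.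
      by rewrite -subset0 => e [_ _ [y [_ h]]]; apply: ny; exists y.
    by rewrite setI0 oddc0; split=> //; exact: finite_set0.
  apply: CD_even CC _; split; last exact: delta_local.
  by apply: cut_delta AKx Gy ny => z [/AV].
have fin : finite_set (C `&` delta G A `&` touching G K).
  by apply: sub_finite_set f1 => e [].
rewrite [RHS](@oddc_xor _ (C `&` delta G A `&` touching G K) (C `&` delta G (A `&` K))) ?e2 ?addbF //.
move=> e; have [Ce|nCe] := pselect (C e); last by split=> [[]//|[[[[]]]|[[]]]].
have [u [v [uv nuv eE]]] := edgeE (CE _ Ce).
have vu : adjacent G v u by rewrite adjacent_sym.
have [Gu Gv] := adjacent_vertex uv.
have T1 : touching G K e <-> K u \/ K v.
  rewrite eE; split=> [[_ [x [[->|->] Kx]]]|]; [by left|by right|].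
  by move=> h; split; [exact/asboolP|case: h => h; [exists u|exists v]; split=> //; [left|right]].
have T2 : bdry K A e <-> (K u /\ ~ K v /\ A v) \/ (K v /\ ~ K u /\ A u).
  rewrite eE; split.
    move=> [_ [x [ex Kx]] [y [ey [[nKy _] Ay]]]].
    by case: ex => /= ?; case: ey => /= ?; subst; tauto.
  move=> h; split; first exact/asboolP.
    by case: h => -[h _]; [exists u|exists v]; split=> //; [left|right].
  case: h => -[h [h' h'']]; [exists v|exists u]; split=> //; try by [left|right].
    by split=> //; split=> //; exists u.
  by split=> //; split=> //; exists v.
have T3 := deltaP A uv; have T4 := deltaP (A `&` K) uv; rewrite -eE in T3 T4.
have {}T4 : delta G (A `&` K) e <-> (A u /\ K u) /\ ~ (A v /\ K v) \/
  (A v /\ K v) /\ ~ (A u /\ K u) := T4.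
rewrite /setI /mkset; move: T1 T2 T3 T4.
move: (touching G K e) (bdry K A e) (delta G A e) (delta G (A `&` K) e) => t b d d'.
have := pselect (K u); have := pselect (K v); have := pselect (A u); have := pselect (A v).
by clear -Ce; tauto.
Qed.

End Even.

(** * Extracting geometrically connected sets *)

Section ConnectedPart.
Variables (T : choiceType) (G : graph T) (Psi : set (graph_end G)).
Implicit Types (S Q K A : set T) (C D F : set (set T)) (w : graph_end G).

Let evenset F := [/\ F `<=` edges G,
  forall b, cut G b -> finitely_coverable G b -> meets_evenly F b
  & forall w, in_closure F w -> Psi w].

Lemma in_closureS F F' w : F `<=` F' -> in_closure F w -> in_closure F' w.
Proof. by move=> h cl S fS; have [e Fe x] := cl S fS; exists e => //; exact: h. Qed.

Lemma chain_finite (U : choiceType) (F : set (set U)) (X : set U) : finite_set X ->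
  total_on F subset -> F !=set0 -> X `<=` \bigcup_(H in F) H ->
  exists2 H, F H & X `<=` H.
Proof.
move=> /finite_fsetP[Y ->] tot [H0 FH0].
have : {subset (Y : seq U) <= Y} by [].
suff main : forall s : seq U, (forall x, x \in s -> (\bigcup_(H in F) H) x) ->
    exists2 H, F H & forall x, x \in s -> H x.
  by move=> _ h; have [|H FH hH] := main Y; [move=> x xY; exact: h|exists H].
elim=> [|x s IH] h; first by exists H0.
have [|H FH hH] := IH; first by move=> y ys; apply: h; rewrite in_cons ys orbT.
have [H' FH' H'x] := h x (mem_head _ _).
have [sub|sub] := tot H H' FH FH'.
  by exists H' => // y; rewrite in_cons => /orP[/eqP ->//|/hH/sub].
by exists H => // y; rewrite in_cons => /orP[/eqP ->|/hH//]; exact: sub.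
Qed.

(** By Zorn's lemma there is a maximal removable set [H] that leaves [e]. If a cut avoiding the rest
    separated some of its edges, all edges outside the component of [e] could be removed too. *)
Lemma connected_part F e : evenset F -> F e ->
  exists C, [/\ C_Psi Psi C, C e & C `<=` F].
Proof.
move=> [FE Feven Fcl] Fe.
pose P : set (set (set T)) := [set H | evenset (F `\` H) /\ ~ H e].
have evE X : evenset X -> forall b, cut G b -> finitely_coverable G b ->
    finite_set (X `&` b) /\ oddc (X `&` b) = false.
  by move=> [_ h _] b cb fb; apply/meets_evenlyP/h.
have [H [[eH nHe] maxH]] : exists H, P H /\ forall B, H `<` B -> ~ P B.
  apply: Zorn_bigcup => FF FP tot.
  have [ne|nFF] := pselect (FF !=set0); last first.
    have -> : \bigcup_(X in FF) X = set0.
      by rewrite -subset0 => x [X FX _]; apply: nFF; exists X.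
    by split=> //; rewrite setD0.
  have sub X : FF X -> F `\` \bigcup_(X in FF) X `<=` F `\` X.
    by move=> FX x [Fx nx]; split=> // Xx; apply: nx; exists X.
  have [X0 FX0] := ne; split; last by move=> [X /FP[_ nX]].
  split; first by move=> x [/FE].
    move=> b cb fb; apply/meets_evenlyP.
    have [fF _] := (meets_evenlyP _ _).1 (Feven b cb fb).
    have [||X FX hX] := @chain_finite _ FF (F `&` b `&` \bigcup_(X in FF) X) _ tot ne.
    - exact: finite_setIl.
    - by move=> x [].
    have -> : (F `\` \bigcup_(X in FF) X) `&` b = (F `\` X) `&` b.
      apply/seteqP; split=> x [[Fx nx] bx]; split=> //; split=> //.
        by move=> Xx; apply: nx; exists X.
      by move=> ux; apply: nx; apply: hX.
    by have [eX _] := FP X FX; exact: evE eX b cb fb.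
  move=> w cl; have [[_ _ h] _] := FP X0 FX0; apply: h.
  exact: in_closureS (sub _ FX0) cl.
set C := F `\` H in eH; have [CE Ceven Ccl] := eH.
exists C; split; [|by []|by move=> x []].
split=> // b cb fb [K1 [K2 [cK1 cK2 nK [g1 [Cg1 Gg1] g1K] [g2 [Cg2 Gg2] g2K]]]].
apply: contrapT => nCb.
have {}nCb f : C f -> ~ b f by move=> Cf bf; apply: nCb; exists f.
pose L := del_edges G b.
have [x [y [xy _ eE]]] := edgeE (FE _ Fe).
pose K0 : set T := [set v | linked L x v].
have [Gx Gy] := adjacent_vertex xy.
have cK0 : component L K0 by exists x.
have K0x : K0 x by exact: linked_refl.
have stay f u v : C f -> f u -> f v -> K0 u -> K0 v.
  move=> Cf fu fv K0u; have [a au fE] := edge_end (CE _ Cf) fu.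
  rewrite fE in fv; case: fv => ->; last exact: K0u.
  apply: linked_trans K0u _; have Gu := (adjacent_vertex au).2.
  apply: (@path_linked _ L u [:: a]) => //; rewrite /= andbT; apply/asboolP.
  by rewrite setUC -fE; split; [exact: CE|exact: nCb].
pose C' := C `&` [set f | f `<=` K0].
have inK0 f v : C f -> f v -> K0 v -> f `<=` K0 by move=> Cf fv K0v u fu; exact: stay fv fu K0v.
have [g Cg ng] : exists2 g, C g & ~ C' g.
  have gne g : edges G g -> exists v, g v.
    by move=> /edgeE[u [v [_ _ ->]]]; exists u; left.
  have [E|ne] := pselect (K1 = K0).
    exists g2 => // -[_ sub]; have [v g2v] := gne g2 Gg2.1.
    by apply: nK; rewrite E; apply: component_eq cK0 cK2 (sub _ g2v) (g2K _ g2v).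
  exists g1 => // -[_ sub]; have [v g1v] := gne g1 Gg1.1.
  by apply: ne; apply: component_eq cK1 cK0 (g1K _ g1v) (sub _ g1v).
apply: (maxH (H `|` (C `\` C'))).
  rewrite properEneq; split; last by move=> z; left.
  apply/eqP => E; have : H g by rewrite E; right.
  by case: Cg.
have E' : F `\` (H `|` (C `\` C')) = C'.
  apply/seteqP; split=> [z [Fz nz]|z [Cz sz]].
    have Cz : C z by split=> // Hz; apply: nz; left.
    by apply: contrapT => nC'; apply: nz; right.
  by split; [case: Cz|move=> [Hz|[_]]; [case: Cz|apply]].
have Ce : C e by [].
have C'e : C' e by split=> //; apply: inK0 Ce _ K0x; rewrite eE; left.
split; last by move=> [//|[_]]; apply.
rewrite E'; split; first by move=> f [/CE].
  move=> _ [B [BV Bne Bne' ->]] [S fS covS]; rewrite -/(delta G B) in covS *.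
  have [Sb fSb covb] := fb.
  (* Evenness of [C'] at the cut of [B] is that of [C] at the cut of the part of [B] in [K0]; the
     latter is covered by the covers of [delta G B] and [b] together. *)
  have EB : C' `&` delta G B = C `&` delta G (B `&` K0).
    apply/seteqP; split=> f.
      move=> [[Cf sf] [Gf [u [fu Bu]] [v [fv [Gv nBv]]]]]; split=> //; split=> //.
        by exists u; split=> //; split=> //; exact: sf.
      by exists v; split=> //; split=> // -[].
    move=> [Cf [Gf [u [fu [Bu K0u]]] [v [fv [Gv nv]]]]].
    have sf : f `<=` K0 := inK0 f u Cf fu K0u.
    split; first by split.
    split=> //; [by exists u|exists v; split=> //; split=> // Bv].
    by apply: nv; split=> //; exact: sf.
  apply/meets_evenlyP; rewrite EB; apply: (@even_delta _ G C (B `&` K0) Ceven).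
    by move=> z [/BV].
  exists (S `|` Sb); first exact: finite_vertex_setU.
  move=> f [Gf [u [fu [Bu K0u]]] [v [fv [Gv nv]]]].
  have [bf|nbf] := pselect (b f).
    by have [z [fz Sz]] := covb f bf; exists z; split=> //; right.
  have K0v : K0 v.
    have [a au fE] := edge_end Gf fu; rewrite fE in fv; case: fv => ->; last exact: K0u.
    apply: linked_trans K0u _; have Gu := (adjacent_vertex au).2.
    apply: (@path_linked _ L u [:: a]) => //; rewrite /= andbT; apply/asboolP.
    by rewrite setUC -fE.
  have [|z [fz Sz]] := covS f.
    by split=> //; [exists u|exists v; split=> //; split=> // Bv; apply: nv].
  by exists z; split=> //; left.
move=> w cl; apply: Ccl; apply: in_closureS cl.
by move=> f [].
Qed.

End ConnectedPart.

(** * The tree of regions *)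

Section RegionTree.
Variables (T : choiceType) (G : graph T) (Psi : set (graph_end G)).
Variables (S0 : set T) (s0 : T).
Hypothesis cG : connected_graph G.
Hypothesis uPsi : forall w, Psi w -> undominated w.
Hypothesis fS0 : finite_vertex_set G S0.
Hypothesis S0s : S0 s0.
Implicit Types (K : set T) (w : graph_end G) (n m : nat).

Local Notation nbr := (nbr G).
Local Notation lvl := (lvl S0).

(** Level 0 is the whole graph as a root, hence the shift by one against [lvl]. *)
Definition Lv n : set (set T) :=
  if n is m.+1 then [set lvl m w | w in Psi] else [set vertices G].

Lemma Lv_conn n K : Lv n.+1 K -> [/\ conn G K, finite_set (nbr K) & nbr K !=set0].
Proof.
move=> [w Pw <-]; have [c f] := lvl_conn fS0 n (uPsi Pw); split=> //.
apply: contrapT => nn; have [[u lu] lV _] := c.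
have ns : ~ lvl n w s0.
  move=> ls; have l0 : lvl 0 w s0.
    by elim: n {c f nn lu lV} ls => // n IH /(lvlS fS0 (uPsi Pw)).
  exact: (lvl_S0 fS0 (uPsi Pw) (or_introl l0) S0s).
have [p [_ pp _] lp] := cG.2 u s0 (lV u lu) (fS0.2 _ S0s).
elim: p u lu pp lp => [|y p IH] u lu /=; first by move=> _ E; rewrite E in lu.
move=> /andP[uy pp]; apply: IH => //; apply: contrapT => ny.
by apply: nn; exists y; split=> //; exists u.
Qed.

Lemma Lv_vertices n K : Lv n K -> K `<=` vertices G.
Proof. by case: n => [->//|n /Lv_conn[[]]]. Qed.

Lemma Lv_ne n K : Lv n K -> K !=set0.
Proof. by case: n => [->|n /Lv_conn[[]]//]; exists s0; exact: fS0.2. Qed.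

Lemma Lv_eq n K K' v : Lv n K -> Lv n K' -> K v -> K' v -> K = K'.
Proof.
case: n => [-> ->//|n [w Pw <-] [w' Pw' <-]].
by apply: (lvl_eq fS0); exact: uPsi.
Qed.

Lemma Lv_apart n K K' v : Lv n.+1 K -> Lv n.+1 K' -> K v -> ~ nbr K' v.
Proof.
move=> [w Pw <-] [w' Pw' <-] lv nv.
have [E|/(_ v lv)[]//] := lvl_apart fS0 n (uPsi Pw) (uPsi Pw').
by case: nv; rewrite -E.
Qed.

Lemma Lv_parent n K : Lv n.+1 K -> exists K', [/\ Lv n K', K `<=` K' & nbr K `<=` K'].
Proof.
move=> LK; have LK' := LK; case: LK' => w Pw E; case: n LK E => [|n] LK E.
  exists (vertices G); split=> //; [by have [[]] := Lv_conn LK|exact: nbr_vertices].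
exists (lvl n w); split; rewrite -?E; [by exists w|exact: (lvlS fS0 (uPsi Pw))|].
exact: (lvl_nbr fS0 (uPsi Pw)).
Qed.

Lemma Lv_S0 K v : Lv 1 K -> (K `|` nbr K) v -> ~ S0 v.
Proof. by move=> [w Pw <-]; apply: (lvl_S0 fS0); exact: uPsi. Qed.

Lemma Lv_leave v : vertices G v -> exists N, forall n K, N <= n -> Lv n.+1 K -> ~ K v.
Proof.
move=> Gv; have [N hN] := lvl_leave cG fS0 S0s Gv; exists N => n K Nn [w Pw <-].
by apply: hN => //; exact: uPsi.
Qed.

Lemma Lv_lives n w : Psi w -> exists2 K, Lv n K & lives_in w K.
Proof.
move=> Pw; case: n => [|n]; last first.
  by exists (lvl n w); [exists w|exact: (lvl_lives fS0 n (uPsi Pw))].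
exists (vertices G) => // r /ray_of_end[h _ _].
by exists 0 => // i _; exact: h.
Qed.

Lemma Lv_up n m K : n <= m -> Lv m K -> exists2 K', Lv n K' & K `<=` K'.
Proof.
move=> nm; rewrite -(subnKC nm); elim: (m - n) K => [|d IH] K.
  by rewrite addn0 => LK; exists K.
rewrite addnS => /Lv_parent[K' [/IH[K'' LK'' s] s' _]].
by exists K'' => //; exact: subset_trans s' s.
Qed.

Lemma Lv_below n m K K' v : n <= m -> Lv n K -> Lv m K' -> K v -> K' v -> K' `<=` K.
Proof.
move=> nm LK LK' Kv K'v; have [K'' LK'' s] := Lv_up nm LK'.
by rewrite (Lv_eq LK LK'' Kv (s _ K'v)).
Qed.

Lemma Lv_parent_nbr n K K' : Lv n K -> Lv n.+1 K' -> K' `<=` K -> nbr K' `<=` K.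
Proof.
move=> LK LK' s; have [K'' [LK'' s' nK]] := Lv_parent LK'.
have [v K'v] := Lv_ne LK'.
by rewrite (Lv_eq LK LK'' (s _ K'v) (s' _ K'v)).
Qed.

Lemma Lv_avoid S : finite_vertex_set G S ->
  exists N, forall n K v, N <= n -> Lv n.+1 K -> (K `|` nbr K) v -> ~ S v.
Proof.
move=> [fS SV]; have /choice[N hN] : forall v, exists N, S v ->
    forall n K, N <= n -> Lv n.+1 K -> ~ K v.
  move=> v; have [Sv|nSv] := pselect (S v); last by exists 0.
  by have [N hN] := Lv_leave (SV v Sv); exists N.
have [X SE] := (@finite_fsetP _ S).1 fS.
exists (\max_(v <- X) N v).+1 => -[//|n] K v Nn LK Kv Sv.
have vX : v \in X by have : [set` X] v by [rewrite -SE]; exact.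
have Nv : N v <= n.
  by rewrite ltnS in Nn; apply: leq_trans Nn; apply: (@leq_bigmax_seq _ _ xpredT).
have [K' [LK' s s']] := Lv_parent LK.
by apply: (hN v Sv n K') => //; case: Kv => [/s|/s'].
Qed.

Section Chain.
Variable K : nat -> set T.
Hypothesis LK : forall n, Lv n.+1 (K n).
Hypothesis Ks : forall n, K n.+1 `<=` K n.

Lemma chain_mono n m : n <= m -> K m `<=` K n.
Proof.
move=> nm; rewrite -(subnKC nm); elim: (m - n) => [|d IH]; first by rewrite addn0.
by rewrite addnS => x /Ks /IH.
Qed.

(** Vertices from the boundaries of consecutive regions converge, because every vertex eventually
    leaves the chain. *)
Lemma chain_end : exists w, forall n, lives_in w (K n).
Proof.
have /choice[v hv] : forall n, exists v, nbr (K n.+1) v.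
  by move=> n; have [_ _ [v nv]] := Lv_conn (LK n.+1); exists v.
have vK n : K n (v n).
  exact: (Lv_parent_nbr (LK n) (LK n.+1) (@Ks n) (hv n)).
have [|||w hw] := @end_of_sets _ G v K.
- move=> n; have [[_ _ j] _ _] := Lv_conn (LK n); apply: j => //.
  exact/Ks.
- by move=> n E; have [h _] := hv n; apply: h; rewrite E.
- move=> x; have [Gx|nGx] := pselect (vertices G x); last first.
    by exists 0 => n _ Kx; apply: nGx; exact: Lv_vertices (LK n) _ Kx.
  by have [N hN] := Lv_leave Gx; exists N => n Nn; exact: hN Nn (LK n).
exists w => n; have [c f _] := Lv_conn (LK n); have fS := finite_nbr_set f.
have [N hN] := hw _ fS; pose m := maxn N n.
have Em : end_component (nbr (K n)) w (v m) by apply: hN; rewrite leq_maxl.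
have Km : K n (v m) by apply: (@chain_mono n m (leq_maxr _ _)).
by rewrite (component_eq (region_comp c) (ecompP w fS).1 Km Em); exact: (ecompP w fS).2.
Qed.

Lemma chain_sub S w : finite_vertex_set G S -> (forall n, lives_in w (K n)) ->
  exists N, forall n, N <= n -> K n `<=` end_component S w.
Proof.
move=> fS lw; have [N hN] := Lv_avoid fS; exists N => n Nn.
have [c _ _] := Lv_conn (LK n).
apply: (conn_sub_ecomp fS c) => [v Kv|]; first by apply: hN Nn (LK n) _; left.
exact: lives_meet (lw n) (ecompP w fS).2.
Qed.

Lemma chain_unique w w' : (forall n, lives_in w (K n)) -> (forall n, lives_in w' (K n)) ->
  w = w'.
Proof.
move=> lw lw'; apply: end_ext => S fS.
have [N hN] := chain_sub fS lw; have [N' hN'] := chain_sub fS lw'.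
have [[[u Ku] _ _] _ _] := Lv_conn (LK (maxn N N')).
apply: component_eq (ecompP w fS).1 (ecompP w' fS).1 (hN _ _ u Ku) (hN' _ _ u Ku).
  exact: leq_maxl.
exact: leq_maxr.
Qed.

End Chain.

Definition home v n K := [/\ Lv n K, K v & forall K', Lv n.+1 K' -> ~ K' v].

Lemma home_exists v : vertices G v -> exists n K, home v n K.
Proof.
move=> Gv; have [N hN] := Lv_leave Gv.
have ex : exists n, `[< forall K, Lv n.+1 K -> ~ K v >].
  by exists N; apply/asboolP => K; exact: hN.
case: (ex_minnP ex) => -[|n] /asboolP hn min.
  by exists 0, (vertices G).
have : ~ forall K, Lv n.+1 K -> ~ K v.
  by move=> h; have := min n (asboolT h); rewrite ltnn.
move=> h; have [K [LK Kv]] : exists K, Lv n.+1 K /\ K v.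
  apply: contrapT => n'; apply: h => K LK Kv; apply: n'; by exists K.
by exists n.+1, K.
Qed.

Lemma home_unique v n K m K' : home v n K -> home v m K' -> n = m /\ K = K'.
Proof.
move=> [LK Kv h] [LK' K'v h'].
have En : n = m.
  case: (ltngtP n m) => // nm.
    have [K'' LK'' s] := Lv_up nm LK'; case: (h K'' LK''); exact: s.
  have [K'' LK'' s] := Lv_up nm LK; case: (h' K'' LK''); exact: s.
by subst m; split=> //; exact: (Lv_eq LK LK' Kv K'v).
Qed.

(** Every edge lies in a torso, and the level of this torso is unique; this fixes the round of the
    game in which the edge may be used. *)
Definition torso n K : set (set T) := [set e | touching G K e /\
  forall K', Lv n.+1 K' -> ~ touching G K' e].

Lemma torso_exists e : edges G e -> exists n K, Lv n K /\ torso n K e.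
Proof.
move=> Ge; have [u [v [uv _ eE]]] := edgeE Ge; have [Gu Gv] := adjacent_vertex uv.
have [N hN] := Lv_leave Gu; have [N' hN'] := Lv_leave Gv.
have ex : exists n, `[< forall K, Lv n.+1 K -> ~ touching G K e >].
  exists (maxn N N'); apply/asboolP => K LK [_ [z]]; rewrite eE => -[[->|->]].
    by apply: hN LK; exact: leq_maxl.
  by apply: hN' LK; exact: leq_maxr.
case: (ex_minnP ex) => -[|n] /asboolP hn min.
  exists 0, (vertices G); split=> //; split=> //; split=> //.
  by exists u; split=> //; rewrite eE; left.
have : ~ forall K, Lv n.+1 K -> ~ touching G K e.
  by move=> h; have := min n (asboolT h); rewrite ltnn.
move=> h; have [K [LK tK]] : exists K, Lv n.+1 K /\ touching G K e.
  apply: contrapT => n'; apply: h => K LK tK; apply: n'; by exists K.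
by exists n.+1, K.
Qed.

Lemma torso_end n K e u : torso n K e -> e u -> K u \/ nbr K u.
Proof.
move=> [[Ge [z [ez Kz]]] _] eu; have [Ku|nKu] := pselect (K u); [by left|right].
split=> //; exists z => //; have [a au eE] := edge_end Ge eu.
by rewrite eE in ez; case: ez => E; rewrite E in Kz *.
Qed.

Lemma torso_level n K m K' e : Lv n K -> Lv m K' -> torso n K e -> torso m K' e -> n = m.
Proof.
move=> LK LK' [[Ge t] h] [[_ t'] h']; case: (ltngtP n m) => // nm.
  have [K'' LK'' s] := Lv_up nm LK'; case: (h K'' LK''); split=> //.
  by case: t' => z [ez /s K''z]; exists z.
have [K'' LK'' s] := Lv_up nm LK; case: (h' K'' LK''); split=> //.
by case: t => z [ez /s K''z]; exists z.
Qed.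

Lemma home_torso n K e u : Lv n K -> torso n K e -> e u -> K u -> home u n K.
Proof.
move=> LK [[Ge _] h] eu Ku; split=> // K' LK' K'u; apply: (h K' LK'); split=> //.
by exists u.
Qed.

Lemma home_nbr n K K' u : Lv n K -> Lv n.+1 K' -> K' `<=` K -> nbr K' u -> home u n K.
Proof.
move=> LK LK' s nu; split=> //; first exact: (Lv_parent_nbr LK LK' s).
by move=> K'' LK'' /(Lv_apart LK'' LK'); exact.
Qed.

End RegionTree.

Section Koenig.
(** The branch consists of the elements that are iterated images of [b m] for almost all [m] with
    respect to an ultrafilter. *)
Lemma koenig (X : Type) (A : nat -> set X) (f : X -> X) :
  (forall n, finite_set (A n)) -> (forall n, A n !=set0) ->
  (forall n x, A n.+1 x -> A n (f x)) ->
  exists a : nat -> X, forall n, A n (a n) /\ f (a n.+1) = a n.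
Proof.
move=> fA nA pA; have /choice[b hb] := nA.
have [U [UU FU]] := ultraFilterLemma (eventually_filter : ProperFilter \oo).
have UF : ProperFilter U := ultra_proper.
pose B n x := [set m | n <= m /\ iter (m - n) f (b m) = x].
have itA n m : n <= m -> A n (iter (m - n) f (b m)).
  move=> nm; have : forall d x, A (d + n) x -> A n (iter d f x).
    elim=> [//|d IH] x; rewrite addSn iterSr => /pA; exact: IH.
  by apply; rewrite subnK.
have /choice[a ha] : forall n, exists x, A n x /\ U (B n x).
  move=> n; have [|x Ax Ux] := @ultra_finite _ _ U _ (B n) UU (fA n); last by exists x.
  apply: FU; exists n => // m /= nm; exists (iter (m - n) f (b m)) => //.
  exact: itA.
exists a => n; have [An Un] := ha n; have [_ Un1] := ha n.+1; split=> //.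
have [m [[nm E] [nm1 E1]]] := filter_ex (filterI Un Un1).
by rewrite -E -E1 -iterS -subSn // subSS.
Qed.
End Koenig.

(** * Chains of regions and Borel sets of ends *)

Section EndGame.
Variables (T : choiceType) (G : graph T) (Psi : set (graph_end G)).
Variables (S0 : set T) (s0 : T).
Hypothesis cG : connected_graph G.
Hypothesis uPsi : forall w, Psi w -> undominated w.
Hypothesis fS0 : finite_vertex_set G S0.
Hypothesis S0s : S0 s0.

(** A jump [(K, a, b)] is the promise of a connection from [a] to [b] through the region [K]. *)
Definition jump := (set T * T * T)%type.
Implicit Types (j : jump) (y : nat -> jump) (w : graph_end G).
Definition jreg j : set T := j.1.1.
Definition jsrc j : T := j.1.2.
Definition jtgt j : T := j.2.

Local Notation Lv := (Lv Psi S0).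

Definition region_chain y := forall n,
  Lv n.+1 (jreg (y n.+1)) /\ jreg (y n.+2) `<=` jreg (y n.+1).

Definition converges (Q : set (graph_end G)) y := region_chain y /\
  exists2 w, Q w & forall n, lives_in w (jreg (y n.+1)).

Lemma region_chain_borel : borel_seq region_chain.
Proof.
have -> : region_chain = \bigcap_n [set y | Lv n.+1 (jreg (y n.+1)) /\
    jreg (y n.+2) `<=` jreg (y n.+1)].
  by apply/seteqP; split=> [y h n _|y h n]; exact: h.
apply: borel_seq_bigcap => n; apply: (@borel_seq_cylinder _ n.+3) => y y' E /=.
by rewrite !E // ltnW.
Qed.

(** The map from chains of regions to ends is continuous: the end of a chain lies in a basic open
    set as soon as some region is contained in the component. Complements are handled by existence
    and uniqueness of the end of a chain. *)
Lemma converges_borel Q : borel_ends Q -> borel_seq (converges Q).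
Proof.
move: Q; apply: smallest_sub.
  split.
  - have -> : converges set0 = region_chain `&` ~` region_chain.
      by apply/seteqP; split=> y [// _ [w []]].
    by apply: borel_seqI; [|apply: borel_seqC]; exact: region_chain_borel.
  - move=> Q hQ /=; have -> : converges (setT `\` Q) = region_chain `&` ~` converges Q.
      apply/seteqP; split=> y [cy].
        move=> [w [_ nQ] lw]; split=> // -[_ [w' Qw' lw']]; apply: nQ.
        by rewrite (@chain_unique _ _ _ _ _ cG uPsi fS0 S0s (fun n => jreg (y n.+1))
            (fun n => (cy n).1) w w' lw lw').
      move=> nQ; split=> //.
      have [w lw] := @chain_end _ _ _ _ _ cG uPsi fS0 S0s (fun n => jreg (y n.+1))
            (fun n => (cy n).1) (fun n => (cy n).2).
      by exists w => //; split=> // Qw; apply: nQ; split=> //; exists w.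
    by apply: borel_seqI; [exact: region_chain_borel|exact: borel_seqC].
  - move=> Q hQ /=; have -> : converges (\bigcup_k Q k) = \bigcup_k converges (Q k).
      apply/seteqP; split=> y; first by move=> [cy [w [k _ Qw] lw]]; exists k => //; split=> //; exists w.
      by move=> [k _ [cy [w Qw lw]]]; split=> //; exists w => //; exists k.
    exact: borel_seq_bigcup.
move=> Q [D' sD <-] /=.
have -> : converges (\bigcup_(i in D') end_base_open i) = region_chain `&`
    \bigcup_n [set y | exists2 SC, D' SC & jreg (y n.+1) `<=` SC.2].
  apply/seteqP; split=> y [cy].
    move=> [w [SC DSC wSC] lw]; split=> //; have [fS cS] := sD _ DSC.
    have [N hN] := @chain_sub _ _ _ _ _ cG uPsi fS0 S0s (fun n => jreg (y n.+1))
      (fun n => (cy n).1) _ w fS lw.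
    exists N => //; exists SC => //; rewrite -(ecomp_eq fS cS wSC).
    exact: hN.
  move=> [n _ [SC DSC sub]]; split=> //.
  have [w lw] := @chain_end _ _ _ _ _ cG uPsi fS0 S0s (fun n => jreg (y n.+1))
            (fun n => (cy n).1) (fun n => (cy n).2).
  by exists w => //; exists SC => //; exact: (lives_sub (lw n) sub).
apply: borel_seqI; first exact: region_chain_borel.
apply: borel_seq_bigcup => n; apply: (@borel_seq_cylinder _ n.+2) => y y' E /=.
by rewrite !E.
Qed.

End EndGame.

(** * The game on an edge *)

Lemma oddc_count (U : choiceType) (L : seq U) (Q : set U) :
  oddc [set e | odd (count_mem e L) /\ Q e] = \big[addb/false]_(e <- L) `[< Q e >].
Proof.
elim: L => [|a L IH].
  by rewrite big_nil -[RHS](@oddc0 U); congr oddc; apply/seteqP; split=> // e [].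
rewrite big_cons -IH.
have fL : finite_set [set e | odd (count_mem e L) /\ Q e].
  apply: sub_finite_set (finite_seq L) => e [o _] /=.
  by apply: contraTT o => /count_memPn ->.
have <- : oddc [set e | e = a /\ Q e] = `[< Q a >].
  have [Qa|nQa] := pselect (Q a).
    rewrite asboolT // -(@oddc1 U a); congr oddc; apply/seteqP; split=> e /=; first by case.
    by move=> ->.
  rewrite asboolF // -(@oddc0 U); congr oddc; apply/seteqP; split=> e //= [->].
  by move/nQa.
apply: oddc_xor => //.
  by apply: sub_finite_set (finite_set1 a) => e [].
have [tt ff] : is_true true /\ ~ is_true false by [].
move=> e /=; rewrite oddD; have q := pselect (Q e).
by rewrite eq_sym; case: eqP => ea /=; case: (odd _) => /=; tauto.
Qed.

Section EdgeGame.
Variables (T : choiceType) (G : graph T) (Psi : set (graph_end G)).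
Variables (P : set (set T)) (x y : T).
Hypothesis cG : connected_graph G.
Hypothesis uPsi : forall w, Psi w -> undominated w.
Hypothesis axy : adjacent G x y.
Hypothesis PE : P `<=` edges G.
Hypothesis nP : ~ P [set x; y].

Local Notation jump := (jump T).
Local Notation S0 := [set x; y].
Local Notation Lv := (Lv Psi S0).
Local Notation torso := (torso Psi S0).
Local Notation home := (home Psi S0).
Local Notation nbr := (nbr G).

Lemma ends_finite : finite_vertex_set G S0.
Proof.
have [Gx Gy] := adjacent_vertex axy; split; first by rewrite finite_setU.
by move=> z [->|->].
Qed.
Local Notation fS0 := ends_finite.

Lemma ends_mem : S0 x. Proof. by left. Qed.
Local Notation S0s := ends_mem.

Definition side (A : set T) v : bool := `[< A v >].
Definition cross (A : set T) e : bool := `[< delta G A e >].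

Lemma crossE A u v : adjacent G u v -> cross A [set u; v] = side A u (+) side A v.
Proof.
move=> uv; rewrite /cross /side (propext (deltaP A uv)).
have [Au|nAu] := pselect (A u); have [Av|nAv] := pselect (A v).
- by rewrite (asboolT Au) (asboolT Av) asboolF //; tauto.
- by rewrite (asboolT Au) (asboolF nAv) asboolT //; tauto.
- by rewrite (asboolF nAu) (asboolT Av) asboolT //; tauto.
- by rewrite (asboolF nAu) (asboolF nAv) asboolF //; tauto.
Qed.

Definition cmove := (seq (set T) * seq jump)%type.
Implicit Types (m : cmove) (j : jump) (h : seq (cmove * jump)) (n : nat) (e A K : set T).

(** The last clause says that edges and jumps together have the boundary [jsrc j + jtgt j] modulo 2,
    tested on all vertex sets because this is how cuts see it. *)
Definition legal n j m := [/\ forall e, e \in m.1 -> P e /\ torso n (jreg j) e,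
  forall i, i \in m.2 -> [/\ Lv n.+1 (jreg i), jreg i `<=` jreg j,
    nbr (jreg i) (jsrc i) & nbr (jreg i) (jtgt i)]
  & forall A, side A (jsrc j) (+) side A (jtgt j) =
      \big[addb/false]_(e <- m.1) cross A e (+)
      \big[addb/false]_(i <- m.2) (side A (jsrc i) (+) side A (jtgt i))].

Definition chosen m j : Prop := j \in m.2.

Definition start : jump := (vertices G, x, y).

Local Notation state := (@game_state cmove jump start).

(** * From a strategy of the first player to a circuit *)

Section CircuitSide.
Variable f : seq (cmove * jump) -> cmove.
Hypothesis hf : forall h, follows_left chosen f h -> legal (size h) (state h) (f h).
Hypothesis hW : forall z, (forall n, follows_left chosen f (rounds z n)) ->
  converges Psi S0 Psi (fun n => state (rounds z n)).

(** All histories consistent with [f], listed with multiplicity; the list is finite because a move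
    offers finitely many jumps. *)
Fixpoint histories n : seq (seq (cmove * jump)) :=
  if n is k.+1 then [seq (f h, j) :: h | h <- histories k, j <- (f h).2] else [:: [::]].

Lemma historiesP n h : h \in histories n -> size h = n /\ follows_left chosen f h.
Proof.
elim: n h => [|n IH] h /=; first by rewrite inE => /eqP ->.
by move=> /allpairsPdep[h' [j [/IH[<- c] jf ->]]].
Qed.

Lemma histories_behead n h : h \in histories n.+1 -> behead h \in histories n.
Proof. by move=> /allpairsPdep[h' [j [hh' jf ->]]]. Qed.

Lemma histories_legal n h : h \in histories n -> legal n (state h) (f h).
Proof. by move=> /historiesP[<- /hf]. Qed.

Lemma histories_state n h : h \in histories n.+1 -> [/\ Lv n.+1 (jreg (state h)),
  jreg (state h) `<=` jreg (state (behead h)), nbr (jreg (state h)) (jsrc (state h))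
  & nbr (jreg (state h)) (jtgt (state h))].
Proof.
move=> /allpairsPdep[h' [j [/histories_legal[_ hj _] jf ->]]] /=.
exact: hj.
Qed.

Lemma histories_Lv n h : h \in histories n -> Lv n (jreg (state h)).
Proof. by case: n => [|n /histories_state[]//]; rewrite inE => /eqP ->. Qed.

Definition used n : seq (set T) := flatten [seq (f h).1 | h <- histories n].

Lemma usedP n e : e \in used n -> P e /\ exists h, [/\ h \in histories n &
  torso n (jreg (state h)) e].
Proof.
move=> /flattenP[s /mapP[h hh ->] es]; have [he _ _] := histories_legal hh.
by have [Pe te] := he e es; split=> //; exists h.
Qed.

Lemma used_level n k e : e \in used n -> e \in used k -> n = k.
Proof.
move=> /usedP[_ [h [/histories_Lv L t]]] /usedP[_ [h' [/histories_Lv L' t']]].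
exact: (torso_level cG uPsi fS0 S0s L L' t t').
Qed.

Fixpoint used_below n : seq (set T) :=
  if n is k.+1 then used_below k ++ used k else [::].

Lemma used_belowP n e : e \in used_below n -> exists2 k, k < n & e \in used k.
Proof.
elim: n => // n IH /=; rewrite mem_cat => /orP[/IH[k kn ek]|en]; last by exists n.
by exists k => //; exact: ltnW.
Qed.

(** Replacing every open jump by the answer of [f] preserves the boundary modulo 2. *)
Lemma balance n A : side A x (+) side A y =
  \big[addb/false]_(e <- used_below n) cross A e (+)
  \big[addb/false]_(h <- histories n)
     (side A (jsrc (state h)) (+) side A (jtgt (state h))).
Proof.
elim: n => [|n IH]; first by rewrite /= big_nil big_seq1.
rewrite IH /= big_cat -addbA; congr addb.
rewrite /used big_flatten big_map big_allpairs_dep -big_split /=.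
by apply: eq_big_seq => h /histories_legal[_ _ ->].
Qed.

(** The sum modulo 2 of all moves of [f]. An edge occurs in one round only, so a single [n]
    decides. *)
Definition parity_set : set (set T) := [set e | exists n, odd (count_mem e (used n))].

Lemma odd_mem (U : eqType) (e : U) (s : seq U) : odd (count_mem e s) -> e \in s.
Proof. by apply: contraTT => /count_memPn ->. Qed.

Lemma parity_sub : parity_set `<=` P.
Proof. by move=> e [n /odd_mem /usedP[]]. Qed.

Lemma count_below n k e : k < n -> e \in used k ->
  count_mem e (used_below n) = count_mem e (used k).
Proof.
elim: n => // n IH; rewrite ltnS leq_eqVlt /= count_cat => /orP[/eqP ->|kn] ek.
  rewrite (count_memPn _) //; apply: contraTN isT => /used_belowP[i ik ei].
  by move: ik; rewrite (used_level ei ek) ltnn.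
rewrite IH // [X in _ + X](count_memPn _) ?addn0 //.
by apply: contraTN kn => en; rewrite (used_level ek en) ltnn.
Qed.

Lemma parity_below n e : (forall k, n <= k -> e \notin used k) ->
  parity_set e <-> odd (count_mem e (used_below n)).
Proof.
move=> hn; split=> [[k o]|o].
  have ek := odd_mem o; rewrite (@count_below n k) //.
  by rewrite ltnNge; apply: contraTN ek => /hn.
have /used_belowP[k kn ek] := odd_mem o; exists k.
by rewrite -(count_below kn ek).
Qed.

(** From some level on, no edge touching a region crosses the cut. The jumps still open then have
    both ends on one side, and [balance] involves only the edges used so far. *)
Lemma parity_even A S : A `<=` vertices G -> finite_vertex_set G S ->
  (forall e, delta G A e -> e `&` S !=set0) ->
  finite_set (parity_set `&` delta G A) /\
  oddc (parity_set `&` delta G A) = side A x (+) side A y.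
Proof.
move=> AV fS cov; have [N hN] := Lv_avoid cG uPsi fS0 S0s fS.
have nt n K e : N <= n -> Lv n.+1 K -> touching G K e -> ~ delta G A e.
  move=> Nn LK [Ge [z [ez Kz]]] /cov[s [es Ss]]; apply: (hN n K s Nn LK _ Ss).
  have [Ks|nKs] := pselect (K s); [by left|right]; split=> //; exists z => //.
  have [u us eE] := edge_end Ge es.
  by move: ez; rewrite eE => -[->//|E]; case: nKs; rewrite -E.
have nc e k : N < k -> e \in used k -> ~ delta G A e.
  case: k => // k Nk /usedP[_ [h [/histories_Lv L [t _]]]].
  exact: nt L t.
have nb h : h \in histories N.+1 ->
    side A (jsrc (state h)) (+) side A (jtgt (state h)) = false.
  move=> /histories_state[L _ [n1 [u1 K1 a1]] [n2 [u2 K2 a2]]].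
  have [[_ _ j] _ _] := Lv_conn cG uPsi fS0 S0s L.
  have st a b : jreg (state h) a -> adjacent G a b -> side A a = side A b.
    move=> Ka ab; have := crossE A ab; rewrite /cross asboolF.
      by case: (side A a); case: (side A b).
    by apply: (nt N _ _ (leqnn _) L); split; [exact/asboolP|exists a; split=> //; left].
  rewrite -(st _ _ K1 a1) -(st _ _ K2 a2).
  have E : side A u1 = side A u2.
    apply: (@joined_ind _ _ (fun v => side A u1 = side A v) _ _ _ (j _ _ K1 K2)) => //.
    by move=> a b Ka _ ab ->; exact: st.
  by rewrite E addbb.
have PE' e : (parity_set `&` delta G A) e <->
    odd (count_mem e (used_below N.+1)) /\ delta G A e.
  split=> -[p d]; split=> //; apply/(parity_below (n := N.+1)) => // k Nk;
    by apply/negP => ek; exact: (nc e k Nk ek).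
have -> : parity_set `&` delta G A =
    [set e | odd (count_mem e (used_below N.+1)) /\ delta G A e].
  by apply/seteqP; split=> e /PE'.
split.
  by apply: sub_finite_set (finite_seq (used_below N.+1)) => e [/odd_mem].
rewrite oddc_count (balance N.+1) [X in _ (+) X]big1_seq ?addbF //.
Qed.

(** Edges near [w] are used by histories whose regions contain [w]. Koenig's lemma turns these into
    a play, which [f] wins, and the chain of regions has no other end. *)
Lemma parity_closure w : in_closure (parity_set `|` [set S0]) w -> Psi w.
Proof.
move=> cl; have lives n : exists2 h, h \in histories n & lives_in w (jreg (state h)).
  (* A finite set that excludes all edges used before round [n] and confines the component of [w] to
     one region of that round. *)
  pose S := (\bigcup_(h in [set` histories n]) nbr (jreg (state h))) `|`
    ((\bigcup_(e in [set` used_below n]) e) `|` S0).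
  have fS : finite_vertex_set G S.
    apply: finite_vertex_setU; last apply: finite_vertex_setU; last exact: fS0.
      apply: finite_vertex_bigcup; first exact: finite_seq.
      move=> h /=; case: n {S} => [|n].
        rewrite inE => /eqP -> /=; suff -> : nbr (jreg start) = set0 by split.
        by rewrite -subset0 => v nv; case: (nv) => nG _; apply: nG; exact: nbr_vertices nv.
      by move=> /histories_state[/(Lv_conn cG uPsi fS0 S0s)[_ fn _] _ _ _]; exact: finite_nbr_set.
    apply: finite_vertex_bigcup; first exact: finite_seq.
    move=> e /= /used_belowP[k _ /usedP[/PE Ge _]].
    have [u [v [uv _ ->]]] := edgeE Ge; have [Gu Gv] := adjacent_vertex uv.
    by split; [rewrite finite_setU|move=> z [->|->]].
  have [e [[k o]|->] [v [ev Cv]]] := cl _ fS; last first.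
    by have [_ nS _] := ecomp_conn w fS; case: (nS v Cv); right; right.
  have [_ nS _] := ecomp_conn w fS.
  have ek := odd_mem o; have nk : n <= k.
    rewrite leqNgt; apply/negP => kn; apply: (nS v Cv); right; left; exists e => //=.
    by apply: odd_mem; rewrite (count_below kn ek).
  have [_ [h' [hh' t]]] := usedP ek.
  have [h hh sub] : exists2 h, h \in histories n & jreg (state h') `<=` jreg (state h).
    move: h' hh' {t ek o}; rewrite -(subnKC nk); elim: (k - n) => [|d IH] h'.
      by rewrite addn0; exists h'.
    rewrite addnS => hh'; have [h hh sub] := IH _ (histories_behead hh').
    exists h => //; have [_ s _ _] := histories_state hh'.
    exact: subset_trans s sub.
  exists h => //; have Kv : jreg (state h) v.
    have [/sub//|[_ [u Ku uv]]] := torso_end t ev.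
    apply: contrapT => nKv; apply: (nS v Cv); left; exists h => //=.
    by split=> //; exists u => //; exact: sub.
  apply: (lives_sub (ecompP w fS).2); have [cC _ _] := ecomp_conn w fS.
  apply: (conn_sub cC) => [u Cu nu|]; last by exists v.
  by apply: (nS u Cu); left; exists h.
pose A n : set (seq (cmove * jump)) :=
  [set h | h \in histories n /\ lives_in w (jreg (state h))].
have [||n h [hh lw]|a ha] := @koenig _ A behead.
- by move=> n; apply: sub_finite_set (finite_seq (histories n)) => h [].
- by move=> n; have [h hh lh] := lives n; exists h.
- split; first exact: histories_behead.
  by have [_ s _ _] := histories_state hh; exact: lives_sub lw s.
have sa n : size (a n) = n by have [[/historiesP[]]] := ha n.
pose z n := head (f [::], start) (a n.+1).
have za n : rounds z n = a n.
  elim: n => [|n IH] /=; first by apply/esym/size0nil; exact: sa.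
  have [_ E] := ha n; rewrite IH -E /z.
  by case: (a n.+1) (sa n.+1).
have [|cz [w' Pw' lw']] := hW (z := z).
  by move=> n; rewrite za; have [[/historiesP[]]] := ha n.
have lw n : lives_in w (jreg (state (rounds z n.+1))).
  by rewrite za; have [[]] := ha n.+1.
by rewrite (chain_unique cG uPsi fS0 S0s (K := fun n => jreg (state (rounds z n.+1)))
   (fun n => (cz n).1) lw lw').
Qed.

(** The edge itself compensates the odd parity of [parity_set] at the cuts separating [x] from
    [y]. *)
Lemma circuit_exists : exists C, [/\ C_Psi Psi C, C S0 & C `<=` P `|` [set S0]].
Proof.
have Ge : edges G S0 by exact/asboolP.
have [||C [CC Ce Cs]] := @connected_part _ _ Psi (parity_set `|` [set S0]) S0.
- split=> [e [/parity_sub/PE//|->//]|b cb [S fS cov]|w]; last exact: parity_closure.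
  case: cb => A [AV _ _ bE]; have bd : b = delta G A by rewrite bE.
  have [|fF oF] := parity_even AV fS; first by rewrite -bd.
  apply/meets_evenlyP; rewrite bd setIUl; have f1 : finite_set ([set S0] `&` delta G A).
    by apply: sub_finite_set (finite_set1 S0) => e [].
  split; first by rewrite finite_setU.
  rewrite oddcU //; last by move=> e [/parity_sub Pe _] [E _]; apply: nP; rewrite -E.
  rewrite oF -crossE // /cross.
  have [d|nd] := pselect (delta G A S0).
    have -> : [set S0] `&` delta G A = [set S0].
      by apply/seteqP; split=> [e []//|e ->]; split.
    by rewrite oddc1 asboolT.
  have -> : [set S0] `&` delta G A = set0.
    by rewrite -subset0 => e [->].
  by rewrite oddc0 asboolF.
- by right.
exists C; split=> // e /Cs[/parity_sub|]; by [left|right].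
Qed.

End CircuitSide.

(** * From a strategy of the second player to a cut *)

Section CutSide.
Variable g : seq (cmove * jump) -> cmove -> jump.
Hypothesis hg : forall h m, follows_right start legal g h ->
  legal (size h) (state h) m -> chosen m (g h m).
Hypothesis hW : forall z, (forall n, follows_right start legal g (rounds z n)) ->
  ~ converges Psi S0 Psi (fun n => state (rounds z n)).

(* At each stage one history is selected for every state that the strategy can
   reach, so that finitely many histories lie over each region. *)
Fixpoint selected n : set (seq (cmove * jump)) :=
  if n is k.+1 then [set h | h = pick_in [::] [set h' | exists h'' m,
      [/\ selected k h'', legal k (state h'') m & h' = (m, state h) :: h'' /\ g h'' m = state h]]
      /\ exists h' m, [/\ selected k h', legal k (state h') m & h = (m, g h' m) :: h']]
  else [set [::]].

Definition reached n j := exists2 h, selected n h & state h = j.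

Lemma selectedP n h : selected n h -> size h = n /\ follows_right start legal g h.
Proof.
elim: n h => [|n IH] h /=; first by move=> ->.
by move=> [_ [h' [m [/IH[<- fh'] l ->]]]].
Qed.

Lemma selected_behead n h : selected n.+1 h -> selected n (behead h).
Proof. by move=> [_ [h' [m [sh' l ->]]]]. Qed.

Lemma selected_unique n h h' : selected n h -> selected n h' -> state h = state h' -> h = h'.
Proof.
case: n => [-> ->//|n /= [E1 _] [E2 _] E].
by rewrite E in E1; rewrite E1 [RHS]E2.
Qed.

Lemma selected_state n h : selected n.+1 h -> [/\ Lv n.+1 (jreg (state h)),
  jreg (state h) `<=` jreg (state (behead h)), nbr (jreg (state h)) (jsrc (state h))
  & nbr (jreg (state h)) (jtgt (state h))].
Proof.
move=> [_ [h' [m [sh' l ->]]]] /=; have [sz fr] := selectedP sh'.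
have [_ hj _] := l; apply: hj; apply: hg => //.
by rewrite sz.
Qed.

Lemma reached_next n j m : reached n j -> legal n j m ->
  exists2 i, i \in m.2 & reached n.+1 i.
Proof.
move=> [h sh <-] l; have [sz fr] := selectedP sh.
exists (g h m); first by apply: hg => //; rewrite sz.
pose c := [set h' | exists h'' m', [/\ selected n h'', legal n (state h'') m' &
   h' = (m', g h m) :: h'' /\ g h'' m' = g h m]].
have [|h'' [m' [sh'' l'' [E E']]]] := @pick_inP _ [::] ((m, g h m) :: h) c.
  by exists h, m.
exists (pick_in [::] c); last by rewrite E.
split; last by exists h'', m'; rewrite E' E.
by have -> : state (pick_in [::] c) = g h m by rewrite E.
Qed.

(** A connection inside [K] built from edges of [P] and jumps that are never reached against [g].
    This is the reachability relation from which the cut is read off. *)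
Definition convey n K u v := exists2 m, legal n (K, u, v) m &
  forall i, i \in m.2 -> ~ reached n.+1 i.

Lemma convey_refl n K u : convey n K u u.
Proof. by exists ([::], [::]) => //; split=> // A; rewrite addbb !big_nil. Qed.

Lemma convey_trans n K u v t : convey n K u v -> convey n K v t -> convey n K u t.
Proof.
move=> [m [m1 m2 m3] mr] [m' [m1' m2' m3'] mr'].
exists (m.1 ++ m'.1, m.2 ++ m'.2); last first.
  by move=> i /=; rewrite mem_cat => /orP[/mr|/mr'].
split=> [e|i|A] /=.
- by rewrite mem_cat => /orP[/m1|/m1'].
- by rewrite mem_cat => /orP[/m2|/m2'].
- rewrite !big_cat /= addbACA -m3 -m3' /=.
  by rewrite /jsrc /jtgt /= -addbA addKb.
Qed.

(** At a reached state the strategy answers every legal move with one of its jumps, which is then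
    reached as well. *)
Lemma convey_reached n K u v : convey n K u v -> ~ reached n (K, u, v).
Proof. by move=> [m l nr] r; have [i im ri] := reached_next r l; exact: nr ri. Qed.

Lemma convey_jump n K K' u v : Lv n.+1 K' -> K' `<=` K -> nbr K' u -> nbr K' v ->
  ~ reached n.+1 (K', u, v) -> convey n K u v.
Proof.
move=> L s nu nv nr; exists ([::], [:: (K', u, v)]); last by move=> i; rewrite inE => /eqP ->.
by split=> // [i|A]; [rewrite inE => /eqP ->|rewrite big_nil big_seq1].
Qed.

Lemma convey_edge n K u v : P [set u; v] -> torso n K [set u; v] -> convey n K u v.
Proof.
move=> Puv t; exists ([:: [set u; v]], [::]) => //.
split=> // [e|A]; first by rewrite inE => /eqP ->.
by rewrite big_seq1 big_nil addbF crossE //; exact/asboolP/PE.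
Qed.

(* On a region with constant boundary labels the label is propagated to the
   whole region; this keeps the ends of Psi out of the closure of the cut. *)
Fixpoint label n : set T := if n is k.+1 then [set v | exists K, [/\ Lv k.+1 K, K v &
    nbr K `<=` label k \/ exists a, [/\ nbr K a, label k a & convey k.+1 K a v]]]
  else convey 0 (vertices G) x.

Definition labelled : set T := [set v | exists n K, home v n K /\ label n v].

Definition region_label n K u := nbr K `<=` label n \/
  exists a, [/\ nbr K a, label n a & convey n.+1 K a u].

Lemma labelledE v n K : home v n K -> labelled v <-> label n v.
Proof.
move=> hv; split=> [[k [K' [hv' l]]]|l]; last by exists n, K.
by have [<- _] := home_unique cG uPsi fS0 S0s hv' hv.
Qed.

Lemma label_next n K v : Lv n.+1 K -> K v -> label n.+1 v <-> region_label n K v.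
Proof.
move=> L Kv; split=> [[K' [L' K'v h]]|h]; last by exists K.
by rewrite (Lv_eq uPsi fS0 L L' Kv K'v).
Qed.

(** An unreached jump through [K] is by itself a move in the parent region, and there labels pass
    along it. *)
Lemma label_compat n K a b : Lv n.+1 K -> nbr K a -> nbr K b ->
  ~ reached n.+1 (K, a, b) -> label n a -> label n b.
Proof.
move=> L na nb nr; have [K' [L' s nK']] := Lv_parent cG uPsi fS0 S0s L.
have c := convey_jump L s na nb nr.
case: n L L' nr c => [|n] L L' nr c.
  by rewrite L' in c; move=> /= /convey_trans; apply.
rewrite !(label_next L') //; [|exact: nK'..].
by move=> [h|[d [nd ld cd]]]; [left|right; exists d; split=> //; exact: convey_trans c].
Qed.

Lemma region_labelE n K u : Lv n.+1 K -> home u n.+1 K \/ nbr K u ->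
  labelled u <-> region_label n K u.
Proof.
move=> L [hu|nu].
  by rewrite (labelledE hu); apply: label_next => //; case: hu.
have [K' [L' s nK']] := Lv_parent cG uPsi fS0 S0s L.
rewrite (labelledE (home_nbr cG uPsi fS0 S0s L' L s nu)); split=> [lu|].
  by right; exists u; split=> //; exact: convey_refl.
move=> [h|[a [na la c]]]; first exact: h.
by apply: (label_compat L na nu) la; exact: convey_reached.
Qed.

(** An edge of [P] is by itself a legal move in the region of its torso, so the label passes along
    it. *)
Lemma labelled_edge u v : P [set u; v] -> labelled u -> labelled v.
Proof.
move=> Puv; have Ge := PE Puv.
have [n [K [L t]]] := torso_exists cG uPsi fS0 S0s Ge.
have c := convey_edge Puv t.
have pos z : [set u; v] z -> home z n K \/ nbr K z.
  move=> ez; have [Kz|nz] := torso_end t ez; [left|by right].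
  exact: home_torso t ez Kz.
have pu := pos u (or_introl erefl); have pv := pos v (or_intror erefl).
case: n L t c pu pv {pos} => [|n] L t c pu pv; last first.
  rewrite !(region_labelE L) // => -[h|[a [na la ca]]]; [by left|right].
  by exists a; split=> //; exact: convey_trans c.
have nn z : ~ nbr K z.
  by rewrite L => nz; case: (nz) => nG _; apply: nG; exact: nbr_vertices nz.
case: pu pv => [hu|/nn//] [hv|/nn//].
rewrite (labelledE hu) (labelledE hv) /= => /convey_trans; apply.
by rewrite -L.
Qed.

Lemma labelled_const n K (c : Prop) u : Lv n.+1 K -> (forall a, nbr K a -> labelled a <-> c) ->
  home u n.+1 K \/ nbr K u -> labelled u <-> c.
Proof.
move=> L hc hu; rewrite (region_labelE L hu).
have [K' [L' s nK']] := Lv_parent cG uPsi fS0 S0s L.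
have hc' a : nbr K a -> label n a <-> c.
  move=> na; have E := labelledE (home_nbr cG uPsi fS0 S0s L' L s na).
  by rewrite -E; exact: hc.
have [_ _ [a0 na0]] := Lv_conn cG uPsi fS0 S0s L.
split=> [[h|[a [na la _]]]|cc]; first exact: (hc' a0 na0).1 (h a0 na0).
  exact: (hc' a na).1 la.
by left=> a na; exact: (hc' a na).2 cc.
Qed.

(** A constant boundary label passes to the vertices whose home is the region. These contain the
    boundaries of its subregions, so the argument descends through all levels. *)
Lemma labelled_const_below n K (c : Prop) : Lv n.+1 K ->
  (forall a, nbr K a -> labelled a <-> c) -> forall u, K u -> labelled u <-> c.
Proof.
move=> L hc u Ku.
have below d K' : Lv (n + d).+1 K' -> K' `<=` K -> forall a, nbr K' a -> labelled a <-> c.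
  elim: d K' => [|d IH] K' L' s a na.
    rewrite addn0 in L'; have [v K'v] := Lv_ne cG uPsi fS0 S0s L'.
    by apply: hc; rewrite (Lv_eq uPsi fS0 L L' (s v K'v) K'v).
  rewrite addnS in L'; have [K'' [L'' s' nK'']] := Lv_parent cG uPsi fS0 S0s L'.
  have [v K'v] := Lv_ne cG uPsi fS0 S0s L'.
  apply: (labelled_const L'').
    apply: IH => //; apply: (Lv_below cG uPsi fS0 S0s _ L L'' (s v K'v) (s' v K'v)).
    by rewrite ltnS leq_addr.
  by left; exact: (home_nbr cG uPsi fS0 S0s L'' L' s' na).
have Gu := Lv_vertices cG uPsi fS0 S0s L Ku.
have [m [K' hu]] := home_exists cG uPsi fS0 S0s Gu.
have nm : n < m.
  rewrite ltnNge; apply/negP => mn; have [_ _ nh] := hu.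
  have [K'' L'' s] := Lv_up cG uPsi fS0 S0s (mn : m.+1 <= n.+1) L.
  exact: (nh K'' L'' (s u Ku)).
case: m hu nm => // m hu; rewrite ltnS => nm; have [L' K'u _] := hu.
apply: (labelled_const L'); last by left.
apply: (below (m - n)); first by rewrite subnKC.
exact: (Lv_below cG uPsi fS0 S0s _ L L' Ku K'u).
Qed.

Lemma labelled_vertices : labelled `<=` vertices G.
Proof. by move=> v [n [K [[L Kv _] _]]]; exact: (Lv_vertices cG uPsi fS0 S0s L). Qed.

Lemma home_start z : S0 z -> home z 0 (vertices G).
Proof.
move=> Sz; split=> //; first exact: ends_finite.2.
by move=> K' L' K'z; apply: (Lv_S0 uPsi fS0 L' (v := z)) => //; left.
Qed.

Lemma labelled_ends : labelled x /\ ~ labelled y.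
Proof.
split; first by rewrite (labelledE (home_start S0s)); exact: convey_refl.
rewrite (labelledE (home_start (or_intror erefl))) => /convey_reached; apply.
by exists [::].
Qed.

(** If some region around [w] has a constant boundary label, labels are constant throughout it and
    the cut stays away from [w]. Otherwise there is a reached jump around [w] at every level, and
    Koenig's lemma produces a play following [g] that converges to [w]. *)
Lemma labelled_closure w : Psi w -> ~ in_closure (delta G labelled) w.
Proof.
move=> Pw; have /choice[K hK] : forall n, exists K, Lv n K /\ lives_in w K.
  by move=> n; have [K L l] := Lv_lives uPsi fS0 n Pw; exists K.
have nest n : K n.+1 `<=` K n.
  have [v [K1v K2v]] := lives_meet (hK n).2 (hK n.+1).2.
  exact: (Lv_below cG uPsi fS0 S0s (leqnSn n) (hK n).1 (hK n.+1).1 K1v K2v).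
have hn n a : nbr (K n.+1) a -> labelled a <-> label n a.
  move=> na; apply: labelledE.
  exact: (home_nbr cG uPsi fS0 S0s (hK n).1 (hK n.+1).1 (@nest n) na).
have [[n [c hc]]|nc] := pselect (exists n c, forall a, nbr (K n.+1) a -> labelled a <-> c).
  have L := (hK n.+1).1; have [cK fK _] := Lv_conn cG uPsi fS0 S0s L.
  move=> /(_ _ (finite_nbr_set fK))[e [Ge [p [ep lp]] [q [eq [_ nlq]]]] [z [ez]]].
  rewrite (region_ecomp cK fK (hK n.+1).2) => Kz.
  have lab t : e t -> labelled t <-> c.
    move=> et; have [Kt|nKt] := pselect (K n.+1 t); first exact: (labelled_const_below L hc).
    apply: hc; split=> //; exists z => //; have [u ut eE] := edge_end Ge et.
    by move: ez; rewrite eE => -[->//|E]; case: nKt; rewrite -E.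
  by apply: nlq; apply/(lab q eq)/(lab p ep).
pose A n : set (seq (cmove * jump)) := [set h | selected n h /\ jreg (state h) = K n].
move=> _; have [||n h [sh E]|a ha] := @koenig _ A behead.
(* Finite because a selected history is determined by its state, here a jump between two vertices of
   a finite boundary. *)
- case=> [|n]; first by apply: sub_finite_set (finite_set1 [::]) => h [].
  have [_ fK _] := Lv_conn cG uPsi fS0 S0s (hK n.+1).1.
  apply: sub_finite_set (finite_image (fun j => pick_in [::] [set h | selected n.+1 h /\ state h = j])
     (finite_image2 (fun a b => (K n.+1, a, b)) fK fK)) => h [sh E] /=.
  have [_ _ ns nt] := selected_state sh; exists (state h).
    by rewrite -E; exists (jsrc (state h)) => //; exists (jtgt (state h)) => //; case: (state h) => -[].
  have [|sp Ep] := @pick_inP _ [::] h [set h' | selected n.+1 h' /\ state h' = state h].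
    by split.
  exact: (selected_unique sp sh Ep).
- case=> [|n]; first by exists [::]; split=> //; have [-> _] := hK 0.
  have [a [b [na nb la lb]]] : exists a b, [/\ nbr (K n.+1) a, nbr (K n.+1) b,
      label n a & ~ label n b].
    apply: contrapT => h; apply: nc; exists n.
    exists (exists2 a, nbr (K n.+1) a & label n a) => a na; rewrite (hn n a na); split.
      by move=> la; exists a.
    move=> [b nb lb]; apply: contrapT => la; apply: h; by exists b, a.
  have [h sh E] : reached n.+1 (K n.+1, a, b).
    by apply: contrapT => nr; apply: lb; apply: (label_compat (hK n.+1).1 na nb nr).
  by exists h; split=> //; rewrite E.
- split; first exact: selected_behead.
  have [L s _ _] := selected_state sh.
  have Lb : Lv n (jreg (state (behead h))).
    by case: n {s L E} sh => [|n] /selected_behead; [move=> ->|move=> /selected_state[]].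
  have [v Kv] := Lv_ne cG uPsi fS0 S0s (hK n.+1).1.
  by apply: (Lv_eq uPsi fS0 Lb (hK n).1 (v := v)); [apply: s; rewrite E|exact: nest].
have sa n : size (a n) = n by have [[/selectedP[]]] := ha n.
pose z n := head (([::], [::]), start) (a n.+1).
have za n : rounds z n = a n.
  elim: n => [|n IH] /=; first by apply/esym/size0nil; exact: sa.
  have [_ E] := ha n; rewrite IH -E /z.
  by case: (a n.+1) (sa n.+1).
apply: (hW (z := z)).
  by move=> n; rewrite za; have [[/selectedP[]]] := ha n.
have zK n : jreg (state (rounds z n)) = K n by rewrite za; have [[]] := ha n.
split; last by exists w => // n; rewrite zK; exact: (hK n.+1).2.
by move=> n; rewrite !zK; split; [exact: (hK n.+1).1|exact: nest].
Qed.

Lemma cut_exists : exists D, [/\ D_Psi Psi D, D S0 & D `&` P = set0].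
Proof.
have [lx ly] := labelled_ends; have [Gx Gy] := adjacent_vertex axy.
exists (delta G labelled); split.
- split; last exact: labelled_closure.
  exact: cut_delta labelled_vertices lx Gy ly.
- by apply/(deltaP _ axy); left.
- rewrite -subset0 => e [de Pe]; have [u [v [uv _ eE]]] := edgeE (PE Pe).
  rewrite eE in de Pe; have [[lu lv]|[lv lu]] := (deltaP _ uv).1 de.
    exact/lv/(labelled_edge Pe).
  by apply: lu; apply: (labelled_edge (u := v)) => //; rewrite setUC.
Qed.

End CutSide.

Theorem circuit_or_cut : borel_ends Psi ->
  (exists C, [/\ C_Psi Psi C, C S0 & C `<=` P `|` [set S0]]) \/
  (exists D, [/\ D_Psi Psi D, D S0 & D `&` P = set0]).
Proof.
move=> bPsi; have bW := converges_borel cG uPsi fS0 S0s bPsi.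
have [[f hf hW]|[g hg hW]] := game_determined ([::], [::]) start legal chosen bW.
  by left; exact: circuit_exists hf hW.
by right; exact: cut_exists hg hW.
Qed.

End EdgeGame.

(** * Orthogonal families *)

Section Orthogonal.
Variable U : choiceType.
Implicit Types (X I J Z C D : set U) (Cs Ds : set (set U)).

Definition free Cs I := forall C, Cs C -> C `<=` I -> C = set0.

Definition spanned Cs I y := exists2 C, Cs C & C y /\ forall z, C z -> z <> y -> I z.

(** Besides even intersections this demands Minty's painting property: for any [P], each [x] is
    completed to a member of [Cs] by elements of [P] or to a member of [Ds] by elements outside
    [P]. *)
Definition orthogonal X Cs Ds := [/\ forall C, Cs C -> C `<=` X,
  forall D, Ds D -> D `<=` X,
  forall C D, Cs C -> Ds D -> finite_set (C `&` D) /\ oddc (C `&` D) = false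
  & forall P x, X x -> spanned Cs P x \/ spanned Ds (~` P) x].

Lemma orthogonal_sym X Cs Ds : orthogonal X Cs Ds -> orthogonal X Ds Cs.
Proof.
move=> [CX DX o1 o2]; split=> // [D C DD CC|P x Xx]; first by rewrite setIC; exact: o1.
have [h|h] := o2 (~` P) x Xx; [by right|left].
case: h => D DD [Dx hD]; exists D => //; split=> // z Dz zx.
by apply: contrapT; exact: hD.
Qed.

Lemma spannedS Cs I I' y : I `<=` I' -> spanned Cs I y -> spanned Cs I' y.
Proof. by move=> s [C CC [Cy h]]; exists C => //; split=> // z Cz /(h z Cz) /s. Qed.

Lemma orthogonal_meet X Cs Ds C D x : orthogonal X Cs Ds -> Cs C -> Ds D -> C x -> D x ->
  exists z, [/\ z <> x, C z & D z].
Proof.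
move=> [_ _ o1 _] CC DD Cx Dx; apply: contrapT => n.
have [_] := o1 C D CC DD; have -> : C `&` D = [set x].
  apply/seteqP; split=> [z [Cz Dz]|z ->//]; apply: contrapT => zx; apply: n.
  by exists z.
by rewrite oddc1.
Qed.

(** A cut inside the union through a spanned element would meet the circuit spanning it in this
    element only. *)
Lemma spanned_free X Cs Ds I J : orthogonal X Cs Ds -> free Ds J ->
  (forall z, I z -> ~ J z) -> forall J', (forall y, J' y -> spanned Cs I y) ->
  (forall z, I z -> ~ J' z) -> free Ds (J `|` J').
Proof.
move=> o fJ IJ J' sp IJ' D DD DJ; have [[z [Dz J'z]]|n] := pselect (exists z, D z /\ J' z).
  have [C CC [Cz hC]] := sp z J'z.
  have [t [tz Ct Dt]] := orthogonal_meet o CC DD Cz Dz.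
  by have := hC t Ct tz; case: (DJ t Dt) => [/[swap]/IJ//|/[swap]/IJ'].
apply: fJ => // z Dz; case: (DJ z Dz) => // J'z.
by case: n; exists z.
Qed.

(** The discarded part is a maximal [Y] that contains no nonempty trace on [Z] of a cut avoiding
    [I]. Finiteness of the traces makes Zorn's lemma applicable. By maximality, each kept element
    lies on a cut avoiding [I] whose other elements in [Z] are discarded. *)
Lemma split_finite X Cs Ds I J Z : orthogonal X Cs Ds -> free Cs I -> free Ds J ->
  (forall z, I z -> ~ J z) -> Z `<=` X -> (forall z, Z z -> ~ I z /\ ~ J z) ->
  (forall D, Ds D -> finite_set (D `&` Z)) ->
  exists I' J', [/\ forall z, Z z <-> I' z \/ J' z, forall z, I' z -> ~ J' z,
    free Cs (I `|` I'), free Ds (J `|` J') & forall y, J' y -> spanned Cs (I `|` I') y].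
Proof.
move=> o fI fJ IJ ZX ZIJ fin; have [CX DX o1 o2] := o.
pose P Y := Y `<=` Z /\ forall D, Ds D -> D `&` Z `<=` Y -> (forall z, D z -> ~ I z) ->
  D `&` Z = set0.
have [Y [[YZ PY] maxY]] : exists Y, P Y /\ forall B, Y `<` B -> ~ P B.
  apply: Zorn_bigcup => F FP tot; split; first by move=> z [Y /FP[YZ _] /YZ].
  move=> D DD DZ DI; have [ne|nF] := pselect (F !=set0); last first.
    rewrite -subset0 => z /DZ [Y FY _]; by apply: nF; exists Y.
  have [Y FY DY] := chain_finite (fin D DD) tot ne DZ.
  exact: (FP Y FY).2.
exists (Z `\` Y), Y.
have cospan i : (Z `\` Y) i -> exists2 D, Ds D & [/\ D i, forall z, D z -> ~ I z
    & forall z, D z -> Z z -> z <> i -> Y z].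
  move=> [Zi nYi]; apply: contrapT => n; apply: (maxY (Y `|` [set i])).
    split; first by move=> z; left.
    by move=> /(_ i (or_intror erefl)).
  split=> [z [/YZ//|->//]|D DD DZ DI].
  have [Di|nDi] := pselect (D i); last first.
    apply: PY => // z [Dz Zz]; case: (DZ z (conj Dz Zz)) => // zi.
    by case: nDi; rewrite -zi.
  case: n; exists D => //; split=> // z Dz Zz zi.
  by case: (DZ z (conj Dz Zz)) => // E; case: zi.
have sp y : Y y -> spanned Cs (I `|` Z `\` Y) y.
  move=> Yy; have [//|[D DD [Dy hD]]] := o2 (I `|` Z `\` Y) y (ZX y (YZ y Yy)).
  have : (D `&` Z) y by split=> //; exact: YZ.
  rewrite (PY D DD) // => [z [Dz Zz]|z Dz Iz].
    apply: contrapT => nYz; apply: (hD z Dz); last by right.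
    by move=> zy; apply: nYz; rewrite zy.
  apply: (hD z Dz); last by left.
  by move=> zy; have [] := ZIJ y (YZ y Yy); rewrite -zy.
have fC : free Cs (I `|` Z `\` Y).
  move=> C CC CI; have [[i [Ci hi]]|n] := pselect (exists i, C i /\ (Z `\` Y) i); last first.
    by apply: fI => // z Cz; case: (CI z Cz) => // hz; case: n; exists z.
  have [D DD [Di DI DZ]] := cospan i hi.
  have [t [ti Ct Dt]] := orthogonal_meet o CC DD Ci Di.
  by case: (CI t Ct) => [It|[Zt nYt]]; [case: (DI t Dt)|case: nYt; exact: DZ].
split=> //.
- move=> z; split=> [Zz|[[]//|/YZ//]].
  by have [Yz|nYz] := pselect (Y z); [right|left].
- by move=> z [].
- apply: (spanned_free (I := I `|` Z `\` Y) o fJ) => //.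
    by move=> z [/IJ//|[Zz _]]; have [] := ZIJ z Zz.
  by move=> z [Iz /YZ/ZIJ[]//|[]].
Qed.

(** Cuts are finite only on each single block [Z K] here, but a circuit meets few blocks. Zorn's
    lemma runs over assignments of whole blocks; the Boolean records whether an element is kept. *)
Lemma split_family X Cs Ds I J (R : choiceType) (Rg : set R) (Z : R -> set U) :
  orthogonal X Cs Ds -> free Cs I -> free Ds J -> (forall z, I z -> ~ J z) ->
  (forall K, Rg K -> Z K `<=` X) -> (forall K z, Rg K -> Z K z -> ~ I z /\ ~ J z) ->
  (forall K K' z, Rg K -> Rg K' -> Z K z -> Z K' z -> K = K') ->
  (forall K D, Rg K -> Ds D -> finite_set (D `&` Z K)) ->
  (forall C, Cs C -> finite_set [set K | Rg K /\ C `&` Z K !=set0]) ->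
  exists I' J', [/\ forall z, I' z \/ J' z <-> exists2 K, Rg K & Z K z,
    forall z, I' z -> ~ J' z, free Cs (I `|` I'), free Ds (J `|` J')
    & forall y, J' y -> spanned Cs (I `|` I') y].
Proof.
move=> o fI fJ IJ ZX ZIJ Zdis finD finC.
pose WI (W : set (U * bool)) := I `|` [set z | W (z, true)].
pose WJ (W : set (U * bool)) := [set z | W (z, false)].
pose P (W : set (U * bool)) := [/\ forall z b, W (z, b) -> exists2 K, Rg K & Z K z,
  forall z, W (z, true) -> ~ W (z, false),
  forall K z z' b, Rg K -> Z K z -> Z K z' -> W (z, b) -> W (z', true) \/ W (z', false),
  free Cs (WI W) & forall y, WJ W y -> spanned Cs (WI W) y].
have [W [[W1 W2 W3 W4 W5] maxW]] : exists W, P W /\ forall B, W `<` B -> ~ P B.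
  apply: Zorn_bigcup => F FP tot; split.
  - by move=> z b [W /FP[h _ _ _ _] /h].
  - move=> z [W FW Wz] [W' FW' W'z].
    have [s|s] := tot W W' FW FW'.
      by have [_ h _ _ _] := FP W' FW'; apply: (h z) => //; exact: s.
    by have [_ h _ _ _] := FP W FW; apply: (h z) => //; exact: s.
  - move=> K z z' b RK Zz Zz' [W FW Wz]; have [_ _ h _ _] := FP W FW.
    by have [?|?] := h K z z' b RK Zz Zz' Wz; [left|right]; exists W.
  - move=> C CC CI; have [[W0 FW0]|nF] := pselect (F !=set0); last first.
      apply: fI => // z Cz; case: (CI z Cz) => // -[W FW _].
      by case: nF; exists W.
    have [[z0 Cz0]|nC] := pselect (C !=set0); last first.
      by rewrite -subset0 => z Cz; apply: nC; exists z.
    have /choice[p hp] : forall K, exists z, Rg K -> C `&` Z K !=set0 -> (C `&` Z K) z.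
      by move=> K; have [[z hz]|n] := pselect (C `&` Z K !=set0); [exists z|exists z0].
    (* A circuit in the union of the chain meets finitely many blocks, so one member of the chain
       has assigned all of them. *)
    have [H FH hH] : exists2 H, F H &
        [set (p K, true) | K in [set K | Rg K /\ C `&` Z K !=set0]] `<=` H.
      apply: chain_finite tot _ _; [exact/finite_image/finC|by exists W0|].
      move=> _ [K [RK nK] <-]; have [Cp Zp] := hp K RK nK.
      by case: (CI (p K) Cp) => [Ip|//]; have [] := ZIJ K _ RK Zp.
    have [H1 H2 H3 H4 H5] := FP H FH; apply: H4 => // z Cz.
    have [Iz|[W FW Wz]] := CI z Cz; [by left|right].
    have [h1 h2 _ _ _] := FP W FW; have [K RK Zz] := h1 _ _ Wz.
    have nK : C `&` Z K !=set0 by exists z.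
    have [Cp Zp] := hp K RK nK.
    have Hp : H (p K, true) by apply: hH; exists K.
    have [//|Hz] := H3 K _ z _ RK Zp Zz Hp.
    have [s|s] := tot W H FW FH; first by case: (H2 z) => //; exact: s.
    by case: (h2 z) => //; exact: s.
  - move=> y [W FW Wy]; have [_ _ _ _ h] := FP W FW.
    apply: spannedS (h y Wy) => z [Iz|Wz]; [by left|right].
    by exists W.
have dis z : WI W z -> ~ WJ W z.
  move=> [Iz Wz|]; last exact: W2.
  by have [K RK Zz] := W1 _ _ Wz; have [] := ZIJ K z RK Zz.
have fJ' : free Ds (J `|` WJ W).
  apply: (spanned_free (I := WI W) o fJ) => // z [/IJ//|Wz].
  by have [K RK Zz] := W1 _ _ Wz; have [] := ZIJ K z RK Zz.
have all K z : Rg K -> Z K z -> W (z, true) \/ W (z, false).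
  move=> RK Zz; apply: contrapT => nz.
  have nW z' b : Z K z' -> ~ W (z', b).
    by move=> Zz' Wz'; apply: nz; exact: (W3 K z' z b RK Zz' Zz Wz').
  have [||||I' [J' [ZE dis' fC fD sp]]] := split_finite (Z := Z K) o W4 fJ'.
  - move=> t h [Jt|Wt]; last exact: (dis t h Wt).
    case: h => [/IJ//|Wt]; have [K' RK' Zt] := W1 _ _ Wt.
    by have [] := ZIJ K' t RK' Zt.
  - exact: ZX.
  - move=> t Zt; have [nI nJ] := ZIJ K t RK Zt.
    by split=> -[//|/=]; exact: nW.
  - by move=> D; exact: finD.
  pose W' := W `|` [set q | if q.2 then I' q.1 else J' q.1].
  have s1 t : WI W t \/ I' t <-> WI W' t.
    split=> [[[?|?]|?]|[?|[?|?]]]; [by left|by right; left|by right; right|by left; left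
      |by left; right|by right].
  have W'E : WI W `|` I' = WI W' by apply/seteqP; split=> t /s1.
  apply: (maxW W').
    split; first by move=> t; left.
    have [hz|hz] := (ZE z).1 Zz.
      by move=> /(_ (z, true) (or_intror hz)); exact: nW.
    by move=> /(_ (z, false) (or_intror hz)); exact: nW.
  split.
  - move=> t b [/W1//|/= ht]; exists K => //; apply/ZE; by case: b ht; [left|right].
  - move=> t [Wt|It] [Wt'|Jt]; [exact: (W2 t)| | |exact: (dis' t)].
      by apply: (nW t true) => //; apply/ZE; right.
    by apply: (nW t false) => //; apply/ZE; left.
  - move=> K' t t' b RK' Zt Zt' h; have [E|nE] := pselect (K' = K).
      by rewrite E in Zt'; have [?|?] := (ZE t').1 Zt'; [left|right]; right.
    case: h => [Wt|/= ht]; first by have [?|?] := W3 K' t t' b RK' Zt Zt' Wt; [left|right]; left.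
    case: nE; apply: (Zdis K' K t) => //; apply/ZE; by case: b ht; [left|right].
  - by rewrite -W'E.
  - move=> t [Wt|Jt]; rewrite -W'E; last exact: sp.
    by apply: spannedS (W5 t Wt) => u; left.
exists [set z | W (z, true)], (WJ W); split=> //.
move=> z; split=> [[/W1//|/W1//]|[K RK Zz]].
exact: (all K z RK Zz).
Qed.

Lemma oddc_even_parts (R : Type) (Rg : set R) (E : R -> set U) (Y : set U) : finite_set Y ->
  (forall K K' z, Rg K -> Rg K' -> E K z -> E K' z -> K = K') ->
  (forall y, Y y -> exists2 K, Rg K & E K y) ->
  (forall K, Rg K -> oddc (Y `&` E K) = false) -> oddc Y = false.
Proof.
move=> fY Edis; have [n] := ubnP #|` fset_set Y|%fset.
elim: n Y fY => // n IH Y fY szY cov ev.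
have [[y Yy]|nY] := pselect (Y !=set0); last first.
  rewrite (_ : Y = set0) ?oddc0 // -subset0 => y Yy; by apply: nY; exists y.
have [K RK Ky] := cov y Yy.
have f1 : finite_set (Y `&` E K) by exact: finite_setIl.
have f2 : finite_set (Y `\` E K) by exact: finite_setD.
have YE : Y = (Y `&` E K) `|` (Y `\` E K).
  by apply/seteqP; split=> [z Yz|z [[]|[]]//]; have [?|?] := pselect (E K z); [left|right].
rewrite YE oddcU // ?ev //; last by move=> z [_ Kz] [_]; apply.
apply: IH => //.
- rewrite ltnS in szY; apply: leq_trans szY; apply: fproper_ltn_card.
  rewrite fproperE; apply/andP; split; apply/fsubsetP.
    by move=> z; rewrite !in_fset_set // !inE => -[].
  by move=> /(_ y); rewrite !in_fset_set // !inE => /(_ Yy)[_]; apply.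
- by move=> z [/cov].
- move=> K' RK'; have [[z [[Yz nKz] K'z]]|n'] := pselect (exists z, ((Y `\` E K) `&` E K') z).
    rewrite -(ev K' RK'); congr oddc; apply/seteqP; split=> t; first by move=> [[]].
    move=> [Yt K't]; split=> //; split=> // Kt; apply: nKz.
    by rewrite (Edis K K' t).
  by rewrite (_ : _ `&` _ = set0) ?oddc0 // -subset0 => z hz; apply: n'; exists z.
Qed.

(** * Partition in stages *)

Section Stages.
Variables (X : set U) (Cs Ds : set (set U)).
Hypothesis orth : orthogonal X Cs Ds.
Variables (R : choiceType) (Rg : nat -> set R) (E : R -> set U).

Definition outside n := [set z | X z /\ forall K, Rg n K -> ~ E K z].

Hypothesis Edis : forall n K K' z, Rg n K -> Rg n K' -> E K z -> E K' z -> K = K'.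
Hypothesis finL : forall n C, Cs C -> finite_set (C `&` outside n).
Hypothesis finR : forall n C, Cs C -> finite_set [set K | Rg n K /\ C `&` E K !=set0].
Hypothesis repD : forall n K Q, Rg n K -> Q `<=` Ds -> exists Q0, [/\ finite_set Q0,
  Q0 `<=` Q & forall D, Q D -> exists2 D', Q0 D' &
    forall C, Cs C -> oddc (C `&` D `&` E K) = oddc (C `&` D' `&` E K)].
Hypothesis repC : forall n K Q, Rg n K -> Q `<=` Cs -> exists Q0, [/\ finite_set Q0,
  Q0 `<=` Q & forall C, Q C -> exists2 C', Q0 C' &
    forall D, Ds D -> oddc (C `&` D `&` E K) = oddc (C' `&` D `&` E K)].
Hypothesis coverX : forall x, X x -> exists n, outside n x.

Definition valid_pair (p : set U * set U) := [/\ p.1 `<=` X, p.2 `<=` X,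
  forall z, p.1 z -> ~ p.2 z, free Cs p.1 & free Ds p.2].

(* The last two conditions say that, up to parities, every cut avoiding the chosen
   part and every circuit avoiding the discarded part is decided inside each region. *)
Definition stage n (p q : set U * set U) := [/\ valid_pair q, p.1 `<=` q.1 /\ p.2 `<=` q.2,
  outside n `<=` q.1 `|` q.2,
  forall K D, Rg n K -> Ds D -> (forall z, D z -> E K z -> ~ p.1 z) -> exists2 D', Ds D' &
    (forall C, Cs C -> oddc (C `&` D `&` E K) = oddc (C `&` D' `&` E K)) /\
    forall z, D' z -> E K z -> q.2 z \/ spanned Ds q.2 z
  & forall K C, Rg n K -> Cs C -> (forall z, C z -> E K z -> ~ q.2 z) -> exists2 C', Cs C' &
    (forall D, Ds D -> oddc (C `&` D `&` E K) = oddc (C' `&` D `&` E K)) /\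
    forall z, C' z -> E K z -> q.1 z \/ spanned Cs q.1 z].

(** The elements outside the regions and the representatives of cuts are settled at once, since a
    circuit meets this set finitely. A cut may meet the representatives of circuits in infinitely
    many regions, so those are settled blockwise. *)
Lemma stage_exists n p : valid_pair p -> exists q, stage n p q.
Proof.
case: p => I J [/= IX JX IJ fI fJ]; have [CX DX o1 o2] := orth.
have /choice[R1 hR1] : forall K, exists Q0, Rg n K -> [/\ finite_set Q0,
    Q0 `<=` [set D | Ds D /\ forall z, D z -> E K z -> ~ I z] &
    forall D, Ds D -> (forall z, D z -> E K z -> ~ I z) -> exists2 D', Q0 D' &
      forall C, Cs C -> oddc (C `&` D `&` E K) = oddc (C `&` D' `&` E K)].
  move=> K; have [RK|nRK] := pselect (Rg n K); last by exists set0.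
  have [|Q0 [f s h]] := repD (Q := [set D | Ds D /\ forall z, D z -> E K z -> ~ I z]) RK.
    by move=> D [].
  by exists Q0 => _; split=> // D DD hD; exact: h.
pose Z1 := [set z | [/\ X z, ~ I z, ~ J z &
  outside n z \/ exists K D, [/\ Rg n K, R1 K D, D z & E K z]]].
(* Circuits and cuts are exchanged here, so that the newly kept elements are spanned, with respect
   to cuts, by discarded ones. *)
have [||||J1 [I1 [ZE dis fD1 fC1 sp1]]] :=
    split_finite (I := J) (J := I) (Z := Z1) (orthogonal_sym orth) fJ fI.
- by move=> z Jz /IJ.
- by move=> z [].
- by move=> z [].
- move=> C CC; apply: (@sub_finite_set _ _ ((C `&` outside n) `|`
    \bigcup_(K in [set K | Rg n K /\ C `&` E K !=set0]) \bigcup_(D in R1 K) (C `&` D))).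
    move=> z [Cz [Xz _ _ [Lz|[K [D [RK RD Dz Ez]]]]]]; first by left.
    by right; exists K; [split=> //; exists z|exists D].
  rewrite finite_setU; split; first exact: finL.
  apply: bigcup_finite; first exact: finR.
  move=> K [RK _]; have [f s _] := hR1 K RK.
  by apply: bigcup_finite => // D /s[DD _]; have [] := o1 C D CC DD.
have XZ z : I1 z \/ J1 z -> Z1 z by move=> h; apply/ZE; tauto.
pose Ia := I `|` I1; pose Ja := J `|` J1.
have disa z : Ia z -> ~ Ja z.
  move=> [Iz|I1z] [Jz|J1z]; [exact: (IJ z)| | |exact: (dis z)].
    by have [_] := XZ z (or_intror J1z).
  by have [_] := XZ z (or_introl I1z).
have /choice[R2 hR2] : forall K, exists Q0, Rg n K -> [/\ finite_set Q0,
    Q0 `<=` [set C | Cs C /\ forall z, C z -> E K z -> ~ Ja z] &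
    forall C, Cs C -> (forall z, C z -> E K z -> ~ Ja z) -> exists2 C', Q0 C' &
      forall D, Ds D -> oddc (C `&` D `&` E K) = oddc (C' `&` D `&` E K)].
  move=> K; have [RK|nRK] := pselect (Rg n K); last by exists set0.
  have [|Q0 [f s h]] := repC (Q := [set C | Cs C /\ forall z, C z -> E K z -> ~ Ja z]) RK.
    by move=> C [].
  by exists Q0 => _; split=> // C CC hC; exact: h.
pose Z2 K := [set z | [/\ X z, ~ Ia z, ~ Ja z & E K z /\ exists2 C, R2 K C & C z]].
have [|||||I2 [J2 [ZE2 dis2 fC2 fD2 sp2]]] :=
    split_family (Rg := Rg n) (Z := Z2) orth fC1 fD1 disa.
- by move=> K _ z [].
- by move=> K z _ [].
- by move=> K K' z RK RK' [_ _ _ [Kz _]] [_ _ _ [K'z _]]; exact: (Edis RK RK' Kz K'z).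
- move=> K D RK DD; have [f s _] := hR2 K RK.
  apply: (@sub_finite_set _ _ (\bigcup_(C in R2 K) (C `&` D))).
    by move=> z [Dz [_ _ _ [_ [C RC Cz]]]]; exists C.
  by apply: bigcup_finite => // C /s[CC _]; have [] := o1 C D CC DD.
- move=> C CC; apply: sub_finite_set (finR n CC) => K [RK [z [Cz [_ _ _ [Ez _]]]]].
  by split=> //; exists z.
have XZ2 z : I2 z \/ J2 z -> [/\ X z, ~ Ia z & ~ Ja z] by move=> /ZE2[K _ []].
exists (Ia `|` I2, Ja `|` J2); split=> /=.
- split=> //=.
  + move=> z [[/IX//|I1z]|I2z]; [by have [] := XZ z (or_introl I1z)|by have [] := XZ2 z (or_introl I2z)].
  + move=> z [[/JX//|I1z]|I2z]; [by have [] := XZ z (or_intror I1z)|by have [] := XZ2 z (or_intror I2z)].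
  + move=> z [az|I2z] [bz|J2z]; [exact: (disa z)| | |exact: (dis2 z)].
      by have [_] := XZ2 z (or_intror J2z).
    by have [_] := XZ2 z (or_introl I2z).
- by split=> z; left; left.
- move=> z Lz; have [Iz|nI] := pselect (I z); first by left; left; left.
  have [Jz|nJ] := pselect (J z); first by right; left; left.
  have /ZE[J1z|I1z] : Z1 z by split=> //; [case: Lz|left].
    by right; left; right.
  by left; left; right.
- move=> K D RK DD hD; have [_ s h] := hR1 K RK; have [D' RD' e] := h D DD hD.
  have [DD' hD'] := s D' RD'; exists D' => //; split=> // z D'z Ez.
  have [Jz|nJ] := pselect (J z); first by left; left; left.
  have /ZE[J1z|I1z] : Z1 z.
    split=> //; [exact: (DX D')|exact: hD'|right].
    by exists K, D'.
    by left; left; right.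
  by right; apply: spannedS (sp1 z I1z) => t; left.
- move=> K C RK CC hC; have [_ s h] := hR2 K RK.
  have [|C' RC' e] := h C CC; first by move=> z Cz Ez az; apply: (hC z Cz Ez); left.
  have [CC' hC'] := s C' RC'; exists C' => //; split=> // z C'z Ez.
  have [az|na] := pselect (Ia z); first by left; left.
  have /ZE2[I2z|J2z] : exists2 K, Rg n K & Z2 K z.
    exists K => //; split=> //; [exact: (CX C')|exact: hC'|split=> //].
    by exists C'.
    by left; right.
  by right; exact: sp2.
Qed.

(** The common elements other than [e] lie in the regions and are odd in number, so they are odd in
    some region. *)
Lemma decomposition_odd n C D e : Cs C -> Ds D -> outside n e -> C e -> D e ->
  (forall z, C z -> D z -> outside n z -> z = e) ->
  ~ forall K, Rg n K -> oddc (C `&` D `&` E K) = false.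
Proof.
move=> CC DD Le Ce De hL hK; have [CX _ o1 _] := orth.
have [fin od] := o1 C D CC DD; move: od.
have -> : C `&` D = [set e] `|` ((C `&` D) `\ e).
  apply/seteqP; split=> [z h|z [->//|[]//]]; have [->|ze] := pselect (z = e); [by left|by right].
rewrite oddcU; [|exact: finite_set1|exact: finite_setD|by move=> z -> [_]; apply].
rewrite oddc1 (@oddc_even_parts _ (Rg n) E) //.
- exact: finite_setD.
- exact: Edis.
- move=> z [[Cz Dz] ze]; apply: contrapT => nz; apply: ze; apply: hL => //; split.
    exact: (CX C).
  by move=> K RK Ez; apply: nz; exists K.
- move=> K RK; rewrite -(hK K RK); congr oddc; apply/seteqP; split=> z.
    by move=> [[]].
  move=> [h Ez]; split=> //; split=> // ze; have [_ nL] := Le.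
  by apply: (nL K RK); rewrite -ze.
Qed.

(** Suppose a circuit [C] in [I] has an element [e] outside the regions of level [n]. Painting gives
    a cut [D] through [e] avoiding all other elements kept so far. In every region [D] can be
    exchanged for a decided cut of the same parity, which misses [C] there, against the oddness
    forced by [e]. The argument for cuts is dual. *)
Theorem partition_exists I0 : I0 `<=` X -> free Cs I0 -> exists I J,
  [/\ I0 `<=` I, forall z, X z <-> I z \/ J z, forall z, I z -> ~ J z, free Cs I & free Ds J].
Proof.
move=> IX fI; have [CX DX o1 o2] := orth.
have /choice[next hnext] : forall np : nat * (set U * set U), exists q,
    valid_pair np.2 -> stage np.1 np.2 q.
  move=> [n p] /=; have [v|nv] := pselect (valid_pair p); last by exists p.
  by have [q hq] := stage_exists n v; exists q.
pose s := fix s n := if n is k.+1 then next (k, s k) else (I0, set0).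
have vs n : valid_pair (s n).
  elim: n => [|n IH] /=; last by have [] := hnext (n, s n) IH.
  by split=> [//|z //|z _ //|//|D _ /=]; rewrite subset0.
have st n : stage n (s n) (s n.+1) := hnext (n, s n) (vs n).
have mono n m : n <= m -> (s n).1 `<=` (s m).1 /\ (s n).2 `<=` (s m).2.
  move=> /subnKC <-; elim: (m - n) => [|d [s1 s2]].
    by rewrite addn0; split.
  rewrite addnS; have [_ [t1 t2] _ _ _] := st (n + d).
  by split; [exact: subset_trans s1 t1|exact: subset_trans s2 t2].
pose I := \bigcup_n (s n).1; pose J := \bigcup_n (s n).2.
have dis z : I z -> ~ J z.
  move=> [n _ In] [m _ Jm]; have [_ _ h _ _] := vs (maxn n m).
  apply: (h z); first exact: (mono _ _ (leq_maxl n m)).1.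
  exact: (mono _ _ (leq_maxr n m)).2.
have sI n : (s n).1 `<=` I by move=> z hz; exists n.
have sJ n : (s n).2 `<=` J by move=> z hz; exists n.
have dec n z : outside n z -> (s n.+1).1 z \/ (s n.+1).2 z.
  by have [_ _ h _ _] := st n; move=> /h.
exists I, J; split=> //; first exact: (sI 0).
- move=> z; split=> [/coverX[n /dec[h|h]]|[[n _]|[n _]]]; [left; exact: sI h|right; exact: sJ h| |].
    by have [h _ _ _ _] := vs n; exact: h.
  by have [_ h _ _ _] := vs n; exact: h.
- move=> C CC CI; rewrite -subset0 => e Ce; have [n Le] := coverX (CX C CC e Ce).
  have Ie : (s n.+1).1 e.
    by have [//|/sJ Je] := dec n e Le; case: (dis e) => //; exact: CI.
  have [_ _ _ fr _] := vs n.+1; have [_ [m1 m2] _ h _] := st n.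
  have [[C' CC' [C'e hC']]|[D DD [De hD]]] := o2 (s n.+1).1 e (CX C CC e Ce).
    suff E0 : C' = set0 by rewrite E0 in C'e.
    by apply: fr => // z C'z; have [->//|ze] := pselect (z = e); exact: hC'.
  apply: (decomposition_odd CC DD Le Ce De) => [z Cz Dz Lz|K RK].
    apply: contrapT => ze; apply: (hD z Dz ze); have [//|/sJ Jz] := dec n z Lz.
    by case: (dis z) => //; exact: CI.
  have [|D' DD' [e' hD']] := h K D RK DD.
    move=> z Dz Ez Iz; apply: (hD z Dz); last exact: m1.
    by move=> ze; have [_ nL] := Le; apply: (nL K RK); rewrite -ze.
  rewrite e' // (_ : _ `&` _ = set0) ?oddc0 // -subset0 => z [[Cz D'z] Ez].
  have [/sJ Jz|[D'' DD'' [D''z hz]]] := hD' z D'z Ez; first exact: (dis z (CI z Cz)).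
  (* The cut spanning [z] from discarded elements meets [C] a second time, in an element that would
     be both kept and discarded. *)
  have [t [tz Ct Dt]] := orthogonal_meet orth CC DD'' Cz D''z.
  exact: (dis t (CI t Ct) (sJ n.+1 t (hz t Dt tz))).
- move=> D DD DJ; rewrite -subset0 => e De; have [n Le] := coverX (DX D DD e De).
  have Je : (s n.+1).2 e.
    by have [/sI Ie|//] := dec n e Le; case: (dis e) => //; exact: DJ.
  have [_ _ _ _ fr] := vs n.+1; have [_ [m1 m2] _ _ h] := st n.
  have [[C CC [Ce hC]]|[D' DD' [D'e hD']]] := o2 (~` (s n.+1).2) e (DX D DD e De); last first.
    suff E0 : D' = set0 by rewrite E0 in D'e.
    apply: fr => // z D'z; have [->//|ze] := pselect (z = e).
    by apply: contrapT; exact: hD'.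
  apply: (decomposition_odd CC DD Le Ce De) => [z Cz Dz Lz|K RK].
    apply: contrapT => ze; apply: (hC z Cz ze); have [/sI Iz|//] := dec n z Lz.
    by case: (dis z) => //; exact: DJ.
  have [|C' CC' [e' hC']] := h K C RK CC.
    move=> z Cz Ez; apply: (hC z Cz).
    by move=> ze; have [_ nL] := Le; apply: (nL K RK); rewrite -ze.
  rewrite e' // (_ : _ `&` _ = set0) ?oddc0 // -subset0 => z [[C'z Dz] Ez].
  have [/sI Iz|[C'' CC'' [C''z hz]]] := hC' z C'z Ez; first exact: (dis z Iz (DJ z Dz)).
  have [t [tz Ct Dt]] := orthogonal_meet orth CC'' DD C''z Dz.
  exact: (dis t (sI n.+1 t (hz t Ct tz)) (DJ t Dt)).
Qed.

End Stages.

End Orthogonal.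

(** * The matroid *)

Lemma finite_powerset (T : choiceType) (B : set T) : finite_set B ->
  finite_set [set A | A `<=` B].
Proof.
move=> fB; have [Y BE] := (@finite_fsetP _ B).1 fB.
apply: sub_finite_set (finite_image (fun Z : {fset T} => [set` Z]) (finite_fset (fpowerset Y))).
move=> A /= AB; have fA : finite_set A := sub_finite_set AB fB.
exists (fset_set A); last by rewrite fset_setK.
rewrite /= fpowersetE; apply/fsubsetP => z; rewrite in_fset_set // inE => /AB.
by rewrite BE.
Qed.

Lemma finite_representatives (A B : Type) (Q : set A) (k : A -> B) : finite_set (k @` Q) ->
  exists Q0, [/\ finite_set Q0, Q0 `<=` Q & forall a, Q a -> exists2 a', Q0 a' & k a = k a'].
Proof.
move=> fk; have [[a0 Qa0]|nQ] := pselect (Q !=set0); last first.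
  by exists set0; split=> // a Qa; case: nQ; exists a.
have /choice[g hg] : forall b, exists a, Q a /\ ((k @` Q) b -> k a = b).
  by move=> b; have [[a Qa <-]|n] := pselect ((k @` Q) b); [exists a|exists a0; split=> // /n].
exists (g @` (k @` Q)); split; first exact: finite_image.
- by move=> _ [b _ <-]; have [] := hg b.
- move=> a Qa; have ka : (k @` Q) (k a) by exists a.
  by exists (g (k a)); [exists (k a)|have [_ ->] := hg (k a)].
Qed.

Section EdgeMatroid.
Variables (T : choiceType) (G : graph T) (Psi : set (graph_end G)).
Hypothesis cG : connected_graph G.
Hypothesis uPsi : forall w, Psi w -> undominated w.
Hypothesis bPsi : borel_ends Psi.
Implicit Types (C D I J X : set (set T)) (e : set T).

Lemma circuit_edges C : C_Psi Psi C -> C `<=` edges G.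
Proof. by case. Qed.

Lemma cut_edges D : D_Psi Psi D -> D `<=` edges G.
Proof. by move=> [[A [_ _ _ ->]] _] e []. Qed.

(** * Restriction to an edge set *)

Section Restriction.
Variable X : set (set T).
Hypothesis XE : X `<=` edges G.

Definition circuits_in : set (set (set T)) := [set C | C_Psi Psi C /\ C `<=` X].
(** As in a restriction of a matroid, cuts leave their traces on [X], whereas circuits have to lie
    inside [X]. *)
Definition cuts_in : set (set (set T)) := [set D `&` X | D in D_Psi Psi].

(** Evenness is inherited from the whole graph; the painting property is the alternative given by
    the edge game for [e] and the other edges of [P] in [X]. *)
Lemma edges_orthogonal : orthogonal X circuits_in cuts_in.
Proof.
split=> [C []//|_ [D _ <-] e []//|C _ [CC CX] [D DD <-]|P e Xe].
  have -> : C `&` (D `&` X) = C `&` D.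
    by apply/seteqP; split=> [z [Cz []]|z [Cz Dz]] //; do !split=> //; exact: CX.
  exact: (CD_even cG uPsi).
have [x [y [xy _ eE]]] := edgeE (XE Xe).
pose P' := [set z | [/\ X z, P z & z <> e]].
have [||[C [CC Ce CP]]|[D [DD De DP]]] :=
    @circuit_or_cut _ G Psi P' x y cG uPsi xy _ _ bPsi.
- by move=> z [/XE].
- by rewrite -eE => -[].
- left; rewrite -eE in Ce CP; exists C; last first.
    by split=> // z Cz ze; have [[]|] := CP z Cz.
  by split=> // z /CP[[]|->].
- right; rewrite -eE in De; exists (D `&` X); first by exists D.
  split=> // z [Dz Xz] ze Pz.
  by have : (D `&` P') z by []; rewrite DP.
Qed.

Section Levels.
Variable s0 : T.
Hypothesis Gs0 : vertices G s0.

Let fS0 : finite_vertex_set G [set s0] := finite_vertex_set1 Gs0.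
Let S0s : [set s0] s0 := erefl.
Local Notation Lv := (Lv Psi [set s0]).

Lemma touching_unique n K K' e : Lv n.+1 K -> Lv n.+1 K' -> touching G K e ->
  touching G K' e -> K = K'.
Proof.
move=> L L' [Ge [u [eu Ku]]] [_ [v [ev K'v]]].
have [Kv|nKv] := pselect (K v); first exact: (Lv_eq uPsi fS0 L L' Kv K'v).
case: (Lv_apart uPsi fS0 L' L K'v); split=> //; exists u => //.
have [t tv eE] := edge_end Ge ev.
by move: eu; rewrite eE => -[->//|E]; case: nKv; rewrite -E.
Qed.

(** The edges accumulate at an end of [Psi], and its region of level [n.+1] is the component that
    its finite neighbourhood cuts off. *)
Lemma infinite_touching C M n : C_Psi Psi C -> M `<=` C -> infinite_set M ->
  exists2 K, Lv n.+1 K & infinite_set (M `&` touching G K).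
Proof.
move=> CC MC iM; have [e Me] : M !=set0.
  apply: contrapT => n0; apply: iM; rewrite (_ : M = set0) // -subset0 => z Mz.
  by apply: n0; exists z.
have [x [y [_ _ eE]]] := edgeE (circuit_edges CC (MC e Me)).
have ex : e x by rewrite eE; left.
have [w Pw hw] := infinite_end cG uPsi CC (MC e Me) ex MC iM.
have [K L l] := Lv_lives uPsi fS0 n.+1 Pw; exists K => //.
have [c f _] := Lv_conn cG uPsi fS0 S0s L.
by have := hw _ (finite_nbr_set f); rewrite (region_ecomp c f l).
Qed.

Lemma circuit_outside_finite n C : circuits_in C ->
  finite_set (C `&` outside X (fun n => Lv n.+1) (touching G) n).
Proof.
move=> [CC _]; apply: contrapT => /(infinite_touching n CC)[|K L]; first by move=> e [].
apply; rewrite (_ : _ `&` _ = set0) // -subset0 => e [[_ [_ nt]]].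
exact: nt.
Qed.

Lemma circuit_regions_finite n C : circuits_in C ->
  finite_set [set K | Lv n.+1 K /\ C `&` touching G K !=set0].
Proof.
move=> [CC _]; apply: contrapT => inf.
have /choice[p hp] : forall K, exists e, Lv n.+1 K /\ C `&` touching G K !=set0 ->
    (C `&` touching G K) e.
  move=> K; have [[_ [e he]]|n'] := pselect (Lv n.+1 K /\ C `&` touching G K !=set0).
    by exists e.
  by exists set0 => /n'.
pose M := p @` [set K | Lv n.+1 K /\ C `&` touching G K !=set0].
have [||K L] := @infinite_touching C M n CC.
- by move=> _ [K /hp[Ce _] <-].
- move=> fM; apply: inf; pose q e := pick_in set0 [set K | Lv n.+1 K /\ touching G K e].
  apply: sub_finite_set (finite_image q fM) => K hK; have [_ t] := hp K hK.
  exists (p K); first by exists K.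
  have [|Lq tq] := @pick_inP _ set0 K [set K' | Lv n.+1 K' /\ touching G K' (p K)].
    by split=> //; exact: hK.1.
  exact: (touching_unique Lq hK.1 tq t).
apply; apply: sub_finite_set (finite_set1 (p K)) => _ [[K' hK' <-] tK].
by have [_ tK'] := hp K' hK'; rewrite (touching_unique L hK'.1 tK tK').
Qed.

(** A trace may come from several cuts; one side of one of them is fixed. *)
Definition cut_side D : set T := pick_in set0
  [set A | [/\ A `<=` vertices G, D_Psi Psi (delta G A) & D = delta G A `&` X]].

Lemma cut_sideP D : cuts_in D -> [/\ cut_side D `<=` vertices G,
  D_Psi Psi (delta G (cut_side D)) & D = delta G (cut_side D) `&` X].
Proof.
move=> [D0 DD <-]; have [[A [AV _ _ E]] _] := DD.
have ED : D0 = delta G A by rewrite E.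
apply: (@pick_inP _ set0 A [set A | [/\ A `<=` vertices G, D_Psi Psi (delta G A)
  & D0 `&` X = delta G A `&` X]]).
by split=> //; rewrite -ED.
Qed.

Lemma parity_side n K C D : Lv n.+1 K -> circuits_in C -> cuts_in D ->
  oddc (C `&` D `&` touching G K) = oddc (C `&` bdry G K (cut_side D `&` nbr G K)).
Proof.
move=> L [CC CX] DD; have [AV DA DE] := cut_sideP DD.
have [c f _] := Lv_conn cG uPsi fS0 S0s L.
have -> : C `&` D = C `&` delta G (cut_side D).
  rewrite {1}DE; apply/seteqP; split=> z [Cz]; first by case.
  by move=> dz; do !split=> //; exact: CX.
rewrite (parity_region cG uPsi CC DA AV c f); congr oddc; congr setI.
apply/seteqP; split=> e [Ge eK [z [ez [nz Az]]]]; split=> //; exists z; split=> //.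
by split=> //; case: Az.
Qed.

(** Cuts whose sides have the same trace on the finite set [nbr G K] have equal parities in [K] with
    every circuit. *)
Lemma cut_representatives n K (Q : set (set (set T))) : Lv n.+1 K -> Q `<=` cuts_in ->
  exists Q0, [/\ finite_set Q0, Q0 `<=` Q & forall D, Q D -> exists2 D', Q0 D' &
    forall C, circuits_in C -> oddc (C `&` D `&` touching G K) = oddc (C `&` D' `&` touching G K)].
Proof.
move=> L QD; have [c f _] := Lv_conn cG uPsi fS0 S0s L.
have [|Q0 [f0 s0' h]] := @finite_representatives _ _ Q (fun D => cut_side D `&` nbr G K).
  by apply: sub_finite_set (finite_powerset f) => _ [D _ <-] z [].
exists Q0; split=> // D QDD; have [D' QD' E] := h D QDD; exists D' => // C CC.
by rewrite !(parity_side L CC) ?E //; [exact/QD/s0'|exact: QD].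
Qed.

Lemma circuit_representatives n K (Q : set (set (set T))) : Lv n.+1 K -> Q `<=` circuits_in ->
  exists Q0, [/\ finite_set Q0, Q0 `<=` Q & forall C, Q C -> exists2 C', Q0 C' &
    forall D, cuts_in D -> oddc (C `&` D `&` touching G K) = oddc (C' `&` D `&` touching G K)].
Proof.
move=> L QC; have [c f _] := Lv_conn cG uPsi fS0 S0s L.
(* A circuit is recorded by the traces of cuts against which it is odd, which leaves finitely many
   possibilities. *)
pose k C : set (set T) := [set A | A `<=` nbr G K /\ oddc (C `&` bdry G K A)].
have [|Q0 [f0 s0' h]] := @finite_representatives _ _ Q k.
  by apply: sub_finite_set (finite_powerset (finite_powerset f)) => _ [C _ <-] z [].
exists Q0; split=> // C QCC; have [C' QC' E] := h C QCC; exists C' => // D DD.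
rewrite !(parity_side L) //; [|exact/QC/s0'|exact: QC].
set A := cut_side D `&` nbr G K; have AK : A `<=` nbr G K by move=> z [].
have hA : k C A <-> k C' A by rewrite E.
by apply/idP/idP => o; [have [] := hA.1 (conj AK o)|have [] := hA.2 (conj AK o)].
Qed.

Lemma edges_covered e : X e ->
  exists n, outside X (fun n => Lv n.+1) (touching G) n e.
Proof.
move=> Xe; have [u [v [uv _ eE]]] := edgeE (XE Xe); have [Gu Gv] := adjacent_vertex uv.
have [N hN] := Lv_leave cG uPsi fS0 S0s Gu; have [N' hN'] := Lv_leave cG uPsi fS0 S0s Gv.
exists (maxn N N'); split=> // K L [_ [z [+ Kz]]]; rewrite eE => -[E|E]; rewrite E in Kz.
  exact: (hN _ K (leq_maxl _ _) L).
exact: (hN' _ K (leq_maxr _ _) L).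
Qed.

End Levels.

Lemma edge_partition I0 : I0 `<=` X -> free circuits_in I0 -> exists I J,
  [/\ I0 `<=` I, forall z, X z <-> I z \/ J z, forall z, I z -> ~ J z, free circuits_in I
    & free cuts_in J].
Proof.
have [[s0 Gs0] _] := cG; apply: (@partition_exists _ X circuits_in cuts_in edges_orthogonal _
  (fun n => Lv Psi [set s0] n.+1) (touching G)).
- exact: touching_unique.
- exact: circuit_outside_finite.
- exact: circuit_regions_finite.
- exact: cut_representatives.
- exact: circuit_representatives.
- exact: edges_covered.
Qed.

End Restriction.

(** * The matroid axioms *)

Definition indep_edges : set (set (set T)) := [set I | I `<=` edges G /\ free (C_Psi Psi) I].

Lemma span_or_cut P e : P `<=` edges G -> edges G e ->
  spanned (C_Psi Psi) P e \/ spanned (D_Psi Psi) (~` P) e.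
Proof.
move=> PE Ge; have [_ _ _ o2] := edges_orthogonal (@subset_refl _ (edges G)).
have [[C [CC _] h]|[_ [D DD <-] [[De _] h]]] := o2 P e Ge; [left; by exists C|right].
by exists D => //; split=> // z Dz; apply: h; split=> //; exact: (cut_edges DD).
Qed.

Lemma circuit_cut_meet C D e : C_Psi Psi C -> D_Psi Psi D -> C e -> D e ->
  exists z, [/\ z <> e, C z & D z].
Proof.
move=> CC DD Ce De; have o := edges_orthogonal (@subset_refl _ (edges G)).
have [||||z [ze Cz [Dz _]]] := orthogonal_meet (C := C) (D := D `&` edges G) (x := e) o.
- by split=> //; exact: circuit_edges.
- by exists D.
- by [].
- by split=> //; exact: (cut_edges DD).
by exists z.
Qed.

Lemma dependent_span I e : indep_edges I -> edges G e -> ~ I e ->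
  ~ indep_edges (e |` I) -> spanned (C_Psi Psi) I e.
Proof.
move=> [IE fI] Ge nIe dep; apply: contrapT => ns; apply: dep; split.
  by move=> z [->//|/IE].
move=> C CC Cs; have [Ce|nCe] := pselect (C e).
  case: ns; exists C => //; split=> // z Cz ze.
  by case: (Cs z Cz).
by apply: fI => // z Cz; case: (Cs z Cz) => // E; case: nCe; rewrite -E.
Qed.

Lemma span_dependent I e : ~ I e -> spanned (C_Psi Psi) I e -> ~ indep_edges (e |` I).
Proof.
move=> nI [C CC [Ce h]] [_ /(_ C CC)] fr; have E : C = set0; last by rewrite E in Ce.
by apply: fr => z Cz; have [->|ze] := pselect (z = e); [left|right; exact: h].
Qed.

Lemma maximal_span I : indep_edges I ->
  (forall e, edges G e -> ~ I e -> spanned (C_Psi Psi) I e) -> maximal_in indep_edges I.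
Proof.
move=> iI sp; split=> // J iJ IJ; apply/seteqP; split=> // e Je; apply: contrapT => nIe.
apply: (span_dependent nIe (sp e (iJ.1 e Je) nIe)); split.
  by move=> z [->|/iI.1//]; exact: iJ.1.
move=> C CC Cs; apply: iJ.2 => // z /Cs[->//|]; exact: IJ.
Qed.

Lemma base_span J e : maximal_in indep_edges J -> edges G e -> ~ J e -> spanned (C_Psi Psi) J e.
Proof.
move=> [iJ mJ] Ge nJe; apply: dependent_span => // iJe.
by apply: nJe; rewrite -(mJ _ iJe) => [|z]; [left|right].
Qed.

(** If nothing in [J] augments [I], then [I] spans [J]. An edge [e] not spanned by [I] lies on a cut
    otherwise avoiding [I]; the circuit spanning [e] from [J] meets this cut again at some [z], and
    the circuit spanning [z] from [I] would meet it in [z] only. *)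
Lemma edges_augment I J : indep_edges I -> ~ maximal_in indep_edges I ->
  maximal_in indep_edges J -> exists2 x, (J `\` I) x & indep_edges (x |` I).
Proof.
move=> iI nI mJ; apply: contrapT => n; apply: nI; apply: maximal_span => // e Ge nIe.
have spJ z : J z -> ~ I z -> spanned (C_Psi Psi) I z.
  move=> Jz nIz; apply: dependent_span => //; first exact: (mJ.1).1.
  by move=> h; apply: n; exists z.
have [Je|nJe] := pselect (J e); first exact: spJ.
have [//|[D DD [De hD]]] := span_or_cut iI.1 Ge.
have [C CC [Ce hC]] := base_span mJ Ge nJe.
have [z [ze Cz Dz]] := circuit_cut_meet CC DD Ce De.
have [C' CC' [C'z hC']] := spJ z (hC z Cz ze) (hD z Dz ze).
have [t [tz C't Dt]] := circuit_cut_meet CC' DD C'z Dz.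
have It := hC' t C't tz; case: (hD t Dt) => // te.
by apply: nIe; rewrite -te.
Qed.

(** In a partition of [X] into a part without circuits and a part without traces of cuts, an edge
    not spanned by the first would lie on a nonempty trace inside the second. *)
Lemma edges_maximal I X : indep_edges I -> I `<=` X -> X `<=` edges G ->
  exists J, [/\ indep_edges J, I `<=` J, J `<=` X &
    forall e, X e -> ~ J e -> spanned (C_Psi Psi) J e].
Proof.
move=> [IE fI] IX XE.
have [|B [J [IB XBJ dis fB fJ]]] := edge_partition XE IX.
  by move=> C [CC _]; exact: fI.
have BX : B `<=` X by move=> z Bz; apply/XBJ; left.
exists B; split=> //; first split; first exact: subset_trans BX XE.
  by move=> C CC CB; apply: fB => //; split=> //; exact: subset_trans CB BX.
move=> e Xe nBe; have [_ _ _ o2] := edges_orthogonal XE.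
have [[C [CC _] h]|[D DD [De h]]] := o2 B e Xe; first by exists C.
have E : D = set0; last by rewrite E in De.
have [D0 _ ED] := DD; apply: fJ => // z Dz; have Xz : X z by move: Dz; rewrite -ED => -[].
case/XBJ: Xz => // Bz; have [ze|ze] := pselect (z = e); last by case: (h z Dz ze).
by case: nBe; rewrite -ze.
Qed.

Fact edges_indep_ground I : indep_edges I -> I `<=` edges G.
Proof. by case. Qed.

Fact edges_indep_set0 : indep_edges set0.
Proof. by split=> // C _; rewrite subset0. Qed.

Fact edges_indep_subset I J : indep_edges J -> I `<=` J -> indep_edges I.
Proof.
move=> [JE fJ] IJ; split; first exact: subset_trans IJ JE.
by move=> C CC CI; apply: fJ => //; exact: subset_trans CI IJ.
Qed.

Fact edges_indep_maximal I X : indep_edges I -> I `<=` X -> X `<=` edges G ->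
  maximal_in [set J | [/\ indep_edges J, I `<=` J & J `<=` X]] !=set0.
Proof.
move=> iI IX XE; have [J [iJ IJ JX sp]] := edges_maximal iI IX XE.
exists J; split=> // B [iB IB BX] JB; apply/seteqP; split=> // e Be; apply: contrapT => nJe.
apply: (span_dependent nJe (sp e (BX e Be) nJe)).
by apply: (edges_indep_subset iB) => z [->//|/JB].
Qed.

Definition edge_matroid : matroid (edges G) :=
  Matroid edges_indep_ground edges_indep_set0 edges_indep_subset edges_augment
    edges_indep_maximal.

Lemma minimal_dependent (F : set (set (set T))) (dep : set (set T) -> Prop) :
  (forall A, F A -> A `<=` edges G) ->
  (forall A, A `<=` edges G -> dep A <-> exists B, [/\ F B, B !=set0 & B `<=` A]) ->
  minimal_in [set A | A `<=` edges G /\ dep A] = minimal_nonempty F.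
Proof.
move=> FE hdep; apply/seteqP; split=> A.
  move=> [[AE /(hdep A AE)[B [FB nB BA]]] mA].
  have dF B' : F B' -> B' !=set0 -> B' `<=` edges G /\ dep B'.
    move=> FB' nB'; have B'E := FE B' FB'; split=> //.
    by apply/(hdep B' B'E); exists B'; split=> // z.
  have E : B = A by apply: mA => //; exact: dF.
  rewrite E in FB nB; split=> // B' [FB' nB'] B'A; apply: mA => //; exact: dF.
move=> [[FA nA] mA]; have AE := FE A FA; split.
  by split=> //; apply/(hdep A AE); exists A; split=> // z.
move=> B [BE /(hdep B BE)[B' [FB' nB' B'B]]] BA.
have E : B' = A by apply: mA => //; exact: subset_trans B'B BA.
by apply/seteqP; split=> //; rewrite -{1}E.
Qed.

Lemma not_free (F : set (set (set T))) A :
  ~ free F A <-> exists B, [/\ F B, B !=set0 & B `<=` A].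
Proof.
split=> [n|[B [FB [e Be] BA]] fr]; last by rewrite (fr B FB BA) in Be.
apply: contrapT => h; apply: n => B FB BA; rewrite -subset0 => e Be; apply: h.
by exists B; split=> //; exists e.
Qed.

Lemma edge_matroid_circuit : circuit edge_matroid = minimal_nonempty (C_Psi Psi).
Proof.
apply: minimal_dependent; first exact: circuit_edges.
move=> A AE; rewrite -not_free; split=> [n fr|n [_ fr]]; [by apply: n|exact: n].
Qed.

(** If [A] contains no cut, its complement spans every edge, so a maximal independent subset of the
    complement is a base of the matroid. Conversely, a cut in the complement of a base would meet
    the circuit spanning one of its edges in that edge only. *)
Lemma edge_matroid_cocircuit : cocircuit edge_matroid = minimal_nonempty (D_Psi Psi).
Proof.
apply: minimal_dependent; first exact: cut_edges.
move=> A AE; split=> [nd|[D [DD [e De] DA]] [B bB AB]].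
  apply/not_free => fr; apply: nd.
  have [|||B [iB _ BA sp]] := @edges_maximal set0 (edges G `\` A).
  - exact: edges_indep_set0.
  - exact: sub0set.
  - by move=> z [].
  exists B; last by move=> z Az; split; [exact: AE|move=> /BA[]].
  apply: maximal_span => // e Ge nBe.
  have [Ae|nAe] := pselect (A e); last exact: sp.
  have [//|[D DD [De hD]]] := span_or_cut iB.1 Ge.
  have [|[C CC [Ce hC]]|[D' DD' [D'e hD']]] := @span_or_cut (edges G `\` A) e _ Ge.
  - by move=> z [].
  - have [z [ze Cz Dz]] := circuit_cut_meet CC DD Ce De.
    have [C' CC' [C'z hC']] := sp z (hC z Cz ze) (hD z Dz ze).
    have [t [tz C't Dt]] := circuit_cut_meet CC' DD C'z Dz.
    have Bt := hC' t C't tz; case: (hD t Dt) => // te.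
    by apply: nBe; rewrite -te.
  - have E : D' = set0; last by rewrite E in D'e.
    apply: fr => // z D'z; apply: contrapT => nAz.
    have [ze|ze] := pselect (z = e); first by apply: nAz; rewrite ze.
    by apply: (hD' z D'z ze); split=> //; exact: (cut_edges DD').
have [Ge nBe] := AB e (DA e De).
have [C CC [Ce hC]] := base_span bB Ge nBe.
have [z [ze Cz Dz]] := circuit_cut_meet CC DD Ce De.
by have [_ nBz] := AB z (DA z Dz); apply: nBz; exact: hC.
Qed.

End EdgeMatroid.

Theorem theorem4p10 (T : choiceType) (G : graph T) (Psi : set (graph_end G)) :
  infinite_set (vertices G) ->
  connected_graph G ->
  borel_ends Psi ->
  (forall w, Psi w -> undominated w) ->
  exists M : matroid (edges G),
    circuit M = minimal_nonempty (C_Psi Psi) /\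
    cocircuit M = minimal_nonempty (D_Psi Psi).
Proof.
move=> _ cG bPsi uPsi; exists (edge_matroid cG uPsi bPsi).
by split; [exact: edge_matroid_circuit|exact: edge_matroid_cocircuit].
Qed.
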